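(* Suppose $G\in C^2(\mathrm{cl}(X\times Y\times Z))$ and $\pi$ satisfy hypotheses (G0)-(G6) stated in the context. In case $\bar z=+\infty$, assume also that the homeomorphisms of (G1) are uniformly bi-Lipschitz (with bi-Lipschitz constants independent of $x\in X$). Then the following statements are equivalent: (v) there exists $\lambda>0$ such that for every $G$-segment $t\mapsto(x,y_t(x),z_t(x))$ and every $t\in[0,1]$, $$\pi(x,y_t(x),z_t(x))-(1-t)\pi(x,y_0(x),z_0(x))-t\,\pi(x,y_1(x),z_1(x))\ \ge\ t(1-t)\lambda\,\|(y_1(x)-y_0(x),z_1(x)-z_0(x))\|^2_{\mathbb{R}^{n+1}};$$ (vi) the functional $\boldsymbol{\Pi}(u)=\int_X \pi\big(x,\bar y_G(x,u(x),Du(x))\big)\,d\mu(x)$ is uniformly concave on $\mathcal{U}\subset W^{1,2}(X,d\mu)$, uniformly for all Borel probability measures $\mu\ll\mathcal{L}^m$ on $X$; that is, there exists $\tilde\lambda>0$ such that for every such $\mu$, all $u_0,u_1\in\mathcal{U}$ and $t\in[0,1]$, $$\boldsymbol{\Pi}((1-t)u_0+tu_1)-(1-t)\boldsymbol{\Pi}(u_0)-t\,\boldsymbol{\Pi}(u_1)\ge t(1-t)\tilde\lambda\,\|u_1-u_0\|^2_{W^{1,2}(X,d\mu)}.$$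
   Context: Setting. $m\ge n$; $X\subset\mathbb{R}^m$, $Y\subset\mathbb{R}^n$; $Z=(\underline z,\bar z)$; $\mathrm{cl}$ denotes closure in Euclidean space. Subscripts denote partial derivatives, e.g. $G_x=(\partial G/\partial x^1,\dots,\partial G/\partial x^m)$, $G_z=\partial G/\partial z$. $\mathcal{L}^m$ is Lebesgue measure on $\mathbb{R}^m$. (G0) $G\in C^1(\mathrm{cl}(X\times Y\times Z))$, where $X\subset\mathbb{R}^m$, $Y\subset\mathbb{R}^n$ are open and bounded and $Z=(\underline z,\bar z)$ with $-\infty<\underline z<\bar z\le+\infty$. (G1) For each $x\in X$, the map $(y,z)\in \mathrm{cl}(Y\times Z)\mapsto (G_x,G)(x,y,z)\in\mathbb{R}^{m+1}$ is a homeomorphism onto its range. (G2) For each $x\in X$, the range $(G_x,G)(x,\mathrm{cl}(Y\times Z))$ is convex. $G$-segments: for $x_0\in X$ and $(y_0,z_0),(y_1,z_1)\in \mathrm{cl}(Y\times Z)$, let $(y_t,z_t)\in \mathrm{cl}(Y\times Z)$ be the unique solution of $(G_x,G)(x_0,y_t,z_t)=(1-t)(G_x,G)(x_0,y_0,z_0)+t(G_x,G)(x_0,y_1,z_1)$, $t\in[0,1]$. The curve $t\mapsto(x_0,y_t,z_t)$ is the $G$-segment connecting $(x_0,y_0,z_0)$ and $(x_0,y_1,z_1)$. (G3) For each $x,x_0\in X$, $t\in[0,1]\mapsto G(x,y_t,z_t)$ is convex along every $G$-segment $t\mapsto(x_0,y_t,z_t)$. (G4) $G_z(x,y,z)<0$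 for each $(x,y,z)\in X\times \mathrm{cl}(Y)\times \mathrm{cl}(Z)$. (G5) $\pi\in C^0(\mathrm{cl}(X\times Y\times Z))$ and $u_\emptyset(x):=G(x,y_\emptyset,z_\emptyset)$ for some fixed $(y_\emptyset,z_\emptyset)\in \mathrm{cl}(Y\times Z)$ satisfying $G(x,y,\bar z):=\lim_{z\to\bar z}G(x,y,z)\le G(x,y_\emptyset,z_\emptyset)$ for all $(x,y)\in X\times \mathrm{cl}(Y)$. When $\bar z=+\infty$ this inequality is assumed strict, and moreover for all sufficiently large $z$, $G(x,y,z)<G(x,y_\emptyset,z_\emptyset)$ for all $(x,y)\in X\times \mathrm{cl}(Y)$. (G6) $G\in C^2(\mathrm{cl}(X\times Y\times Z))$ and, with $\bar G(\bar x,\bar y)=\bar G(x,x_0,y,z):=x_0G(x,y,z)$ where $\bar x=(x,x_0)$, $\bar y=(y,z)$, $x_0\in X_0$ and $X_0\subset(-\infty,0)$ is a bounded open interval containing $-1$, the $(m+1)\times(n+1)$ matrix $D_{\bar x,\bar y}\bar G(x,-1,y,z)$ has full rank (rank $n+1$) for each $(x,y,z)\in \mathrm{cl}(X\times Y\times Z)$. $G$-convexity: $u\in C^0(X)$ is $G$-convex if for each $x_0\in X$ there exist $y_0\in \mathrm{cl}(Y)$, $z_0\in \mathrm{cl}(Z)$ with $u(x_0)=G(x_0,y_0,z_0)$ and $u(x)\ge G(x,y_0,z_0)$ for all $x\in X$. $\mathcal{U}$ is the set of all $G$-convex functions $u:X\to\mathbb{R}$. If $u$ is $G$-convex and differentiable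 at $x$, $\bar y_G(x,u(x),Du(x))$ denotes the unique $(y,z)\in \mathrm{cl}(Y\times Z)$ with $u(x)=G(x,y,z)$ and $Du(x)=G_x(x,y,z)$; this is defined for Lebesgue-a.e. $x\in X$. Sobolev norm: $\|u\|^2_{W^{1,2}(X,d\mu)}:=\int_X(|u|^2+|Du|^2)\,d\mu$; functions in $\mathcal{U}$ are viewed as equivalence classes of functions differing only on sets of $\mu$-measure zero. *)

(* Defs.v *)
From HB Require Import structures.
From mathcomp Require Import all_boot all_order all_algebra.
From mathcomp Require Import all_classical all_reals all_analysis.

Set Implicit Arguments.
Unset Strict Implicit.
Unset Printing Implicit Defensive.

Import Order.TTheory GRing.Theory Num.Theory.
Import numFieldNormedType.Exports.

Local Open Scope classical_set_scope.
Local Open Scope ring_scope.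

(* The topology of 'rV[R]_k (sup norm) is the Euclidean one.  Wherever the
   value of the Euclidean norm matters, [sqnorm] is used instead of `|_|. *)

Section generalities.
Context {R : realType}.

Definition sqnorm {k : nat} (q : 'rV[R]_k * R) : R :=
  \sum_(i < k) q.1 0 i ^+ 2 + q.2 ^+ 2.

Definition enorm {k : nat} (q : 'rV[R]_k * R) : R := Num.sqrt (sqnorm q).

Definition grad {k : nat} (f : 'rV[R]_k -> R) (x : 'rV[R]_k) : 'rV[R]_k :=
  \row_(i < k) 'D_(delta_mx 0 i) f x.

(* C^k regularity on a set A that need not be open: derivatives are taken
   relative to A, exist at every point of A, and are continuous on A.  On an
   open set this is the usual notion; on the closure of an open set, the
   derivatives on the boundary are the continuous extensions of the interior
   ones (see [cl_value]). *)
Fixpoint Ck (k : nat) {E : normedModType R} (A : set E) (f : E -> R) : Prop :=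
  {within A, continuous f} /\
  if k is k'.+1 then
    exists df : E -> {linear E -> R^o},
      (forall p, A p -> forall e : R, 0 < e ->
        \forall q \near within A (nbhs p),
          `|f q - f p - df p (q - p)| <= e * `|q - p|) /\
      (forall v, Ck k' A (fun p => df p v))
  else True.

(* Value at p \in cl Om of the continuous extension of f : Om -> R. *)
Definition cl_value {E : topologicalType} (Om : set E) (f : E -> R) (p : E) : R :=
  lim (f @ within Om (nbhs p)).

Definition homeo_onto_range {E F : topologicalType} (A : set E) (f : E -> F) :=
  {within A, continuous f} /\
  exists g : F -> E,
    (forall p, A p -> g (f p) = p) /\ {within f @` A, continuous g}.

End generalities.

Section lebesgue.
Context (R : realType).

Definition borel_rV (k : nat) := g_sigma_algebraType (@open 'rV[R]_k).

(* k-dimensional Lebesgue measure on Borel sets, as the k-fold product of the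
   one-dimensional one transported along R * R^k ~ R^(k+1). *)
Fixpoint lebesgue_rV (k : nat) : set (borel_rV k) -> \bar R :=
  match k with
  | 0 => fun A => \d_(0 : borel_rV 0) A
  | k'.+1 => fun A => (lebesgue_measure \x @lebesgue_rV k')%E
      [set tv | A (row_mx (tv.1)%:M tv.2 : 'rV[R]_(1 + k'))]
  end.

End lebesgue.

Section setting.
Context {R : realType} {m n : nat}.
Variables (X : set 'rV[R]_m) (Y : set 'rV[R]_n) (zlo : R) (zhi : \bar R).

(* Points (x, y, z) are represented as (x, (y, z)). *)
Variable G : 'rV[R]_m * ('rV[R]_n * R) -> R.
Variable pi : 'rV[R]_m * ('rV[R]_n * R) -> R.

Definition Zset : set R := [set z | zlo < z /\ (z%:E < zhi)%E].

Definition XYZ : set ('rV[R]_m * ('rV[R]_n * R)) := X `*` (Y `*` Zset).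
Definition clYZ : set ('rV[R]_n * R) := closure (Y `*` Zset).

(* For x in the open set X, G_x(x, y, z) is an ordinary gradient in x, also
   when (y, z) is a boundary point. *)
Definition GxG (x : 'rV[R]_m) (p : 'rV[R]_n * R) : 'rV[R]_m * R :=
  (grad (fun x' => G (x', p)) x, G (x, p)).

Definition Gz (q : 'rV[R]_m * ('rV[R]_n * R)) : R :=
  cl_value XYZ ('D_(0, (0, 1)) G) q.

(* The unique (y, z) \in cl (Y * Z) with (G_x, G)(x, y, z) = q. *)
Definition GxG_inv (x : 'rV[R]_m) (q : 'rV[R]_m * R) : 'rV[R]_n * R :=
  xget 0 [set p | clYZ p /\ GxG x p = q].

Definition ybarG (x : 'rV[R]_m) (u : R) (Du : 'rV[R]_m) : 'rV[R]_n * R :=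
  GxG_inv x (Du, u).

(* (y_t, z_t) on the G-segment connecting (x0, p0) and (x0, p1). *)
Definition Gseg (x0 : 'rV[R]_m) (p0 p1 : 'rV[R]_n * R) (t : R) : 'rV[R]_n * R :=
  GxG_inv x0 (((1 - t) *: (GxG x0 p0).1 + t *: (GxG x0 p1).1),
              ((1 - t) * (GxG x0 p0).2 + t * (GxG x0 p1).2)).

Definition G_limit (x : 'rV[R]_m) (y : 'rV[R]_n) : \bar R :=
  match zhi with
  | r%:E => lim ((G (x, (y, z)))%:E @[z --> r^'-])
  | _ => lim ((G (x, (y, z)))%:E @[z --> +oo%R])
  end.

Definition hypG0 : Prop :=
  [/\ open X, bounded_set X, open Y, bounded_set Y &
      (zlo%:E < zhi)%E /\ Ck 1 (closure XYZ) G].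

Definition hypG1 : Prop :=
  forall x, X x -> homeo_onto_range clYZ (GxG x).

Definition hypG2 : Prop :=
  forall x, X x -> convex_set (GxG x @` clYZ : set ('rV[R]_m * R^o)%type).

Definition hypG3 : Prop :=
  forall x x0, X x -> X x0 -> forall p0 p1, clYZ p0 -> clYZ p1 ->
    convex_function (`[0, 1] : set R^o) (fun t : R => G (x, Gseg x0 p0 p1 t)).

Definition hypG4 : Prop :=
  forall x y z, X x -> closure Y y -> closure Zset z -> Gz (x, (y, z)) < 0.

Definition hypG5 (pnull : 'rV[R]_n * R) : Prop :=
  [/\ {within closure XYZ, continuous pi},
      clYZ pnull,
      forall x y, X x -> closure Y y -> (G_limit x y <= (G (x, pnull))%:E)%E &
      zhi = +oo%E ->
        (forall x y, X x -> closure Y y -> (G_limit x y < (G (x, pnull))%:E)%E) /\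
        (\forall z \near +oo%R, forall x y, X x -> closure Y y ->
           G (x, (y, z)) < G (x, pnull))].

Definition Gbar (q : ('rV[R]_m * R) * ('rV[R]_n * R)) : R :=
  q.1.2 * G (q.1.1, q.2).

Definition basis_pair {k : nat} (i : 'I_(k + 1)) : 'rV[R]_k * R :=
  match fintype.split i with
  | inl j => (delta_mx 0 j, 0)
  | inr _ => (0, 1)
  end.

Definition DxyGbar (X0 : set R) (q : ('rV[R]_m * R) * ('rV[R]_n * R)) :
    'M[R]_(m + 1, n + 1) :=
  \matrix_(i, j) cl_value ((X `*` X0) `*` (Y `*` Zset))
    ('D_(0, basis_pair j) ('D_(basis_pair i, 0) Gbar)) q.

Definition hypG6 (X0 : set R) : Prop :=
  Ck 2 (closure XYZ) G /\
  forall x p, closure XYZ (x, p) -> \rank (DxyGbar X0 ((x, -1), p)) = (n + 1)%N.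

Definition uniformly_biLipschitz : Prop :=
  exists c C : R, [/\ 0 < c, 0 < C &
    forall x, X x -> forall p q, clYZ p -> clYZ q ->
      c * enorm (p - q) <= enorm (GxG x p - GxG x q) <= C * enorm (p - q)].

Definition Gconvex (u : 'rV[R]_m -> R) : Prop :=
  {within X, continuous u} /\
  forall x0, X x0 -> exists y0 z0,
    [/\ closure Y y0, closure Zset z0, u x0 = G (x0, (y0, z0)) &
        forall x, X x -> G (x, (y0, z0)) <= u x].

(* Integrands involving Du only make sense at the points of differentiability
   of u; for G-convex u the other points of X form a Lebesgue-null set. *)
Definition diff_points (u : 'rV[R]_m -> R) : set 'rV[R]_m :=
  X `&` [set x | differentiable u x].

Definition Pi (mu : set (borel_rV R m) -> \bar R) (u : 'rV[R]_m -> R) : \bar R :=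
  (\int[mu]_(x in diff_points u) (pi (x, ybarG x (u x) (grad u x)))%:E)%E.

Definition W12norm2 (mu : set (borel_rV R m) -> \bar R) (u : 'rV[R]_m -> R) :
    \bar R :=
  (\int[mu]_(x in diff_points u) (sqnorm (grad u x, u x))%:E)%E.

Definition pi_uniformly_concave_along_Gsegments : Prop :=
  exists2 lam : R, 0 < lam &
    forall x p0 p1, X x -> clYZ p0 -> clYZ p1 ->
    forall t : R, 0 <= t <= 1 ->
      pi (x, Gseg x p0 p1 t) - (1 - t) * pi (x, p0) - t * pi (x, p1)
      >= t * (1 - t) * lam * sqnorm (p1 - p0).

(* Pi u may be -oo and the Sobolev norm may be +oo when zhi = +oo, so the
   negative terms are moved to the other side to avoid oo - oo; when all terms
   are finite this is the usual inequality. *)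
Definition Pi_uniformly_concave : Prop :=
  exists2 lam : R, 0 < lam &
    forall mu : probability (borel_rV R m) R,
      mu X = 1%E -> mu `<< @lebesgue_rV R m ->
    forall u0 u1, Gconvex u0 -> Gconvex u1 ->
    forall t : R, 0 <= t <= 1 ->
      (Pi mu (fun x => ((1 - t) * u0 x + t * u1 x)%R) >=
       (1 - t)%:E * Pi mu u0 + t%:E * Pi mu u1 +
       (t * (1 - t) * lam)%:E * W12norm2 mu (fun x => (u1 x - u0 x)%R))%E.

End setting.

(* Main.v *)
Require Import Defs.
From HB Require Import structures.
From mathcomp Require Import all_boot all_order all_algebra.
From mathcomp Require Import ring lra.
From mathcomp Require Import all_classical all_reals all_analysis.
From mathcomp Require Import measurable_realfun.
Import Order.TTheory GRing.Theory Num.Theory.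
Import numFieldNormedType.Exports.
Local Open Scope classical_set_scope.
Local Open Scope ring_scope.

(* Write F_x = (G_x, G)(x, .).  By (G1) and (G2), along a G-segment F_x(p_t) is
   the affine interpolation of F_x(p_0) and F_x(p_1), and if u_0, u_1 are
   G-convex and differentiable at x, then (Du_i, u_i)(x) = F_x(p_i(x)), so that
   u_t = (1 - t) u_0 + t u_1 satisfies (Du_t, u_t)(x) = F_x(p_t(x)).  Hence Pi
   is, pointwise in x, the functional pi evaluated along G-segments, and the
   Sobolev norm measures F_x(p_1) - F_x(p_0).

   Two comparisons link |F_x(p_1) - F_x(p_0)| and |p_1 - p_0|.  The bound
   c |p_1 - p_0| <= |F_x(p_1) - F_x(p_0)| is assumed when zhi = +oo; otherwise
   cl(X Y Z) is compact, (G6) makes the derivative of F_x uniformly injective,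
   and the bound is integrated along the G-segment.  The converse bound is only
   needed infinitesimally: uniform concavity follows from a bound on second
   differences.

   (vi) => (v): test with u_i = G(., p_i) and with normalised Lebesgue measures
   on boxes shrinking to x_0.

   (v) => (vi): G-convex functions are locally semiconvex, because the points
   (y, z) of their supports are locally bounded and G is C^2.  For a semiconvex
   function of one variable the second differences fail to be o(h) only at
   countably many points; by Fubini the corresponding set of R^m is Lebesgue
   null for each coordinate direction, and off these sets semiconvexity gives
   differentiability.  There Du is continuous, so the integrands are
   measurable. *)

Set Implicit Arguments.
Unset Strict Implicit.
Unset Printing Implicit Defensive.

(** * Lebesgue measure on row vectors *)

(** The set where a G-convex function fails to be differentiable is not visibly Borel, and the
    integrals over [diff_points] come without measurability or integrability. Hence the exceptional
    sets are described by values of u alone, so that continuity of u makes them Borel, and integrals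
    are compared off a null set directly through simple functions. With oo - oo counted as -oo,
    additivity weakens to an inequality, which goes in the direction that concavity requires.

    When cl(Y Z) is unbounded, bounding the supports is the delicate point: a support G(., p)
    touching u at y is controlled only from above near y, and from below only at y. A penalised
    maximum yields a nearby point where both G and G_x are bounded; the lower Lipschitz bound,
    measured from a fixed reference point, then bounds p.

    Y is not assumed convex, so a straight line from p_0 to p_1 may leave cl(Y Z). Estimates between
    two values of (y, z) therefore run along G-segments, on which F_x moves at constant speed. *)

Lemma borel_rV_open (R : realType) k (U : set 'rV[R]_k) :
  open U -> measurable (U : set (borel_rV R k)).
Proof. by move=> oU; apply: sub_sigma_algebra. Qed.

Lemma ballE (R : realType) (E : normedModType R) (x y : E) (e : R) :
  ball x e y <-> `|x - y| < e.
Proof. by rewrite -ball_normE. Qed.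

Lemma rV_norm_lt (R : realType) k (v : 'rV[R]_k) (e : R) : 0 < e ->
  (`|v| < e <-> forall i, `|v 0 i| < e).
Proof.
move=> e0; rewrite (_ : `|v| = mx_norm v)// mx_normrE; split.
  by move=> /bigmax_ltP[_ H] i; have := H (0, i) isT.
by move=> H; apply/bigmax_ltP; split => // -[i j] _; rewrite ord1.
Qed.

Lemma rV_norm_le (R : realType) k (v : 'rV[R]_k) (e : R) : 0 <= e ->
  (`|v| <= e <-> forall i, `|v 0 i| <= e).
Proof.
move=> e0; rewrite (_ : `|v| = mx_norm v)// mx_normrE; split.
  by move=> /bigmax_leP[_ H] i; have := H (0, i) isT.
by move=> H; apply/bigmax_leP; split => // -[i j] _; rewrite ord1.
Qed.

Lemma rV_coord_le (R : realType) k (v : 'rV[R]_k) i : `|v 0 i| <= `|v|.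
Proof. by have /(_ (lexx _)) := (@rV_norm_le R k v `|v| (normr_ge0 v)).1. Qed.

(** Written coordinatewise so that its preimage under [row_mx] splits as a product. *)
Definition box {R : realType} {k} (c : 'rV[R]_k) (e : R) : set 'rV[R]_k :=
  [set v | forall i, `|v 0 i - c 0 i| < e].

Lemma box_ball (R : realType) k (c : 'rV[R]_k) (e : R) : 0 < e ->
  box c e = ball c e.
Proof.
move=> e0; apply/seteqP; split => v.
  by move=> H; apply/ballE/rV_norm_lt => // i; rewrite !mxE distrC; exact: H.
by move=> /ballE/rV_norm_lt H i; have := H e0 i; rewrite !mxE distrC.
Qed.

Lemma measurable_box (R : realType) k (c : 'rV[R]_k) (e : R) : 0 < e ->
  measurable (box c e : set (borel_rV R k)).
Proof. by move=> e0; rewrite box_ball//; apply: borel_rV_open; exact: ball_open. Qed.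

Lemma rat_approx (R : realType) (x e : R) : 0 < e -> exists q : rat, `|x - ratr q| < e.
Proof.
move=> e0; have : x - e < x + e by rewrite ltrD2l gtrN.
by move=> /rat_in_itvoo[q]; rewrite in_itv/= => /andP[H1 H2]; exists q; rewrite ltr_norml; lra.
Qed.

Lemma rat_rV_approx (R : realType) k (x : 'rV[R]_k) (e : R) : 0 < e ->
  exists c : 'rV[rat]_k, box (map_mx ratr c) e x.
Proof.
move=> e0; have /choice[f Hf] : forall i, exists q : rat, `|x 0 i - ratr q| < e.
  by move=> i; exact: rat_approx.
by exists (\row_i f i) => i; rewrite !mxE.
Qed.

(** The source carries the product sigma-algebra and the target the one generated by open sets. The
    two meet because the preimage of an open set is a countable union of rational rectangles. *)
Lemma measurable_row_mx (R : realType) k :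
  measurable_fun [set: measurableTypeR R * borel_rV R k]
    (fun tv => row_mx tv.1%:M tv.2 : borel_rV R (1 + k)).
Proof.
apply: (@measurability _ _ _ (borel_rV R (1 + k)) setT _ (@open 'rV[R]_(1 + k))) => //.
move=> _ [U oU <-]; rewrite setTI.
pose inv (j : nat) : R := j.+1%:R^-1.
pose B (i : rat * 'rV[rat]_k * nat) : set (measurableTypeR R * borel_rV R k) :=
  [set t : R | `|ratr i.1.1 - t| < inv i.2] `*` box (map_mx ratr i.1.2) (inv i.2).
set V := _ @^-1` U.
have -> : V = \bigcup_(i in [set i | B i `<=` V]) B i.
  apply/seteqP; split=> [[t v] /= tvV|tv [i /= iV]]; last exact: iV.
  have /nbhs_ballP[e /= e0 eU] : nbhs (row_mx t%:M v : 'rV[R]_(1 + k)) U.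
    exact: open_nbhs_nbhs.
  (* Two points within [inv j] of the same rational centre are less than [2 * inv j] apart. *)
  have [j je] : exists j, 2 * inv j < e.
    have [j] := ltr_add_invr (divr_gt0 e0 (ltr0Sn R 1)); rewrite add0r => je.
    by exists j; rewrite mulrC -ltr_pdivlMr.
  have j0 : 0 < inv j by rewrite invr_gt0.
  have [q tq] := rat_approx t j0; have [c vc] := rat_rV_approx v j0.
  exists (q, c, j); last by split => //=; rewrite distrC.
  move=> [s w] [/= sq wc]; apply: eU.
  have tri (x y z : R) : `|x - y| < inv j -> `|z - y| < inv j -> `|x - z| < e.
    by rewrite !ltr_norml; lra.
  rewrite -box_ball// => i; rewrite !mxE; case: splitP => i' _; rewrite ?mxE ?ord1 ?eqxx ?mulr1n.
    by rewrite distrC; apply: tri (tq) _; rewrite distrC.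
  by rewrite -/(w - v); exact: tri (wc i') (vc i').
rewrite bigcup_mkcond; apply: countable_bigcupT_measurable => // i.
case: ifP => // _; apply: measurableX; last by apply: measurable_box; rewrite invr_gt0.
rewrite (_ : [set t | _] = ball (ratr i.1.1 : R) (inv i.2)); first exact: measurable_ball.
by apply/seteqP; split => t /= /ballE.
Qed.

Lemma preimage_row_mx_box (R : realType) k (c : 'rV[R]_(1 + k)) r : 0 < r ->
  [set tv : R * 'rV[R]_k | box c r (row_mx tv.1%:M tv.2)] =
  ball (lsubmx c 0 0) r `*` box (rsubmx c) r.
Proof.
move=> r0; apply/seteqP; split => [[t v] /= H|[t v] [/= /ballE H1 H2] i].
  split; first by apply/ballE; have := H (lshift _ 0); rewrite distrC !mxE (unsplitK (inl _)) !mxE mulr1n.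
  by move=> i; have := H (rshift _ i); rewrite !mxE (unsplitK (inr _)).
rewrite -[c]hsubmxK; case: (split_ordP i) => j ->.
  by rewrite !row_mxEl ord1 !mxE mulr1n distrC; move: H1; rewrite !mxE.
by rewrite !row_mxEr; exact: H2.
Qed.

Section row_measure.
Variables (R : realType) (k : nat).
Variable nu : {sigma_finite_measure set (borel_rV R k) -> \bar R}.
Hypothesis nu_box : forall c r, 0 < r -> (0 < nu (box c r) < +oo)%E.

Definition row_measure : set (borel_rV R (1 + k)) -> \bar R :=
  pushforward (lebesgue_measure \x nu)%E
    (fun tv : measurableTypeR R * borel_rV R k => row_mx tv.1%:M tv.2 : borel_rV R (1 + k)).

Let row_measure0 : row_measure set0 = 0%E.
Proof. by rewrite /row_measure /pushforward preimage_set0 measure0. Qed.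

Let row_measure_ge0 A : (0 <= row_measure A)%E.
Proof. exact: integral_ge0. Qed.

Let row_measure_sigma_additive : semi_sigma_additive row_measure.
Proof. apply: measure_semi_sigma_additive; exact: measurable_row_mx. Qed.

HB.instance Definition _ := isMeasure.Build _ _ _ row_measure
  row_measure0 row_measure_ge0 row_measure_sigma_additive.

Lemma row_measure_box c r : 0 < r -> (0 < row_measure (box c r) < +oo)%E.
Proof.
move=> r0; rewrite /row_measure /pushforward [X in product_measure1 _ _ X]preimage_row_mx_box//.
have [n0 noo] := andP (nu_box (rsubmx c) r0).
rewrite product_measure1E//; [|exact: measurable_ball|exact: measurable_box].
rewrite /= lebesgue_measure_ball ?ltW//; apply/andP; split.
  by rewrite mule_gt0// lte_fin mulrn_wgt0.
by rewrite lte_mul_pinfty// lee_fin mulrn_wge0// ltW.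
Qed.

Let row_measure_sigma_finite : sigma_finite [set: borel_rV R (1 + k)] row_measure.
Proof.
exists (fun n => box 0 n.+1%:R).
  apply/esym; rewrite -subTset => v _.
  have [n vn] : exists n : nat, `|v : 'rV[R]__| < n.+1%:R.
    exists (Num.bound `|v : 'rV[R]__|); apply: lt_le_trans (archi_boundP (normr_ge0 _)) _.
    by rewrite ler_nat.
  exists n => // i; rewrite mxE subr0; exact: le_lt_trans (rV_coord_le _ _) vn.
move=> n; split; first by apply: measurable_box; rewrite ltr0n.
by have /andP[] := row_measure_box 0 (ltr0Sn R n).
Qed.

HB.instance Definition _ := Measure_isSigmaFinite.Build _ _ _ row_measure
  row_measure_sigma_finite.

End row_measure.

(** [lebesgue_rV] is a bare function; this equips it with the sigma-finite measure structure on
    which Fubini relies. Positivity and finiteness on boxes are carried through the induction, since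
    each step derives sigma-finiteness from them. *)
Lemma lebesgue_rV_measure (R : realType) k :
  exists2 nu : {sigma_finite_measure set (borel_rV R k) -> \bar R},
    (nu : set _ -> _) = @lebesgue_rV R k &
    forall c r, 0 < r -> (0 < nu (box c r) < +oo)%E.
Proof.
elim: k => [|k [nu nuE nu_box]].
  exists (\d_(0 : borel_rV R 0)) => //= c r r0.
  by rewrite diracE mem_set ?lte_fin ?ltr01 ?ltey// => -[].
exists (row_measure nu); last exact: row_measure_box.
by rewrite /= -nuE.
Unshelve. all: exact: nu_box.
Qed.

(** The product measure is defined by integrating sections in the other variable; its uniqueness
    allows the exchange. *)
Lemma Fubini_null (R : realType) (k : nat) (nu : {sigma_finite_measure set (borel_rV R k) -> \bar R})
    (A : set (measurableTypeR R * borel_rV R k)) :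
  measurable A -> (forall v, (lebesgue_measure (ysection A v) = 0)%E) ->
  ((lebesgue_measure \x nu)%E A = 0)%E.
Proof.
move=> mA A0.
rewrite (@product_measure_unique _ _ _ _ _ _ _ (lebesgue_measure \x^ nu)%E)//.
  by rewrite /product_measure2; apply: integral0_eq => v _ /=; exact: A0.
by move=> B C mB mC; rewrite /= product_measure2E.
Qed.

(** Induction on [k] along [R^(1+k) = R * R^k]. If [i] is the first coordinate, the sections over
    [R^k] are countable, hence null; otherwise every section over [R] satisfies the induction
    hypothesis. *)
Lemma lebesgue_rV_null (R : realType) k (A : set (borel_rV R k)) (i : 'I_k) :
  measurable A ->
  (forall v : 'rV[R]_k, countable [set t : R | A (v + t *: delta_mx 0 i)]) ->
  @lebesgue_rV R k A = 0%E.
Proof.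
elim: k => [|k IH] in A i *; first by case: i.
move=> mA cA; have mrow := @measurable_row_mx R k.
have mA' : measurable [set tv : measurableTypeR R * borel_rV R k | A (row_mx tv.1%:M tv.2)].
  by have := mrow measurableT _ mA; rewrite setTI.
have [nu nuE _] := lebesgue_rV_measure R k.
rewrite /= -nuE; have [j ij|j ij] := split_ordP (i : 'I_(1 + k)).
  apply: Fubini_null => // v; apply: countable_lebesgue_measure0.
  rewrite (_ : ysection _ _ = [set t : R | A ((@row_mx R 1 1 k 0 v : 'rV[R]_k.+1) + t *: delta_mx 0 i)])//.
  apply/eq_set => t; rewrite inE /=; congr (A _); rewrite ij; apply/rowP => l.
  case: (split_ordP (l : 'I_(1 + k))) => l' ->; rewrite !mxE ?(unsplitK (inl _)) ?(unsplitK (inr _)) /= ?mxE !ord1.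
    by rewrite !eqxx mulr1 add0r.
  by rewrite (_ : (_ == _) = false) ?mulr0 ?addr0//; exact: eq_rlshift.
rewrite /product_measure1; apply: integral0_eq => t _ /=.
rewrite nuE; apply: (IH _ j); first exact: measurable_xsection.
move=> v; rewrite (_ : [set _ | _] = [set s : R | A ((@row_mx R 1 1 k t%:M v : 'rV[R]_k.+1) + s *: delta_mx 0 i)])//.
apply/eq_set => s; rewrite /xsection /= inE /=; congr (A _); rewrite ij; apply/rowP => l.
case: (split_ordP (l : 'I_(1 + k))) => l' ->; rewrite !mxE ?(unsplitK (inl _)) ?(unsplitK (inr _)) /= ?mxE.
  suff /negbTE -> : lshift k l' != rshift 1 j :> 'I_k.+1 by rewrite mulr0 addr0.
  by apply/eqP => /(congr1 val); rewrite /= ord1.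
by congr (_ + _ * _%:R); apply/esym; exact: eq_rshift.
Qed.

(** * Integral inequalities without integrability *)

Import HBNNSimple.

(** Neither [f] nor [g] is measurable here. The integral is a supremum over simple functions, and a
    simple function below [f] can be set to 0 on [N] without changing its integral; it is then below
    [g]. *)
Lemma nnsfun_ae_le d (T : measurableType d) (R : realType)
    (mu : {measure set T -> \bar R}) (N : set T) (f g : T -> \bar R) :
  measurable N -> mu N = 0%E ->
  (forall x, 0%E <= f x)%E -> (forall x, 0%E <= g x)%E ->
  (forall x, ~ N x -> (f x <= g x)%E) ->
  (\int[mu]_x f x <= \int[mu]_x g x)%E.
Proof.
move=> mN N0 f0 g0 fg.
rewrite ge0_integralTE// ge0_integralTE//.
apply: ge_ereal_sup => _ [h /= hf <-].
have mNC : measurable (~` N) by exact: measurableC.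
pose h' := proj_nnsfun h mNC.
have -> : sintegral mu h = sintegral mu h'.
  rewrite -mrestrict -integral_nnsfun//.
  have -> : sintegral mu h = (\int[mu]_x (h x)%:E)%E by rewrite integral_nnsfun// patch_setT.
  rewrite (@ge0_negligible_integral _ _ _ mu setT N)//; first by rewrite setTD.
    by exact/measurable_EFinP.
  by move=> x _; rewrite lee_fin.
apply: ereal_sup_ubound; exists h' => // x; rewrite -[h' x]/((h' : T -> R) x) -mrestrict patchE.
by case: ifPn => [|_]; [rewrite inE => Nx; exact: le_trans (hf x) (fg x Nx)|exact: g0].
Qed.

(** Positive and negative parts are compared separately. The domains enter only through the
    restrictions, so they may be non-measurable, as may be the case for [diff_points]. *)
Lemma integral_le_off_null d (T : measurableType d) (R : realType)
    (mu : {measure set T -> \bar R}) (N D D' : set T) (f g : T -> \bar R) :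
  measurable N -> mu N = 0%E ->
  (forall x, ~ N x -> ((f \_ D) x <= (g \_ D') x)%E) ->
  (\int[mu]_(x in D) f x <= \int[mu]_(x in D') g x)%E.
Proof.
move=> mN N0 fg; rewrite integral_mkcond [leRHS]integral_mkcond integralE [leRHS]integralE.
apply: leeB; apply: (nnsfun_ae_le mN N0) => // x Nx; have := fg x Nx.
  by rewrite !funeposE => H; rewrite ge_max !le_max lexx H orbT.
by rewrite -leeN2 !funenegE => H; rewrite ge_max !le_max lexx H orbT.
Qed.

(** Here [a, b, c] stand for the integrals of the positive parts of [f], [g], [f + g], and the
    primed letters for the negative parts. An infinite [a'] or [b'] makes the left side -oo;
    otherwise [c'] is finite and the only infinite case left is [c = +oo]. *)
Lemma lee_sub_add (R : realType) (a b c a' b' c' : \bar R) :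
  (0 <= a -> 0 <= b -> 0 <= c -> 0 <= a' -> 0 <= b' -> 0 <= c' -> c' <= a' + b' ->
  c + (a' + b') = c' + (a + b) -> (a - a') + (b - b') <= c - c')%E.
Proof.
move=> a0 b0 c0 a'0 b'0 c'0.
have [->|a'oo] := eqVneq a' +oo%E; first by rewrite addeNy addNye leNye.
have [->|b'oo] := eqVneq b' +oo%E; first by rewrite addeNy addeNy leNye.
case: a' a'0 a'oo => [a'| |] // a'0 _; case: b' b'0 b'oo => [b'| |] // b'0 _.
case: c' c'0 => [c'| |] // c'0 _; case: c c0 => [c| |] // c0; last by rewrite leey.
case: a a0 => [a| |] // a0; case: b b0 => [b| |] // b0.
by rewrite -!EFinD lee_fin => -[]; lra.
Qed.

(** Additivity can fail when oo - oo occurs, but that value is -oo and so keeps this inequality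
    true. *)
Lemma le_integralD d (T : measurableType d) (R : realType)
    (mu : {measure set T -> \bar R}) (D : set T) (f g : T -> R) :
  measurable D -> measurable_fun D f -> measurable_fun D g ->
  (\int[mu]_(x in D) (f x)%:E + \int[mu]_(x in D) (g x)%:E <=
   \int[mu]_(x in D) (f x + g x)%:E)%E.
Proof.
move=> mD mf mg.
have mF : @measurable_fun _ _ T (\bar R) D (fun x => (f x)%:E) by exact/measurable_EFinP.
have mG : @measurable_fun _ _ T (\bar R) D (fun x => (g x)%:E) by exact/measurable_EFinP.
have mH : @measurable_fun _ _ T (\bar R) D (fun x => (f x + g x)%:E).
  by apply/measurable_EFinP; exact: measurable_funD.
rewrite integralE [X in (_ + X)%E]integralE [leRHS]integralE.
set a := (\int[mu]_(x in D) _)%E; set a' := (\int[mu]_(x in D) _)%E.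
set b := (\int[mu]_(x in D) _)%E; set b' := (\int[mu]_(x in D) _)%E.
set c := (\int[mu]_(x in D) _)%E; set c' := (\int[mu]_(x in D) _)%E.
(* Integrated form of [(f+g)^+ + f^- + g^- = (f+g)^- + f^+ + g^+], where all terms are
   nonnegative. *)
have E : (c + (a' + b') = c' + (a + b))%E.
  rewrite /a /b /c /a' /b' /c'.
  rewrite -!ge0_integralD//; try by [exact: measurable_funepos|exact: measurable_funeneg
    |apply: emeasurable_funD; [exact: measurable_funepos|exact: measurable_funepos]
    |apply: emeasurable_funD; [exact: measurable_funeneg|exact: measurable_funeneg]
    |move=> x _; exact: adde_ge0].
  apply: eq_integral => x _; rewrite /= !funeposE !funenegE /= -?EFinN -!EFin_max -!EFinD.
  have pn (y : R) : Num.max y 0 = Num.max (- y) 0 + y.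
    by case: (lerP 0 y) => ?; case: (lerP 0 (- y)) => ?; lra.
  by congr EFin; rewrite (pn (f x)) (pn (g x)) (pn (f x + g x)); ring.
have c'le : (c' <= a' + b')%E.
  rewrite /a' /b' /c' -ge0_integralD//; try by [exact: measurable_funeneg].
  apply: ge0_le_integral => //; try by [exact: measurable_funeneg
    |apply: emeasurable_funD; [exact: measurable_funeneg|exact: measurable_funeneg]
    |move=> x _; exact: adde_ge0].
  move=> x _; rewrite /= !funenegE /= -?EFinN -!EFin_max -!EFinD lee_fin ge_max.
  have ge (y : R) : - y <= Num.max (- y) 0 /\ 0 <= Num.max (- y) 0.
    by rewrite !le_max !lexx orbT.
  by have [] := ge (f x); have [] := ge (g x); lra.
by apply: lee_sub_add => //; exact: integral_ge0.
Qed.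
(** * Semiconvex functions *)

Section epsilon_delta.
Variables (R : realType) (E F : normedModType R).
Implicit Types (A : set E) (f : E -> F).

Lemma nbhs_distP (x : E) (P : set E) :
  (\forall y \near x, P y) <-> exists2 d : R, 0 < d & forall y, `|y - x| < d -> P y.
Proof.
split=> [/nbhs_ballP[d /= d0 H]|[d d0 H]].
  by exists d => // y yd; apply: H; apply/ballE; rewrite distrC.
by apply/nbhs_ballP; exists d => //= y /ballE yd; apply: H; rewrite distrC.
Qed.

Lemma within_distP A (x : E) (P : set E) :
  (\forall y \near within A (nbhs x), P y) <->
  exists2 d : R, 0 < d & forall y, A y -> `|y - x| < d -> P y.
Proof.
rewrite near_withinE; split=> [/nbhs_distP[d d0 H]|[d d0 H]]; first by exists d => // y Ay yd; exact: H.
by apply/nbhs_distP; exists d => // y yd Ay; exact: H.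
Qed.

Lemma within_continuousP A f : {within A, continuous f} <->
  forall x, A x -> forall e, 0 < e ->
    exists2 d, 0 < d & forall y, A y -> `|y - x| < d -> `|f y - f x| < e.
Proof.
split=> [/subspace_continuousP H x Ax e e0|H].
  by have /cvgrPdist_lt/(_ e e0)/within_distP[d d0 dH] := H x Ax; exists d => // y Ay yd; rewrite distrC dH.
apply/subspace_continuousP => x Ax; apply/cvgrPdist_lt => e e0.
have [d d0 dH] := H x Ax e e0; apply/within_distP; exists d => // y Ay yd.
by rewrite distrC dH.
Qed.

Lemma continuous_distP f x : {for x, continuous f} <->
  forall e, 0 < e -> exists2 d, 0 < d & forall y, `|y - x| < d -> `|f y - f x| < e.
Proof.
split=> [H e e0|H].
  by have /cvgrPdist_lt/(_ e e0)/nbhs_distP[d d0 dH] := H; exists d => // y yd; rewrite distrC dH.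
apply/cvgrPdist_lt => e e0.
have [d d0 dH] := H e e0; apply/nbhs_distP; exists d => // y yd.
by rewrite distrC dH.
Qed.

End epsilon_delta.

(** * Gradients as coordinate linear forms *)

Definition dotv {R : realType} {m} (xi v : 'rV[R]_m) : R := \sum_i xi 0 i * v 0 i.

Section dotv.
Variables (R : realType) (m : nat).
Implicit Types xi v w : 'rV[R]_m.

Lemma dotv_is_linear xi : linear (dotv xi : 'rV[R]_m -> R^o).
Proof.
move=> a v w; rewrite /dotv scaler_sumr -big_split; apply: eq_bigr => i _.
by rewrite !mxE mulrDr mulrCA.
Qed.

HB.instance Definition _ xi := GRing.isLinear.Build R 'rV[R]_m R^o *:%R (dotv xi : 'rV[R]_m -> R^o) (dotv_is_linear xi).

Lemma dotvD xi v w : dotv xi (v + w) = dotv xi v + dotv xi w.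
Proof. exact: linearD. Qed.

Lemma dotvB xi v w : dotv xi (v - w) = dotv xi v - dotv xi w.
Proof. exact: linearB. Qed.

Lemma dotvZ xi a v : dotv xi (a *: v) = a * dotv xi v.
Proof. exact: linearZ. Qed.

Lemma dotv0 xi : dotv xi 0 = 0.
Proof. exact: linear0. Qed.

Lemma dotv_sum xi (I : Type) (r : seq I) (F : I -> 'rV[R]_m) :
  dotv xi (\sum_(i <- r) F i) = \sum_(i <- r) dotv xi (F i).
Proof. exact: linear_sum. Qed.

Lemma dotv_delta xi i : dotv xi (delta_mx 0 i) = xi 0 i.
Proof.
rewrite /dotv (bigD1 i)//= big1 ?addr0 ?mxE ?eqxx ?mulr1// => j ji.
by rewrite mxE (negPf ji) andbF mulr0.
Qed.

Lemma dotv_le xi v : `|dotv xi v| <= m%:R * `|xi| * `|v|.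
Proof.
apply: le_trans (ler_norm_sum _ _ _) _.
apply: (@le_trans _ _ (\sum_(i < m) `|xi| * `|v|)); first apply: ler_sum.
  by move=> i _; rewrite normrM ler_pM// rV_coord_le.
by rewrite sumr_const card_ord mulr_natl mulrnAl.
Qed.

Lemma continuous_dotv xi : continuous (dotv xi).
Proof.
move=> v; apply/continuous_distP => e e0; pose K := m%:R * `|xi| + 1.
have K0 : 0 < K by rewrite ltr_wpDl// mulr_ge0.
exists (e / K); first exact: divr_gt0.
move=> w; rewrite ltr_pdivlMr// -dotvB; apply: le_lt_trans.
by rewrite (le_trans (dotv_le _ _))// mulrC ler_wpM2l// lerDl.
Qed.

Lemma differentiable_grad (f : 'rV[R]_m -> R) x xi :
  (forall e, 0 < e -> exists2 d, 0 < d &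
    forall v, `|v| < d -> `|f (x + v) - f x - dotv xi v| <= e * `|v|) ->
  differentiable f x /\ grad f x = xi.
Proof.
move=> H; pose g : 'rV[R]_m -> R^o := f; pose L : {linear 'rV[R]_m -> R^o} := dotv xi.
have E : g \o shift x = (cst (g x) : 'rV[R]_m -> R^o) + (L : 'rV[R]_m -> R^o) +o_ (0 : 'rV[R]_m) id.
  apply/eqaddoP => e e0; have [d d0 dH] := H e e0.
  apply/nbhs_ballP; exists d => //= v /ballE; rewrite sub0r normrN => /dH.
  by rewrite !fctE /= [v + x]addrC opprD addrA.
have dE : 'd g x = L :> ('rV[R]_m -> R^o).
  by apply: diff_unique => //; exact: continuous_dotv.
have df : differentiable f x.
  by apply/diff_locallyP; rewrite -/g dE; split => //; exact: continuous_dotv.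
split=> //; apply/rowP => i; rewrite mxE deriveE// -/g dE; exact: dotv_delta.
Qed.

Lemma differentiable_gradP (f : 'rV[R]_m -> R) x : differentiable f x ->
  forall e, 0 < e -> exists2 d, 0 < d &
    forall v, `|v| < d -> `|f (x + v) - f x - dotv (grad f x) v| <= e * `|v|.
Proof.
move=> df e e0.
have dE v : 'd f x v = dotv (grad f x) v.
  rewrite {1}(row_sum_delta v) linear_sum /dotv; apply: eq_bigr => i _.
  by rewrite linearZ /= mulrC mxE deriveE.
have /diff_locallyP[_ /eqaddoP/(_ e e0)/nbhs_ballP[d /= d0 H]] := df.
exists d => // v vd; have := H v; rewrite !fctE /= dE [v + x]addrC opprD addrA.
by apply; apply/ballE; rewrite sub0r normrN.
Qed.

End dotv.

(* A support slope [xi s] makes [xi s + 2 C s] nondecreasing in [s], and at a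
   kink this function jumps; the jumps are disjoint open intervals, each of
   which contains a rational. *)
Lemma countable_kinks1 (R : realType) (J : set R) (w : R -> R) (C : R) :
  0 <= C -> (forall a b c, J a -> J b -> a <= c <= b -> J c) ->
  (forall s, J s -> exists xi, forall t, J t ->
    w s + xi * (t - s) - C * (t - s) ^+ 2 <= w t) ->
  countable [set s | J s /\ exists2 e, 0 < e & forall d, 0 < d -> exists h,
    [/\ 0 < h < d, J (s + h), J (s - h) & e * h < `|w (s + h) + w (s - h) - 2 * w s|]].
Proof.
move=> C0 Jc H; set K := [set s | _].
have /choice[xi Hxi] : forall s, exists xi, J s -> forall t, J t ->
    w s + xi * (t - s) - C * (t - s) ^+ 2 <= w t.
  move=> s; have [Js|nJ] := pselect (J s); last by exists 0.
  by have [x] := H s Js; exists x.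
pose eta s := xi s + 2 * C * s.
(* Adding the support inequalities at [s] and at [t] gives [(xi s - xi t) * (t - s) <= 2 * C * (t -
   s) ^+ 2]. *)
have eta_nd s t : J s -> J t -> s <= t -> eta s <= eta t.
  move=> Js Jt; rewrite le_eqVlt => /predU1P[->//|st].
  have := Hxi s Js t Jt; have := Hxi t Jt s Js; rewrite /eta => h1 h2.
  have : (xi s + 2 * C * s - (xi t + 2 * C * t)) * (t - s) <= 0 by nra.
  by rewrite pmulr_lle0 ?subr_gt0// subr_le0.
have jump s : K s -> exists2 e, 0 < e & forall h, 0 < h -> J (s + h) -> J (s - h) ->
    e <= eta (s + h) - eta (s - h).
  move=> [Js [e e0 He]]; exists e => // h0 h00 Jp Jm.
  (* For [h] below [e / (2 * C + 1)] the support at [s] keeps the second difference above [- e * h],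
     so a kink can only be convex. The supports at [s + h] and [s - h] then bound it above by the
     increment of [eta] times [h]. *)
  have [] := He (Num.min h0 (e / (2 * C + 1))).
    by rewrite lt_min h00 divr_gt0//; lra.
  move=> h [/andP[h1]]; rewrite lt_min ltr_pdivlMr; last lra.
  move=> /andP[h2 h3] Jph Jmh Hh.
  have s1 := Hxi s Js _ Jph; have s2 := Hxi s Js _ Jmh.
  have s3 := Hxi _ Jph _ Js; have s4 := Hxi _ Jmh _ Js.
  have m1 := eta_nd _ _ Jph Jp; have m2 := eta_nd _ _ Jm Jmh.
  have {}m1 : eta (s + h) <= eta (s + h0) by apply: m1; lra.
  have {}m2 : eta (s - h0) <= eta (s - h) by apply: m2; lra.
  suff : e * h <= (eta (s + h) - eta (s - h)) * h by rewrite ler_pM2r//; lra.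
  move: Hh; rewrite lter_normr /eta => /orP[|] Hh; last by nra.
  by nra.
(* The rational is taken between the supremum of [eta] to the left of [s] and that supremum plus the
   jump. *)
have /choice[q Hq] : forall s, exists q : rat, K s ->
    forall t, J t -> (t < s -> eta t < ratr q) /\ (s < t -> ratr q < eta t).
  move=> s; have [Ks|nK] := pselect (K s); last by exists 0.
  have [e e0 He] := jump s Ks; case: (Ks) => Js [e' e'0 /(_ 1 ltr01)].
  move=> [h [/andP[h0 _] Jp Jm _]].
  pose A := [set eta t | t in [set t | J t /\ t < s]].
  have A_ub t : J t -> s < t -> ubound A (eta t - e).
    move=> Jt st _ [r [Jr rs] <-]; pose k := Num.min (t - s) (s - r).
    have k0 : 0 < k by rewrite lt_min !subr_gt0 st.
    have [kt kr] : k <= t - s /\ k <= s - r by rewrite !ge_min !lexx orbT.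
    have Jsk : J (s + k) by apply: (Jc r t) => //; lra.
    have Jsk' : J (s - k) by apply: (Jc r t) => //; lra.
    have := He k k0 Jsk Jsk'.
    have : eta (s + k) <= eta t by apply: eta_nd => //; lra.
    have : eta r <= eta (s - k) by apply: eta_nd => //; lra.
    lra.
  have A0 : A !=set0 by exists (eta (s - h)); exists (s - h) => //; split=> //; lra.
  have sA : has_sup A by split=> //; exists (eta (s + h) - e); apply: A_ub => //; lra.
  have : sup A < sup A + e by rewrite ltrDl.
  move=> /rat_in_itvoo[q]; rewrite in_itv/= => /andP[q1 q2]; exists q => _ t Jt; split=> ts.
    by apply: le_lt_trans q1; apply: sup_upper_bound => //; exists t.
  apply: lt_le_trans q2 _; rewrite -lerBrDr; apply: ge_sup => //; exact: A_ub.
apply/countable_injP; exists (fun s => pickle (q s)) => s t.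
rewrite !inE => Ks Kt /(pcan_inj pickleK) qst.
(* The value of [eta] at the midpoint separates the two rationals, so [q] is strictly increasing on
   [K]. *)
have wl a b : K a -> K b -> a < b -> ratr (q a) < ratr (q b) :> R.
  move=> Ka Kb ab; have [Ja _] := Ka; have [Jb _] := Kb.
  have Jm : J ((a + b) / 2) by apply: (Jc a b) => //; lra.
  have [_ h1] := Hq a Ka _ Jm; have [h2 _] := Hq b Kb _ Jm.
  by apply: (@lt_trans _ _ (eta ((a + b) / 2))); [apply: h1|apply: h2]; lra.
by case: (ltgtP s t) => // [/(wl _ _ Ks Kt)|/(wl _ _ Kt Ks)]; rewrite qst ltxx.
Qed.

(** * Second differences and differentiability *)

Section semiconvex.
Variables (R : realType) (m : nat).
Implicit Types (u : 'rV[R]_m -> R) (X B : set 'rV[R]_m).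

(** [xi] is a proximal subgradient of [u] at [x], valid on all of [B] with the constant [C]. *)
Definition semisupport u B (C : R) (x xi : 'rV[R]_m) : Prop :=
  forall y, B y -> u x + dotv xi (y - x) - C * `|y - x| ^+ 2 <= u y.

Definition locally_semiconvex u X : Prop :=
  forall x, X x -> exists r C, [/\ 0 < r, 0 <= C, ball x r `<=` X &
    forall y, ball x r y -> exists xi, semisupport u (ball x r) C y xi].

Definition diff2 u x v : R := u (x + v) + u (x - v) - 2 * u x.

(** Second differences involve values of [u] only, so this set is Borel as soon as [X] is open and
    [u] continuous; a condition on derivatives would not give this directly. *)
Definition kink u X (i : 'I_m) : set 'rV[R]_m :=
  [set x | X x /\ exists2 e, 0 < e & forall d, 0 < d -> exists h,
    [/\ 0 < h < d, X (x + h *: delta_mx 0 i), X (x - h *: delta_mx 0 i) &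
        e * h < `|diff2 u x (h *: delta_mx 0 i)|]].

Lemma norm_delta (h : R) (i : 'I_m) : `|h *: delta_mx 0 i : 'rV[R]_m| = `|h|.
Proof.
rewrite normrZ; suff -> : `|delta_mx 0 i : 'rV[R]_m| = 1 by rewrite mulr1.
apply/eqP; rewrite eq_le; apply/andP; split.
  apply/rV_norm_le => // j; rewrite mxE eqxx /=.
  by case: (_ == _); rewrite ?normr1 ?normr0.
by have := rV_coord_le (delta_mx 0 i : 'rV[R]_m) i; rewrite mxE !eqxx normr1.
Qed.

(** The trace of the ball on the line is an interval by convexity, and supports restrict to it with
    slope [xi 0 i]. *)
Lemma countable_kinks_ball u (c : 'rV[R]_m) r C (i : 'I_m) (v : 'rV[R]_m) X :
  0 < r -> 0 <= C ->
  (forall y, ball c r y -> exists xi, semisupport u (ball c r) C y xi) ->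
  countable [set t : R | ball c r (v + t *: delta_mx 0 i) /\ kink u X i (v + t *: delta_mx 0 i)].
Proof.
move=> r0 C0 H; pose p (t : R) := v + t *: delta_mx 0 i : 'rV[R]_m.
have pB s t : p s - p t = (s - t) *: delta_mx 0 i by rewrite /p scalerBl opprD addrACA subrr add0r.
apply: sub_countable (@countable_kinks1 R [set t | ball c r (p t)] (u \o p) C C0 _ _).
- apply: subset_card_le => t /= [Bt [_ [e e0 He]]]; split => //; exists e => // d d0.
  have /ballE ct := Bt.
  (* Shrinking [h] keeps both displaced points in the ball, so a kink relative to [X] is one
     relative to the ball. *)
  have [] := He (Num.min d (r - `|c - p t|)); first by rewrite lt_min d0 subr_gt0.
  move=> h [/andP[h0]]; rewrite lt_min => /andP[hd hr] _ _ Hh; exists h.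
  have E1 : p (t + h) = p t + h *: delta_mx 0 i by rewrite /p scalerDl addrA.
  have E2 : p (t - h) = p t - h *: delta_mx 0 i by rewrite /p scalerBl addrA.
  rewrite h0 hd /= E1 E2; split => //.
    apply/ballE; rewrite opprD addrA; apply: le_lt_trans (ler_normB _ _) _.
    by rewrite norm_delta gtr0_norm//; lra.
  apply/ballE; rewrite opprB addrA addrAC; apply: le_lt_trans (ler_normD _ _) _.
  by rewrite norm_delta gtr0_norm//; lra.
- move=> a b t /= Ba Bb /andP[at_ tb].
  have [E|ab] := eqVneq a b; first by have -> : t = a by lra.
  have ab' : a < b by lra.
  have ba0 : b - a != 0 by rewrite subr_eq0 eq_sym.
  pose l := (t - a) / (b - a); have l01 : 0 <= l <= 1.
    by rewrite divr_ge0/= ?ler_pdivrMr ?subr_gt0//; lra.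
  have -> : p t = (1 - l) *: p a + l *: p b.
    have -> : t = (1 - l) * a + l * b by rewrite /l; field.
    rewrite /p !scalerDr !scalerA addrACA -!scalerDl; congr (_ + _).
    by rewrite subrK scale1r.
  move/ballE in Ba; move/ballE in Bb; apply/ballE.
  have -> : c - ((1 - l) *: p a + l *: p b) = (1 - l) *: (c - p a) + l *: (c - p b).
    by rewrite !scalerBr addrACA -opprD -scalerDl subrK scale1r.
  move/andP: l01 => []; clearbody l => l0 l1.
  apply: le_lt_trans (ler_normD _ _) _; rewrite !normrZ.
  rewrite (ger0_norm l0) ger0_norm ?subr_ge0//.
  have : Num.max `|c - p a| `|c - p b| < r by rewrite gt_max Ba Bb.
  apply: le_lt_trans; set M := Num.max _ _.
  have /andP[h1 h2] : (`|c - p a| <= M) && (`|c - p b| <= M) by rewrite !le_max !lexx orbT.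
  by nra.
- move=> s /= Bs; have [xi Hxi] := H _ Bs; exists (xi 0 i) => t Bt.
  have := Hxi _ Bt; rewrite pB dotvZ dotv_delta norm_delta real_normK ?num_real// mulrC.
  by [].
Qed.

Lemma continuous_open_distP u X x : open X -> {within X, continuous u} -> X x ->
  forall e, 0 < e -> exists2 d, 0 < d & forall y, `|y - x| < d -> X y /\ `|u y - u x| < e.
Proof.
move=> oX /within_continuousP cu Xx e e0; have [d d0 dH] := cu x Xx e e0.
have /nbhs_distP[d' d'0 d'H] : nbhs x X by exact: open_nbhs_nbhs.
exists (Num.min d d'); first by rewrite lt_min d0.
by move=> y; rewrite lt_min => /andP[yd yd']; split; [exact: d'H|apply: dH => //; exact: d'H].
Qed.

Lemma diff2_cts u X (h x : 'rV[R]_m) : open X -> {within X, continuous u} ->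
  X x -> X (x + h) -> X (x - h) -> forall e, 0 < e -> exists2 d, 0 < d &
  forall y, `|y - x| < d ->
    [/\ X y, X (y + h), X (y - h) & `|diff2 u y h - diff2 u x h| < e].
Proof.
move=> oX cu Xx Xp Xm e e0; have e4 : 0 < e / 4 by rewrite divr_gt0.
have [d1 d10 H1] := continuous_open_distP oX cu Xx e4.
have [d2 d20 H2] := continuous_open_distP oX cu Xp e4.
have [d3 d30 H3] := continuous_open_distP oX cu Xm e4.
exists (Num.min d1 (Num.min d2 d3)); first by rewrite !lt_min d10 d20.
move=> y; rewrite !lt_min => /and3P[y1 y2 y3].
have [Xy uy] := H1 _ y1.
have [|Xyp uyp] := H2 (y + h); first by rewrite opprD addrACA subrr addr0.
have [|Xym uym] := H3 (y - h); first by rewrite opprB addrA subrK.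
by split => //; move: uy uyp uym; rewrite /diff2 !ltr_norml; lra.
Qed.

(* The exceptional set is a countable union of G_delta sets. *)
Lemma measurable_kink u X i : open X -> {within X, continuous u} ->
  measurable (kink u X i : set (borel_rV R m)).
Proof.
move=> oX cu; pose inv (j : nat) : R := j.+1%:R^-1.
pose O (j k : nat) : set 'rV[R]_m := \bigcup_(h in [set h : R | 0 < h < inv k])
  [set x | [/\ X x, X (x + h *: delta_mx 0 i), X (x - h *: delta_mx 0 i) &
     inv j * h < `|diff2 u x (h *: delta_mx 0 i)|]].
have invP d : 0 < d -> exists k, inv k < d.
  by move=> /ltr_add_invr[k]; rewrite add0r; exists k.
have inv0 k : 0 < inv k by rewrite invr_gt0.
have -> : kink u X i = \bigcup_j \bigcap_k O j k.
  apply/seteqP; split=> x.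
    move=> [Xx [e e0 He]]; have [j je] := invP e e0; exists j => // k _.
    have [h [/andP[h0 hk] Xp Xm Hh]] := He (inv k) (inv0 k).
    exists h; first by rewrite /= h0.
    by split=> //; apply: lt_trans Hh; rewrite ltr_pM2r.
  move=> [j _ H]; split; first by have [h _ []] := H 0%N Logic.I.
  exists (inv j) => // d d0; have [k kd] := invP d d0.
  have [h /andP[h0 hk] [_ Xp Xm Hh]] := H k Logic.I.
  by exists h; rewrite h0 (lt_trans hk kd).
apply: bigcupT_measurable => j; apply: bigcapT_measurable => k.
apply: borel_rV_open; apply: bigcup_open => h _.
rewrite openE => x [Xx Xp Xm Hh]; apply: (iffRL (@nbhs_distP R 'rV[R]_m x _)).
have [|d d0 dH] := diff2_cts oX cu Xx Xp Xm (e := `|diff2 u x (h *: delta_mx 0 i)| - inv j * h).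
  by rewrite subr_gt0.
exists d => // y /dH[Xy Xyp Xym H]; split => //; move: H; rewrite distrC => /(le_lt_trans (lerB_dist _ _)).
by rewrite ltrD2l ltrN2.
Qed.

(** Balls with rational centre and radius [inv j], together with integer constants, form a countable
    family; those that are [good] cover [X], and each contributes countably many kinks to a given
    line. *)
Lemma null_kink u X i : open X -> {within X, continuous u} -> locally_semiconvex u X ->
  @lebesgue_rV R m (kink u X i) = 0%E.
Proof.
move=> oX cu lsu; apply: (@lebesgue_rV_null R m _ i); first exact: measurable_kink.
move=> v; pose inv (j : nat) : R := j.+1%:R^-1.
have inv0 k : 0 < inv k by rewrite invr_gt0.
pose good (q : 'rV[rat]_m * nat * nat) := forall y : 'rV[R]_m, ball (map_mx ratr q.1.1 : 'rV[R]_m) (inv q.1.2) y ->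
  exists xi, semisupport u (ball (map_mx ratr q.1.1 : 'rV[R]_m) (inv q.1.2)) q.2%:R y xi.
apply: (@sub_countable _ _ _ (\bigcup_(q in [set q | good q])
  [set t : R | ball (map_mx ratr q.1.1 : 'rV[R]_m) (inv q.1.2) (v + t *: delta_mx 0 i) /\
     kink u X i (v + t *: delta_mx 0 i)])).
  apply: subset_card_le => t /= Kt; have [Xt _] := Kt.
  have [r [C [r0 C0 rX H]]] := lsu _ Xt.
  have [j jr] : exists j, 2 * inv j < r.
    have [j] := ltr_add_invr (divr_gt0 r0 (ltr0Sn R 1)); rewrite add0r => je.
    by exists j; rewrite mulrC -ltr_pdivlMr.
  have [c cx] := rat_rV_approx (v + t *: delta_mx 0 i) (inv0 j).
  rewrite box_ball// in cx.
  have sub : ball (map_mx ratr c : 'rV[R]_m) (inv j) `<=` ball (v + t *: delta_mx 0 i : 'rV[R]_m) r.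
    move=> y yc; apply: (@le_ball _ _ _ (inv j + inv j)); first by lra.
    by apply: ball_triangle yc; exact: ball_sym.
  exists (c, j, Num.bound C) => //= y yB; have [xi Hxi] := H y (sub _ yB).
  exists xi => z zB; apply: le_trans (Hxi z (sub _ zB)).
  by rewrite lerD2l lerN2 ler_wpM2r// ltW// archi_boundP.
apply: bigcup_countable; first exact: countableP.
by move=> q /= gq; apply: countable_kinks_ball gq.
Qed.

Lemma not_kinkP u X i x : X x -> ~ kink u X i x -> forall e, 0 < e ->
  exists2 d, 0 < d & forall h, 0 < h < d ->
    X (x + h *: delta_mx 0 i) -> X (x - h *: delta_mx 0 i) ->
    `|diff2 u x (h *: delta_mx 0 i)| <= e * h.
Proof.
move=> Xx nK e e0; apply: contrapT => H; apply: nK; split => //; exists e => // d d0.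
apply: contrapT => H'; apply: H; exists d => // h hd Xp Xm; rewrite leNgt; apply/negP => Hh.
by apply: H'; exists h.
Qed.

Lemma sub_ball_norm (x y : 'rV[R]_m) r : `|y - x| < r -> ball x r y.
Proof. by move=> yx; apply/ballE; rewrite distrC. Qed.

Lemma addrKl (V : zmodType) (x y : V) : x + y - x = y.
Proof. by rewrite addrAC subrr add0r. Qed.

(* The support slope bounds [u] from below on both sides of [x]; the absence of a
   kink turns the bound at [- s] into an upper bound at [s]. *)
Lemma support_coord u X r C x xi i : 0 < r -> 0 <= C -> ball x r `<=` X ->
  semisupport u (ball x r) C x xi -> ~ kink u X i x -> forall e, 0 < e ->
  exists2 d, 0 < d & forall s, `|s| < d ->
    u (x + s *: delta_mx 0 i) - u x - s * xi 0 i <= e * `|s| + C * s ^+ 2.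
Proof.
move=> r0 C0 rX Hxi nK e e0.
have Xx : X x by apply: rX; exact: ballxx.
have [d d0 dH] := not_kinkP Xx nK e0; exists (Num.min d r); first by rewrite lt_min d0.
have B s : `|s| < r -> ball x r (x + s *: delta_mx 0 i : 'rV[R]_m).
  by move=> sr; apply: sub_ball_norm; rewrite addrKl norm_delta.
have L s : `|s| < r -> u x + s * xi 0 i - C * s ^+ 2 <= u (x + s *: delta_mx 0 i).
  move=> sr; have := Hxi _ (B s sr).
  by rewrite addrKl norm_delta dotvZ dotv_delta real_normK ?num_real.
move=> s; rewrite lt_min => /andP[sd sr].
have [->|s0] := eqVneq s 0; first by rewrite scale0r addr0 normr0; lra.
have := dH `|s|; rewrite normr_gt0 s0 sd => /(_ isT).
have := B s sr; have Bm : ball x r (x + - s *: delta_mx 0 i : 'rV[R]_m) by apply: B; rewrite normrN.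
have Lm : u x + - s * xi 0 i - C * (- s) ^+ 2 <= u (x + - s *: delta_mx 0 i) by apply: L; rewrite normrN.
move: Bm Lm; rewrite sqrrN /diff2.
have [s0'|s0'] := ltP 0 s.
  rewrite gtr0_norm// -(scaleNr s (delta_mx 0 i : 'rV[R]_m)) => Bm Lm Bp /(_ (rX _ Bp) (rX _ Bm)).
  by rewrite ler_norml; lra.
rewrite ler0_norm// -(scaleNr (- s) (delta_mx 0 i : 'rV[R]_m)) opprK => Bm Lm Bp /(_ (rX _ Bm) (rX _ Bp)).
by rewrite ler_norml; lra.
Qed.

Lemma sum_const_natr (c : R) : \sum_(i < m) c = m%:R * c.
Proof. by rewrite sumr_const card_ord mulr_natl. Qed.

(* Jensen with the weights 1/(m+1): [x + v] is the barycentre of [x] and of the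
   points [x + (m+1) v_i e_i]. *)
Lemma jensen_coord u B C (x v eta : 'rV[R]_m) : 0 <= C -> B x ->
  (forall i, B (x + (m.+1%:R * v 0 i) *: delta_mx 0 i)) ->
  semisupport u B C (x + v) eta ->
  m.+1%:R * u (x + v) <= u x + \sum_i u (x + (m.+1%:R * v 0 i) *: delta_mx 0 i)
     + C * m.+1%:R * (m.+2%:R * `|v|) ^+ 2.
Proof.
move=> C0 Bx Bi H; set k : R := m.+1%:R; pose y i := (k * v 0 i) *: delta_mx 0 i : 'rV[R]_m.
have kE : k = m%:R + 1 by rewrite /k -natr1.
have m0 : 0 <= m%:R :> R by [].
have H0 : u (x + v) + dotv eta (- v) - C * `|v| ^+ 2 <= u x.
  by have := H x Bx; rewrite opprD addrA subrr add0r normrN.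
have Hi i : u (x + v) + dotv eta (y i - v) - C * `|y i - v| ^+ 2 <= u (x + y i).
  by have := H _ (Bi i); rewrite opprD addrACA subrr add0r.
have Ni i : `|y i - v| <= m.+2%:R * `|v|.
  apply: le_trans (ler_normB _ _) _; rewrite norm_delta normrM ger0_norm//.
  by rewrite -(natr1 m.+1) mulrDl mul1r lerD2r ler_wpM2l// rV_coord_le.
(* The displacements from [x + v] add up to [(m+1) v - m v - v = 0], so the unknown slope [eta]
   cancels. *)
have sumS : \sum_i dotv eta (y i - v) + dotv eta (- v) = 0.
  rewrite -dotv_sum -dotvD sumrB sumr_const card_ord.
  rewrite (_ : \sum_i y i = k *: v); last first.
    by rewrite [in RHS](row_sum_delta v) scaler_sumr; apply: eq_bigr => i _; rewrite scalerA.
  by rewrite -addrA -opprD -mulrSr -scaler_nat subrr dotv0.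
have bnd (w : 'rV[R]_m) : `|w| <= m.+2%:R * `|v| -> C * `|w| ^+ 2 <= C * (m.+2%:R * `|v|) ^+ 2 :> R.
  by move=> wv; rewrite ler_wpM2l// lerXn2r ?nnegrE// mulr_ge0.
have v_le : `|v| <= m.+2%:R * `|v| by rewrite ler_peMl// ler1n.
have := ler_sum (index_enum 'I_m) (P := xpredT) (fun i _ => Hi i).
rewrite !big_split /= sumr_const card_ord sumrN -mulr_sumr => S.
have : \sum_(i < m) C * `|y i - v| ^+ 2 <= m%:R * (C * (m.+2%:R * `|v|) ^+ 2).
  apply: (@le_trans _ _ (\sum_(i < m) C * (m.+2%:R * `|v|) ^+ 2)).
    by apply: ler_sum => i _; exact: bnd.
  by rewrite sum_const_natr.
have := bnd v v_le.
move: S; rewrite -mulr_sumr -[_ *+ m]mulr_natl.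
rewrite -[X in _ <= X -> _]/(\sum_(i < m) u (x + (k * v 0 i) *: delta_mx 0 i)) -/k.
set q := (m.+2%:R * `|v|) ^+ 2; set S1 := \sum_(i < m) `|_| ^+ 2; set S2 := \sum_(i < m) u _.
by rewrite kE; move: sumS; set S3 := \sum_i dotv _ _; lra.
Qed.

(** The support at [x] gives the lower half of the expansion. The upper half is known along the
    coordinate axes, where there is no kink, and Jensen's inequality carries it to an arbitrary
    increment. *)
Lemma semiconvex_differentiable u X r C x xi : 0 < r -> 0 <= C ->
  ball x r `<=` X -> (forall y, ball x r y -> exists eta, semisupport u (ball x r) C y eta) ->
  semisupport u (ball x r) C x xi -> (forall i, ~ kink u X i x) ->
  differentiable u x /\ grad u x = xi.
Proof.
move=> r0 C0 rX H Hxi nK; apply: differentiable_grad => e e0.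
set k : R := m.+1%:R; have k0 : 0 < k by rewrite ltr0n.
have k1 : 1 <= k by rewrite ler1n.
(* The axis increments are [k * v 0 i], so this tolerance leaves an error of at most
   [e / 2 * |v|]. *)
have e'0 : 0 < e / (2 * k) by rewrite divr_gt0// mulr_gt0.
have [d d0 dH] : exists2 d, 0 < d & forall i s, `|s| < d ->
    u (x + s *: delta_mx 0 i) - u x - s * xi 0 i <= e / (2 * k) * `|s| + C * s ^+ 2.
  have /choice[f Hf] : forall i, exists d, 0 < d /\ forall s, `|s| < d ->
      u (x + s *: delta_mx 0 i) - u x - s * xi 0 i <= e / (2 * k) * `|s| + C * s ^+ 2.
    by move=> i; have [d d0 dH] := support_coord r0 C0 rX Hxi (nK i) e'0; exists d.
  exists (\big[Num.min/1]_i f i); first by apply: lt_bigmin => // i _; have [] := Hf i.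
  move=> i s sd; have [_] := Hf i; apply; apply: lt_le_trans sd _.
  by rewrite (bigD1 i)//= ge_min lexx.
(* [K] dominates the quadratic coefficients of both halves; [|v| < e / (2 * K)] turns these terms
   into at most [e / 2 * |v|]. *)
pose K := C * k ^+ 2 + C * (m.+2%:R) ^+ 2 + C + 1.
have K0 : 0 < K by rewrite !ltr_wpDl// ?addr_ge0// mulr_ge0// exprn_ge0.
exists (Num.min (Num.min (d / k) (r / k)) (e / (2 * K))).
  by rewrite !lt_min !divr_gt0// mulr_gt0.
move=> v; rewrite !lt_min !ltr_pdivlMr// ?mulr_gt0// => /andP[/andP[vd vr] ve].
have v0 : 0 <= `|v| by [].
have vr' : `|v| < r by apply: le_lt_trans vr; rewrite ler_peMr.
have Bv : ball x r (x + v) by apply: sub_ball_norm; rewrite addrKl.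
have kv i : `|k * v 0 i| <= k * `|v|.
  by rewrite normrM gtr0_norm// ler_wpM2l ?(ltW k0)// rV_coord_le.
have Bi i : ball x r (x + (k * v 0 i) *: delta_mx 0 i : 'rV[R]_m).
  apply: sub_ball_norm; rewrite addrKl norm_delta.
  by apply: le_lt_trans (kv i) _; rewrite mulrC.
have [eta Heta] := H _ Bv.
have lo : u x + dotv xi v - C * `|v| ^+ 2 <= u (x + v).
  by have := Hxi _ Bv; rewrite addrKl.
have up := jensen_coord C0 (ballxx x r0) Bi Heta.
have Hi i : u (x + (k * v 0 i) *: delta_mx 0 i) <=
    u x + k * (xi 0 i * v 0 i) + e / 2 * `|v| + C * k ^+ 2 * `|v| ^+ 2.
  have := dH i (k * v 0 i) _; have := kv i => h1; have h2 : `|k * v 0 i| < d.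
    by apply: le_lt_trans h1 _; rewrite mulrC.
  move=> /(_ h2).
  have h3 : e / (2 * k) * `|k * v 0 i| <= e / 2 * `|v|.
    have -> : e / 2 * `|v| = e / (2 * k) * (k * `|v|) by field; rewrite gt_eqF.
    by rewrite ler_wpM2l// ltW.
  have h4 : C * (k * v 0 i) ^+ 2 <= C * k ^+ 2 * `|v| ^+ 2.
    rewrite -mulrA ler_wpM2l// -exprMn -real_normK ?num_real//.
    by rewrite lerXn2r ?nnegrE// mulr_ge0// ltW.
  move=> h5; have {}h5 : u (x + (k * v 0 i) *: delta_mx 0 i) - u x - k * v 0 i * xi 0 i <=
    e / 2 * `|v| + C * k ^+ 2 * `|v| ^+ 2 by apply: le_trans h5 _; exact: lerD.
  by rewrite [xi 0 i * _]mulrC mulrA -!addrA -lerBlDl -lerBlDl.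
have S : \sum_i u (x + (k * v 0 i) *: delta_mx 0 i) <=
    m%:R * u x + k * dotv xi v + m%:R * (e / 2 * `|v| + C * k ^+ 2 * `|v| ^+ 2).
  apply: le_trans (ler_sum _ (fun i _ => Hi i)) _.
  rewrite !big_split /= !sum_const_natr -mulr_sumr mulrDr.
  by rewrite /dotv !addrA.
have mk : m%:R = k - 1 by rewrite /k -natr1 addrK.
rewrite ler_norml; apply/andP; split.
  have : C * `|v| ^+ 2 <= e * `|v|.
    have : K * `|v| <= e / 2 by lra.
    have : C <= K by rewrite /K; have := exprn_ge0 2 (ltW k0); have := @exprn_ge0 R m.+2%:R 2 (ler0n _ _); nra.
    by rewrite expr2 => h1 h2; nra.
  by lra.
have {up}up : k * (u (x + v) - u x - dotv xi v) <= k * (e / 2 * `|v| + C * k ^+ 2 * `|v| ^+ 2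
     + C * (m.+2%:R * `|v|) ^+ 2).
  move: up S; rewrite -/k mk; set S := \sum_i _.
  have : 0 <= e / 2 * `|v| + C * k ^+ 2 * `|v| ^+ 2.
    have h1 : 0 <= e / 2 * `|v| by rewrite mulr_ge0// ltW// divr_gt0.
    have h2 : 0 <= C * k ^+ 2 * `|v| ^+ 2 by rewrite !mulr_ge0 ?exprn_ge0// ltW.
    exact: addr_ge0.
  by lra.
move: up; rewrite ler_pM2l// => up.
have : (C * k ^+ 2 + C * m.+2%:R ^+ 2) * `|v| ^+ 2 <= e / 2 * `|v|.
  have h1 : K * `|v| <= e / 2 by lra.
  have h2 : C * k ^+ 2 + C * m.+2%:R ^+ 2 <= K by rewrite /K; lra.
  rewrite expr2 mulrA ler_wpM2r//; apply: le_trans h1; exact: ler_wpM2r.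
by rewrite exprMn in up; lra.
Qed.

(** The supports at [y] bound each partial derivative on both sides by difference quotients of [u]
    with a fixed step [h]. Continuity of [u] moves these to [x], where differentiability compares
    them with the gradient. So [h] is chosen before the neighbourhood of [x]. *)
Lemma semiconvex_grad_cts u X r C x : 0 < r -> 0 <= C ->
  open X -> {within X, continuous u} ->
  ball x r `<=` X -> differentiable u x ->
  forall e, 0 < e -> exists2 d, 0 < d & forall y, `|y - x| < d ->
    semisupport u (ball x r) C y (grad u y) -> `|grad u y - grad u x| < e.
Proof.
move=> r0 C0 oX cu rX du e e0.
(* Four errors of [e / 8 * h] arise: linearisation at [x], the term [C * h ^+ 2], and the two values
   of [u] moved from [y] to [x]. *)
have e8 : 0 < e / 8 by rewrite divr_gt0.
have [d d0 dH] := differentiable_gradP du e8.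
have [h [h0 hd hr hC]] : exists h, [/\ 0 < h, h < d, h < r / 2 & C * h <= e / 8].
  exists (Num.min (Num.min (d / 2) (r / 4)) (e / 8 / (C + 1))).
  have C1 : 0 < C + 1 by lra.
  split; first by rewrite !lt_min !divr_gt0.
  - by rewrite !gt_min; apply/orP; left; apply/orP; left; lra.
  - by rewrite !gt_min; apply/orP; left; apply/orP; right; lra.
  - apply: (@le_trans _ _ (C * (e / 8 / (C + 1)))); first by rewrite ler_wpM2l// ge_min lexx orbT.
    by rewrite mulrA ler_pdivrMr// mulrDr mulr1 mulrC lerDl ltW.
have Bs s i : `|s| <= h -> ball x r (x + s *: delta_mx 0 i : 'rV[R]_m).
  by move=> sh; apply: sub_ball_norm; rewrite addrKl norm_delta; lra.
have [d1 d10 H1] : exists2 d1, 0 < d1 & forall i s y, (s = 0) \/ (s = h) \/ (s = - h) ->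
    `|y - (x + s *: delta_mx 0 i)| < d1 -> `|u y - u (x + s *: delta_mx 0 i)| < e / 8 * h.
  have eh : 0 < e / 8 * h by rewrite mulr_gt0.
  have /choice[f Hf] : forall i, exists d1, 0 < d1 /\ forall s y, (s = 0) \/ (s = h) \/ (s = - h) ->
    `|y - (x + s *: delta_mx 0 i)| < d1 -> `|u y - u (x + s *: delta_mx 0 i)| < e / 8 * h.
    move=> i; have c s : `|s| <= h -> exists2 d2, 0 < d2 & forall y,
       `|y - (x + s *: delta_mx 0 i)| < d2 -> `|u y - u (x + s *: delta_mx 0 i)| < e / 8 * h.
      move=> sh; have [d2 d20 H2] := continuous_open_distP oX cu (rX _ (Bs s i sh)) eh.
      by exists d2 => // y /H2[].
    have [|a1 a10 A1] := c 0; first by rewrite normr0 ltW.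
    have [|a2 a20 A2] := c h; first by rewrite gtr0_norm.
    have [|a3 a30 A3] := c (- h); first by rewrite normrN gtr0_norm.
    exists (Num.min a1 (Num.min a2 a3)); rewrite !lt_min a10 a20 a30; split => // s y.
    by move=> [->|[->|->]]; rewrite !lt_min => /and3P[? ? ?]; [exact: A1|exact: A2|exact: A3].
  exists (\big[Num.min/1]_i f i); first by apply: lt_bigmin => // i _; have [] := Hf i.
  move=> i s y Hs sd; have [_] := Hf i; apply => //; apply: lt_le_trans sd _.
  by rewrite (bigD1 i)//= ge_min lexx.
exists (Num.min d1 (r / 2)); first by rewrite lt_min d10 divr_gt0.
move=> y; rewrite lt_min => /andP[yd yr] Hy; apply/rV_norm_lt => // i; rewrite !mxE.
have dv s : `|s| = h -> `|u (x + s *: delta_mx 0 i) - u x - s * grad u x 0 i| <= e / 8 * h.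
  by move=> sh; have := dH (s *: delta_mx 0 i); rewrite norm_delta sh dotvZ dotv_delta; apply.
have uy s : s = 0 \/ s = h \/ s = - h -> `|u (y + s *: delta_mx 0 i) - u (x + s *: delta_mx 0 i)| < e / 8 * h.
  by move=> Hs; apply: H1 => //; rewrite opprD addrACA subrr addr0.
have up s : `|s| = h -> u y + s * grad u y 0 i - C * h ^+ 2 <= u (y + s *: delta_mx 0 i).
  move=> sh; have := Hy (y + s *: delta_mx 0 i); rewrite addrKl norm_delta sh dotvZ dotv_delta.
  apply; apply: sub_ball_norm; rewrite addrAC; apply: le_lt_trans (ler_normD _ _) _.
  by rewrite norm_delta sh; lra.
have hh : C * h ^+ 2 <= e / 8 * h by rewrite expr2 mulrA ler_wpM2r// ltW.
have nh : `|h| = h by rewrite gtr0_norm.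
have nnh : `|- h| = h by rewrite normrN.
have := uy 0 (or_introl erefl); rewrite !scale0r !addr0.
have := uy h (or_intror (or_introl erefl)); have := uy (- h) (or_intror (or_intror erefl)).
have := up h nh; have := up (- h) nnh; have := dv h nh; have := dv (- h) nnh.
rewrite !mxE; set g := 'D_(_) u y; set g' := 'D_(_) u x.
rewrite !ler_norml !ltr_norml => D1 D2 U1 U2 V1 V2 V0.
have lo : - e * h < (g - g') * h by lra.
have hi : (g - g') * h < e * h by lra.
by rewrite -(ltr_pM2r h0) lo /= -(ltr_pM2r h0).
Qed.

End semiconvex.

(* The difference with the parabola [K/4 s (1 - s)] cannot have a negative
   interior minimum. *)
Lemma concave_of_diff2 (R : realType) (f : R -> R) (K : R) : 0 < K ->
  {within `[0, 1], continuous f} ->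
  (forall s, 0 < s < 1 -> exists2 d, 0 < d & forall h, 0 < h < d ->
     0 <= s - h -> s + h <= 1 -> K * h ^+ 2 <= 2 * f s - f (s + h) - f (s - h)) ->
  forall t, 0 <= t <= 1 -> K / 4 * (t * (1 - t)) <= f t - (1 - t) * f 0 - t * f 1.
Proof.
move=> K0 cf H t t01.
(* The sharp coefficient would be [K / 2]. Half of it leaves [2 g(s) - g(s+h) - g(s-h) >= K / 2 * h
   ^+ 2 > 0], which contradicts minimality at [s]. *)
pose g s := f s - ((1 - s) * f 0 + s * f 1 + K / 4 * (s * (1 - s))).
have cg : {within `[0, 1], continuous g}.
  apply/within_continuousP => s /=; rewrite in_itv /= => s01 e e0.
  have e2 : 0 < e / 2 by rewrite divr_gt0.
  have [|d d0 dH] := iffLR (@within_continuousP _ _ _ _ f) cf s _ _ e2.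
    by rewrite /= in_itv.
  set L := `|f 1 - f 0| + K / 4; have L0 : 0 < L by rewrite ltr_wpDl// divr_gt0.
  exists (Num.min d (e / 2 / L)); first by rewrite lt_min d0 !divr_gt0.
  move=> s' /=; rewrite in_itv /= => s'01; rewrite lt_min => /andP[sd].
  rewrite ltr_pdivlMr// => sL; have := dH s'; rewrite /= in_itv => /(_ s'01 sd) h1.
  rewrite (_ : g s' - g s = (f s' - f s) - (s' - s) * (f 1 - f 0 + K / 4 * (1 - s - s'))); last by rewrite /g; ring.
  apply: le_lt_trans (ler_normB _ _) _; rewrite normrM.
  suff : `|f 1 - f 0 + K / 4 * (1 - s - s')| <= L.
    by move=> /(ler_wpM2l (normr_ge0 (s' - s))); lra.
  apply: le_trans (ler_normD _ _) _; rewrite lerD2l normrM gtr0_norm ?divr_gt0//.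
  by rewrite ler_piMr ?divr_ge0 ?(ltW K0)// ler_norml; lra.
have [s s01 smin] := EVT_min ler01 cg.
rewrite in_itv /= in s01.
have g0 : g 0 = 0 by rewrite /g; ring.
have g1 : g 1 = 0 by rewrite /g; ring.
suff gs : 0 <= g s.
  by have := smin t; rewrite in_itv /= t01 => /(_ isT); move: gs; rewrite /g; lra.
have [//|gs] := leP 0 (g s); exfalso.
have s0 : s != 0 by apply: contraTneq gs => ->; rewrite g0 ltxx.
have s1 : s != 1 by apply: contraTneq gs => ->; rewrite g1 ltxx.
have {}s01 : 0 < s < 1 by rewrite !lt_neqAle s1 [0 == s]eq_sym s0.
have [d d0 dH] := H s s01; have /andP[s0' s1'] := s01.
pose h := Num.min (d / 2) (Num.min s (1 - s)).
have h0 : 0 < h by rewrite !lt_min divr_gt0// s0' subr_gt0.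
have [hd hs hs'] : [/\ h <= d / 2, h <= s & h <= 1 - s] by rewrite !ge_min !lexx ?orbT.
have := dH h; have h0d : 0 < h < d by lra.
have sm : 0 <= s - h by lra.
have sp : s + h <= 1 by lra.
move=> /(_ h0d sm sp) Hh.
have := smin (s - h); rewrite in_itv /= sm => /(_ _) g_m.
have {}g_m : g s <= g (s - h) by apply: g_m; lra.
have := smin (s + h); rewrite in_itv /= sp andbT => /(_ _) g_p.
have {}g_p : g s <= g (s + h) by apply: g_p; lra.
have : 0 < K * h ^+ 2 by rewrite mulr_gt0// exprn_gt0.
move: g_m g_p Hh; rewrite /g !expr2; nra.
Qed.
(** * Products, norms and integrals *)

Section pairs.
Variables (R : realType) (E F : normedModType R).
Implicit Types (p q : E * F).

Lemma pair_normE p : `|p| = Num.max `|p.1| `|p.2|.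
Proof. by rewrite prod_normE. Qed.

Lemma pair_norm_lt p (e : R) : (`|p| < e) = (`|p.1| < e) && (`|p.2| < e).
Proof. by rewrite pair_normE gt_max. Qed.

Lemma pair_norm_le p (e : R) : (`|p| <= e) = (`|p.1| <= e) && (`|p.2| <= e).
Proof. by rewrite pair_normE ge_max. Qed.

Lemma pair_norml (x : E) : `|(x, 0 : F)| = `|x|.
Proof. by rewrite pair_normE normr0 max_l. Qed.

Lemma pair_normr (y : F) : `|(0 : E, y)| = `|y|.
Proof. by rewrite pair_normE normr0 max_r. Qed.

Lemma pairB (x x' : E) (y y' : F) : (x, y) - (x', y') = (x - x', y - y').
Proof. by []. Qed.

Lemma pairDZ (h : R) (x u : E) (y v : F) : (x, y) + h *: (u, v) = (x + h *: u, y + h *: v).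
Proof. by []. Qed.

Lemma pairD (x u : E) (y v : F) : (x, y) + (u, v) = (x + u, y + v).
Proof. by []. Qed.

Lemma pairZD (h : R) (x u : E) (y v : F) : h *: (u, v) + (x, y) = (h *: u + x, h *: v + y).
Proof. by []. Qed.

End pairs.

Lemma sqnorm_ge (R : realType) k (q : 'rV[R]_k * R) : `|q| ^+ 2 <= sqnorm q.
Proof.
have sge : 0 <= \sum_(i < k) q.1 0 i ^+ 2 by apply: sumr_ge0 => i _; exact: sqr_ge0.
have s0 : 0 <= sqnorm q by rewrite addr_ge0// sqr_ge0.
rewrite -[leRHS]sqr_sqrtr// lerXn2r ?nnegrE ?sqrtr_ge0// pair_norm_le; apply/andP; split.
  apply/rV_norm_le => [|i]; first exact: sqrtr_ge0.
  rewrite -sqrtr_sqr ler_sqrt// /sqnorm (bigD1 i)//= -!addrA lerDl addr_ge0 ?sqr_ge0//.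
  by apply: sumr_ge0 => j _; exact: sqr_ge0.
by rewrite -sqrtr_sqr ler_sqrt// lerDr.
Qed.

Lemma sqnorm_le (R : realType) k (q : 'rV[R]_k * R) : sqnorm q <= k.+1%:R * `|q| ^+ 2.
Proof.
have [h1 h2] : `|q.1| <= `|q| /\ `|q.2| <= `|q|.
  by apply/andP; rewrite -pair_norm_le.
rewrite /sqnorm -natr1 mulrDl mul1r; apply: lerD.
  rewrite -sum_const_natr; apply: ler_sum => i _.
  rewrite -real_normK ?num_real// lerXn2r ?nnegrE//.
  exact: le_trans (rV_coord_le _ _) h1.
by rewrite -real_normK ?num_real// lerXn2r ?nnegrE.
Qed.

Lemma sqnorm_ge0 (R : realType) k (q : 'rV[R]_k * R) : 0 <= sqnorm q.
Proof. by apply: le_trans (sqnorm_ge q); exact: sqr_ge0. Qed.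

Lemma enorm_ge (R : realType) k (q : 'rV[R]_k * R) : `|q| <= enorm q.
Proof. by rewrite -[leLHS]ger0_norm// -sqrtr_sqr ler_sqrt ?sqnorm_ge0// sqnorm_ge. Qed.

Lemma enorm_le (R : realType) k (q : 'rV[R]_k * R) : enorm q <= k.+1%:R * `|q|.
Proof.
rewrite -[leRHS]ger0_norm ?mulr_ge0// -sqrtr_sqr ler_sqrt ?sqr_ge0//.
apply: le_trans (sqnorm_le q) _; rewrite exprMn ler_wpM2r ?sqr_ge0//.
by rewrite expr2 ler_peMr// ler1n.
Qed.

Lemma sqnorm_cts (R : realType) k (q : 'rV[R]_k * R) (e : R) : 0 < e -> exists2 d, 0 < d &
  forall q', `|q' - q| < d -> `|sqnorm q' - sqnorm q| < e.
Proof.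
move=> e0; pose N := `|q|; have N0 : 0 <= N by exact: normr_ge0.
have N1 : 0 < 2 * N + 1 by rewrite ltr_wpDl ?mulr_ge0.
pose Q := k.+1%:R * (2 * N + 1); have Q0 : 0 < Q by rewrite mulr_gt0.
exists (Num.min 1 (e / Q)); first by rewrite lt_min ltr01 divr_gt0.
move=> q'; rewrite lt_min => /andP[/ltW z1]; rewrite ltr_pdivlMr//; apply: le_lt_trans.
have key (s t : R) : `|t - s| <= `|q' - q| -> `|s| <= N ->
    `|t ^+ 2 - s ^+ 2| <= `|q' - q| * (2 * N + 1).
  move=> ts sN; have -> : t ^+ 2 - s ^+ 2 = (t - s) * (2 * s + (t - s)) by ring.
  rewrite normrM ler_pM//; apply: le_trans (ler_normD _ _) _.
  rewrite normrM ger0_norm// lerD ?ler_wpM2l//; exact: le_trans ts z1.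
have /andP[h1 h2] : (`|q'.1 - q.1| <= `|q' - q|) && (`|q'.2 - q.2| <= `|q' - q|).
  by have := lexx `|q' - q|; rewrite {1}pair_norm_le.
have [h3 h4] : `|q.1| <= N /\ `|q.2| <= N by apply/andP; rewrite -pair_norm_le.
have -> : `|q' - q| * Q = k%:R * (`|q' - q| * (2 * N + 1)) + `|q' - q| * (2 * N + 1).
  by rewrite /Q -natr1; ring.
rewrite /sqnorm opprD addrACA -sumrB; apply: le_trans (ler_normD _ _) _; apply: lerD; last exact: key.
rewrite -sum_const_natr; apply: le_trans (ler_norm_sum _ _ _) _; apply: ler_sum => i _.
apply: key; last exact: le_trans (rV_coord_le _ _) h3.
by apply: le_trans h1; have := rV_coord_le (q'.1 - q.1) i; rewrite !mxE.
Qed.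

Lemma grad_lin (R : realType) k (u v : 'rV[R]_k -> R) (a b : R) x :
  differentiable u x -> differentiable v x ->
  differentiable (fun y => a * u y + b * v y) x /\
  grad (fun y => a * u y + b * v y) x = a *: grad u x + b *: grad v x.
Proof.
move=> du dv; apply: differentiable_grad => e e0.
pose K := `|a| + `|b| + 1; have K0 : 0 < K by rewrite ltr_wpDl// addr_ge0.
have [d d0 dH] := differentiable_gradP du (divr_gt0 e0 K0).
have [d' d'0 d'H] := differentiable_gradP dv (divr_gt0 e0 K0).
exists (Num.min d d'); first by rewrite lt_min d0.
move=> w; rewrite lt_min => /andP[/dH h /d'H h'].
have -> : dotv (a *: grad u x + b *: grad v x) w = a * dotv (grad u x) w + b * dotv (grad v x) w.
  rewrite /dotv !mulr_sumr -big_split; apply: eq_bigr => i _ /=.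
  by rewrite mxE [X in X + _]mxE [X in _ + X]mxE; ring.
have -> : a * u (x + w) + b * v (x + w) - (a * u x + b * v x) -
    (a * dotv (grad u x) w + b * dotv (grad v x) w) =
  a * (u (x + w) - u x - dotv (grad u x) w) + b * (v (x + w) - v x - dotv (grad v x) w) by ring.
apply: le_trans (ler_normD _ _) _; rewrite !normrM.
apply: le_trans (lerD (ler_wpM2l _ h) (ler_wpM2l _ h')) _ => //.
rewrite -mulrDl !mulrA ler_wpM2r// ler_pdivrMr// mulrC ler_wpM2l ?(ltW e0)//.
by rewrite lerDl.
Qed.

(** Relative continuity suffices: the preimage of a ray is the trace on [D] of the open set [U]. *)
Lemma measurable_fun_within (R : realType) k (D : set (borel_rV R k)) (f : 'rV[R]_k -> R) :
  (forall x, D x -> forall e, 0 < e -> exists2 d, 0 < d & forall y, D y -> `|y - x| < d -> `|f y - f x| < e) ->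
  measurable_fun D (f : borel_rV R k -> R).
Proof.
move=> H mD; apply: (measurability _ (RGenOInfty.measurableE R)) => //.
move=> /= _ [_ [a ->] <-].
pose U : set 'rV[R]_k := \bigcup_(xd in [set xd : 'rV[R]_k * R | forall y, D y -> `|y - xd.1| < xd.2 -> a < f y])
  [set y | `|y - xd.1| < xd.2].
have -> : D `&` f @^-1` `]a, +oo[ = D `&` U.
  apply/seteqP; split=> x [Dx] /=; rewrite ?in_itv /= ?andbT => fx; split=> //.
    have fx0 : 0 < f x - a by rewrite subr_gt0.
    have [d d0 dH] := H x Dx _ fx0; exists (x, d) => /=; last by rewrite subrr normr0.
    by move=> y Dy /(dH _ Dy); rewrite ltr_norml; lra.
  by have [[z d] /= zd xz] := fx; exact: zd.
apply: measurableI => //; apply: borel_rV_open.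
rewrite openE => x [[z d] /= zd xz]; apply: (iffRL (nbhs_distP x _)).
exists (d - `|x - z|); first by rewrite subr_gt0.
move=> y; rewrite ltrBrDr => yx; exists (z, d) => //=; apply: le_lt_trans yx.
by rewrite -{1}(subrK x y) -addrA; exact: ler_normD.
Qed.

Lemma EFin_mulBr (R : realType) (a : R) (x y : \bar R) : 0 < a ->
  (a%:E * (x - y) = a%:E * x - a%:E * y)%E.
Proof.
move=> a0; case: x => [x| |]; case: y => [y| |];
  rewrite /= ?(gt0_mulye, gt0_muley, gt0_mulNye, gt0_muleNy) ?lte_fin//=.
all: rewrite -?EFinM ?(addye, addey, addeNy, addNye, gt0_muley, gt0_muleNy) ?lte_fin//.
by rewrite mulrBr.
Qed.

Lemma le_integralZl d (T : measurableType d) (R : realType)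
    (mu : {measure set T -> \bar R}) (D : set T) (f : T -> R) (a : R) :
  measurable D -> measurable_fun D f -> 0 <= a ->
  (a%:E * \int[mu]_(x in D) (f x)%:E <= \int[mu]_(x in D) (a * f x)%:E)%E.
Proof.
move=> mD mf; rewrite le_eqVlt => /orP[/eqP<-|a0].
  by rewrite mul0e; under eq_integral do rewrite mul0r; rewrite integral0.
have mF : @measurable_fun _ _ T (\bar R) D (fun x => (f x)%:E) by exact/measurable_EFinP.
rewrite integralE [leRHS]integralE EFin_mulBr//.
rewrite -!ge0_integralZl_EFin//; try by [exact: measurable_funepos|exact: measurable_funeneg|exact: ltW].
rewrite le_eqVlt; apply/orP; left; apply/eqP; congr (_ - _)%E; apply: eq_integral => x _.
  by rewrite !funeposE -!EFin_max -EFinM maxr_pMr ?mulr0// ltW.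
by rewrite !funenegE -!EFinN -!EFin_max -EFinM maxr_pMr ?mulr0 ?mulrN// ltW.
Qed.

Lemma box_probability (R : realType) k (c : 'rV[R]_k) r : 0 < r ->
  exists mu : probability (borel_rV R k) R,
    [/\ mu `<< @lebesgue_rV R k, mu (~` box c r) = 0%E &
        forall X : set (borel_rV R k), box c r `<=` X -> mu X = 1%E].
Proof.
move=> r0; have [nu nuE nu_box] := lebesgue_rV_measure R k.
have mB := measurable_box c r0; have /andP[B0 Boo] := nu_box c r r0.
(* The Dirac mass is the fallback of [mnormalize] for zero or infinite total mass; [nu_box] excludes
   both. *)
pose mu := mnormalize (mrestr nu mB) (\d_(0 : borel_rV R k)).
have muE A : mu A = (nu (A `&` box c r) * (fine (nu (box c r)))^-1%:E)%E.
  by rewrite /mu /mnormalize /= /mrestr setTI gt_eqF//= lt_eqF.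
exists mu; split=> [A||A BA].
- rewrite -nuE => nA B mB' BA; apply: etrans (muE B) _.
  have -> : nu (B `&` box c r) = 0%E; last by rewrite mul0e.
  by apply: nA; [exact: measurableI|move=> x [/BA]].
- by apply: etrans (muE _) _; rewrite setICl measure0 mul0e.
- apply: etrans (muE _) _; rewrite setIidr//; have fB : nu (box c r) \is a fin_num by rewrite ge0_fin_numE// ltW.
  by rewrite -{1}(fineK fB) -EFinM divff// fine_eq0// gt_eqF.
Qed.

(** * Closures, directional derivatives, compactness and mean values *)

Section closure_distance.
Variables (R : realType).

Lemma closure_distP (E : normedModType R) (A : set E) x :
  closure A x <-> forall e : R, 0 < e -> exists2 y, A y & `|y - x| < e.
Proof.
split=> [clA e e0|H B /nbhs_distP[d d0 dB]].
  have [y [Ay yB]] := clA _ (nbhsx_ballx x e e0).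
  by exists y => //; move/ballE: yB; rewrite distrC.
by have [y Ay yd] := H d d0; exists y; split=> //; exact: dB.
Qed.

Lemma closureX (E F : normedModType R) (A : set E) (B : set F) :
  closure (A `*` B) = closure A `*` closure B.
Proof.
apply/seteqP; split=> [[x y] /closure_distP H|[x y] [/= /closure_distP Hx /closure_distP Hy]].
  have {}H e : 0 < e -> exists a b, [/\ A a, B b, `|a - x| < e & `|b - y| < e].
    move=> /H[[a b] [/= Aa Bb]]; rewrite pairB pair_norm_lt => /andP[? ?].
    by exists a, b.
  by split; apply/closure_distP => e /H[a [b [? ? ? ?]]]; [exists a|exists b].
apply/closure_distP => e e0; have [a Aa ax] := Hx e e0; have [b Bb by_] := Hy e e0.
by exists (a, b) => //; rewrite pairB pair_norm_lt ax.
Qed.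

End closure_distance.

Section directional.
Variables (R : realType) (E : normedModType R).

Lemma derive_distE (f : E -> R) (q v : E) (l : R) :
  (forall e, 0 < e -> exists2 d, 0 < d & forall h, `|h| < d ->
     `|f (q + h *: v) - f q - h * l| <= e * `|h|) -> 'D_v f q = l.
Proof.
move=> H; apply: cvg_lim => //; apply/cvgrPdist_le => e e0.
have [d d0 dH] := H e e0.
apply: (iffRL (within_distP [set h : R | h != 0] 0 _)); exists d => // h /= h0; rewrite subr0 => hd.
rewrite /= [h *: v + q]addrC; have Hh := dH h hd.
have -> : h^-1 *: (f (q + h *: v) - f q) = l + h^-1 * (f (q + h *: v) - f q - h * l).
  by rewrite mulrBr mulKf// [RHS]addrC subrK.
by rewrite distrC addrKl normrM normfV ler_pdivrMl ?normr_gt0// [`|h| * e]mulrC.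
Qed.

Lemma near_line (B : set E) (q v : E) : open B -> B q ->
  exists2 d : R, 0 < d & forall h, `|h| < d -> B (q + h *: v).
Proof.
move=> oB Bq; have /nbhs_distP[d d0 dB] : nbhs q B by exact: open_nbhs_nbhs.
have v1 : 0 < `|v| + 1 by rewrite ltr_wpDl.
exists (d / (`|v| + 1)); first exact: divr_gt0.
move=> h hd; apply: dB; rewrite addrKl normrZ; move: hd; rewrite ltr_pdivlMr//.
by apply: le_lt_trans; rewrite ler_wpM2l// lerDl.
Qed.

Lemma cl_value_distE (B : set E) (f g : E -> R) (q : E) :
  closure B q -> (forall y, B y -> f y = g y) ->
  (forall e, 0 < e -> exists2 d, 0 < d & forall y, B y -> `|y - q| < d -> `|g y - g q| < e) ->
  cl_value B f q = g q.
Proof.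
move=> clB fg H; rewrite /cl_value.
have PF : ProperFilter (within B (nbhs q)) by exact: within_nbhs_proper.
apply: cvg_lim => //; apply/cvgrPdist_lt => e e0; apply/within_distP.
by have [d d0 dH] := H e e0; exists d => // y By yd; rewrite distrC fg// dH.
Qed.

End directional.

Section compact_bounds.
Variables (R : realType) (m n : nat).
Local Notation E := ('rV[R]_m * ('rV[R]_n * R))%type.

Lemma compact_bound (T : topologicalType) (B : set T) (f : T -> R) :
  compact B -> {within B, continuous f} -> exists2 K, 0 <= K & forall q, B q -> `|f q| <= K.
Proof.
move=> cB cf; have [[q0 Bq0]|B0] := pselect (B !=set0); last first.
  by exists 0 => // q Bq; exfalso; apply: B0; exists q.
have [|a _ aH] := @compact_EVT_max T R (fun q => `|f q|) B (ex_intro _ q0 Bq0) cB.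
  by move=> x; apply: (@cvg_norm _ R^o); exact: cf.
by exists `|f a| => // q Bq; apply: aH; rewrite inE.
Qed.

Lemma lin_coord (L : {linear E -> R^o}) (v : E) :
  L v = \sum_i v.1 0 i * L (delta_mx 0 i, 0) +
        (\sum_j v.2.1 0 j * L (0, (delta_mx 0 j, 0)) + v.2.2 * L (0, (0, 1))).
Proof.
case: v => x [y z] /=.
have -> : (x, (y, z)) = (x, 0) + ((0, (y, 0)) + (0, (0, z))).
  by congr (_, (_, _)); rewrite /= ?(addr0, add0r).
rewrite !linearD; congr (_ + (_ + _)).
- have -> : (x, 0) = \sum_i x 0 i *: (delta_mx 0 i, 0 : 'rV[R]_n * R).
    rewrite [x in LHS]row_sum_delta; apply: (big_rec2 (fun a b => (a, 0) = b)) => // i a b _ <-.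
    by rewrite pairZD scaler0 addr0.
  by rewrite linear_sum; apply: eq_bigr => i _; rewrite linearZ.
- have -> : (0, (y, 0)) = \sum_j y 0 j *: (0 : 'rV[R]_m, (delta_mx 0 j, 0 : R)).
    rewrite [y in LHS]row_sum_delta; apply: (big_rec2 (fun a b => (0, (a, 0)) = b)) => // i a b _ <-.
    by rewrite !pairZD !scaler0 !addr0.
  by rewrite linear_sum; apply: eq_bigr => i _; rewrite linearZ.
- rewrite -[RHS]linearZ; congr (L _); congr (_, (_, _)); rewrite /= ?scaler0//.
  by rewrite [_ *: 1]mulr1.
Qed.

(** Continuity is known only for each fixed vector; expanding in coordinates reduces the operator
    bound to finitely many basis vectors. *)
Lemma lin_bounded (B : set E) (l : E -> {linear E -> R^o}) : compact B ->
  (forall v, {within B, continuous (fun q => l q v)}) ->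
  exists2 K, 0 <= K & forall q v, B q -> `|l q v| <= K * `|v|.
Proof.
move=> cB cl.
have /choice[K HK] : forall v, exists K, 0 <= K /\ forall q, B q -> `|l q v| <= K.
  by move=> v; have [K K0 HK] := compact_bound cB (cl v); exists K.
pose KK := \sum_i K (delta_mx 0 i, 0) + (\sum_j K (0, (delta_mx 0 j, 0)) + K (0, (0, 1))).
have K0 v : 0 <= K v by have [] := HK v.
exists KK; first by rewrite !addr_ge0 ?sumr_ge0.
move=> q [x [y z]] Bq; rewrite lin_coord /=.
have [h1 h2 h3] : [/\ `|x| <= `|(x, (y, z))|, `|y| <= `|(x, (y, z))| & `|z| <= `|(x, (y, z))|].
  by have := lexx `|(x, (y, z))|; rewrite {1}pair_norm_le [X in _ && X]pair_norm_le => /and3P[].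
set N := `|(x, (y, z))| in h1 h2 h3 *.
have b c u w : `|c| <= N -> `|l q w| <= u -> `|c * l q w| <= u * N.
  by move=> cN lu; rewrite normrM mulrC ler_pM.
apply: le_trans (ler_normD _ _) _; rewrite 2!mulrDl; apply: lerD; last apply: le_trans (ler_normD _ _) _; last apply: lerD.
- apply: le_trans (ler_norm_sum _ _ _) _; rewrite mulr_suml; apply: ler_sum => i _.
  by apply: b; [exact: le_trans (rV_coord_le _ _) h1|have [_] := HK (delta_mx 0 i, 0); exact].
- apply: le_trans (ler_norm_sum _ _ _) _; rewrite mulr_suml; apply: ler_sum => i _.
  by apply: b; [exact: le_trans (rV_coord_le _ _) h2|have [_] := HK (0, (delta_mx 0 i, 0)); exact].
- by apply: b => //; have [_] := HK (0, (0, 1)); exact.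
Qed.

End compact_bounds.

(** Real induction: the supremum of the times up to which the estimate from 0 holds is attained, and
    the local estimate centred there pushes it further unless it is 1. Each local estimate has a
    fixed centre, so no uniform [d] is available. *)
Lemma lip_of_local (R : realType) (V : normedModType R) (g : R -> V) (K : R) : 0 <= K ->
  (forall s, 0 <= s <= 1 -> exists2 d, 0 < d & forall s', 0 <= s' <= 1 ->
     `|s' - s| < d -> `|g s' - g s| <= K * `|s' - s|) ->
  `|g 1 - g 0| <= K.
Proof.
move=> K0 H; pose S := [set s | 0 <= s <= 1 /\ `|g s - g 0| <= K * s].
have S0 : S 0 by split; rewrite ?lexx ?ler01 ?subrr ?normr0 ?mulr0.
have hS : has_sup S by split; [exists 0|exists 1 => s [/andP[]]].
have ubS := sup_upper_bound hS.
set t := sup S in ubS.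
have t0 : 0 <= t by exact: ubS.
have t1 : t <= 1 by apply: ge_sup; [exists 0|move=> s [/andP[]]].
have [d d0 dH] := H t (introT andP (conj t0 t1)).
have St : S t.
  split; first by rewrite t0.
  have [s Ss ts] := sup_adherent d0 hS; have st := ubS s Ss; have [s01 gs] := Ss.
  have := dH s s01; rewrite ler0_norm ?subr_le0// opprB ltrBlDr -ltrBlDl => /(_ _).
  rewrite -/t in ts; have ts' : t - s < d by lra.
  move=> h; have {}h : `|g s - g t| <= K * (t - s) by apply: h; lra.
  rewrite -(subrK (g s) (g t)) -addrA; apply: le_trans (ler_normD _ _) _; rewrite distrC; lra.
have [t1'|t1'] := ltP t 1; last by have -> : 1 = t :> R by [lra]; have [_] := St; have -> : t = 1 by [lra]; rewrite mulr1.
pose s := Num.min 1 (t + d / 2).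
have ts : t < s by rewrite lt_min t1'; lra.
have s1 : s <= 1 by rewrite ge_min lexx.
have sd : s <= t + d / 2 by rewrite ge_min lexx orbT.
have : S s.
  split; first by apply/andP; split => //; lra.
  have := dH s; rewrite gtr0_norm ?subr_gt0// => h.
  have {}h : `|g s - g t| <= K * (s - t) by apply: h; lra.
  have [_ gt] := St.
  rewrite -(subrK (g t) (g s)) -addrA; apply: le_trans (ler_normD _ _) _; lra.
by move=> /ubS; rewrite leNgt ts.
Qed.

(** [f'] need not be continuous, and differentiability is relative to the interval. The
    linearisation error is absorbed by replacing [K] with [K + e]. *)
Lemma mean_value (R : realType) (f f' : R -> R) (K : R) : 0 <= K ->
  (forall s, 0 <= s <= 1 -> `|f' s| <= K) ->
  (forall s, 0 <= s <= 1 -> forall e, 0 < e -> exists2 d, 0 < d & forall h, `|h| < d ->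
     0 <= s + h <= 1 -> `|f (s + h) - f s - h * f' s| <= e * `|h|) ->
  `|f 1 - f 0| <= K.
Proof.
move=> K0 f'K H; apply/ler_addgt0Pr => e e0.
apply: (@lip_of_local R R^o); first by rewrite addr_ge0// ltW.
move=> s s01; have [d d0 dH] := H s s01 e e0; exists d => // s' s'01 ss'.
have := dH (s' - s) ss'; rewrite addrC subrK => /(_ s'01) h.
rewrite [leLHS](_ : _ = `|(s' - s) * f' s + (f s' - f s - (s' - s) * f' s)|); last by congr (`|_|); ring.
apply: le_trans (ler_normD _ _) _; rewrite [leRHS]mulrDl; apply: lerD => //.
by rewrite normrM mulrC ler_wpM2r// f'K.
Qed.

Lemma compact_cball (R : realType) k (y : 'rV[R]_k) r : compact [set z : 'rV[R]_k | `|z - y| <= r].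
Proof.
apply: bounded_closed_compact.
  exists (`|y| + r); split; first exact: num_real.
  move=> M' MM' z /= zr; rewrite -(subrK y z); apply: le_trans (ler_normD _ _) _; lra.
move=> z /closure_distP H /=; apply/ler_addgt0Pr => e e0.
have [z' /= z1 zy] := H e e0; rewrite -(subrK z' z) -addrA; apply: le_trans (ler_normD _ _) _.
by rewrite [leRHS]addrC lerD// distrC ltW.
Qed.

Lemma compact_cball_pair (R : realType) k (q : 'rV[R]_k * R) r :
  compact [set p : 'rV[R]_k * R | `|p - q| <= r].
Proof.
have -> : [set p | `|p - q| <= r] = [set y | `|y - q.1| <= r] `*` `[q.2 - r, q.2 + r].
  apply/seteqP; split => -[y z] /=; rewrite pair_norm_le/= in_itv/=.
    by move=> /andP[-> h]; rewrite -ler_distl.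
  by move=> [-> h]; rewrite ler_distl.
by apply: compact_setX; [exact: compact_cball|exact: segment_compact].
Qed.

Lemma sqnorm_shift (R : realType) m (v : 'rV[R]_m) (h : R) j :
  \sum_i (v + h *: delta_mx 0 j) 0 i ^+ 2 = \sum_i v 0 i ^+ 2 + h * (2 * v 0 j + h).
Proof.
rewrite (bigD1 j)//= [in RHS](bigD1 j)//= !mxE !eqxx /=.
have -> : \sum_(i | i != j) (v + h *: delta_mx 0 j) 0 i ^+ 2 = \sum_(i | i != j) v 0 i ^+ 2.
  by apply: eq_bigr => i ij; rewrite !mxE (negPf ij) andbF mulr0 addr0.
ring.
Qed.

(* Maximise [f z - kappa * |z - y|^2]: the penalty keeps the maximiser inside
   the ball. *)
Lemma small_slope (R : realType) m (f : 'rV[R]_m -> R) y r M : 0 < r -> 0 <= M ->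
  (forall z, `|z - y| <= r -> differentiable f z) ->
  (forall z, `|z - y| <= r -> f z <= M) -> - M <= f y ->
  exists z, [/\ `|z - y| <= r, `|f z| <= M & `|grad f z| <= 2 * (2 * M + 1) / r + 2].
Proof.
move=> r0 M0 df fM fy.
(* With this [kappa] the penalty on the sphere [|z - y| = r] is at least [2 * M + 1], so [phi] is
   below [- M <= phi y] there. [S] uses squares of coordinates because the sup norm is not
   smooth. *)
pose kappa := (2 * M + 1) / r ^+ 2; have k0 : 0 < kappa by rewrite divr_gt0 ?exprn_gt0//; lra.
pose S (z : 'rV[R]_m) := \sum_i (z - y) 0 i ^+ 2.
have S_ge (z : 'rV[R]_m) : `|z - y| ^+ 2 <= S z.
  by have := sqnorm_ge (z - y, 0); rewrite pair_norml /sqnorm /= expr0n addr0.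
pose phi z := f z - kappa * S z; pose B := [set z : 'rV[R]_m | `|z - y| <= r].
have By : B y by rewrite /B /= subrr normr0 ltW.
have cB : compact B by exact: compact_cball.
have cphi : {within B, continuous phi}.
  apply/within_continuousP => z Bz e e0; have e2 : 0 < e / 2 by rewrite divr_gt0.
  have /continuous_distP/(_ _ e2)[d d0 dH] := differentiable_continuous (df z Bz).
  have [d' d'0 d'H] := sqnorm_cts (z - y, 0) (divr_gt0 e2 k0).
  exists (Num.min d d'); first by rewrite lt_min d0.
  move=> z' _; rewrite lt_min => /andP[/dH h1 zz'].
  have := d'H (z' - y, 0); rewrite pairB subrr pair_norml opprB addrA subrK => /(_ zz').
  rewrite /sqnorm /= expr0n !addr0 -/(S z) -/(S z') ltr_pdivlMr// mulrC => h2.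
  rewrite /phi opprD addrACA -opprD -mulrBr.
  by apply: le_lt_trans (ler_normB _ _) _; rewrite normrM (gtr0_norm k0); lra.
have [z] := compact_EVT_max (ex_intro _ y By) cB cphi.
rewrite inE => Bz zmax.
have phiy : - M <= phi z.
  have := zmax y; rewrite inE => /(_ By); apply: le_trans.
  by rewrite /phi /S big1 ?mulr0 ?subr0// => i _; rewrite subrr mxE expr0n.
have S0 : 0 <= S z by apply: sumr_ge0 => i _; exact: sqr_ge0.
have zr : `|z - y| < r.
  rewrite lt_neqAle Bz andbT; apply/eqP => zr.
  have : kappa * r ^+ 2 <= kappa * S z by rewrite ler_wpM2l ?(ltW k0)// -zr.
  have := fM z Bz; rewrite /kappa divfK ?expf_neq0 ?gt_eqF//.
  by move: phiy; rewrite /phi /kappa; lra.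
exists z; split=> //.
  rewrite ler_norml fM// andbT; apply: le_trans phiy _; rewrite /phi gerBl mulr_ge0// ltW//.
have [d d0 dH] := differentiable_gradP (df z Bz) ltr01.
(* [2 * kappa * r] bounds the slope of the penalty. The additional 2 is one unit for the
   linearisation error and one for its quadratic term, through [kappa * h <= 1]. *)
have E : 2 * (2 * M + 1) / r = 2 * kappa * r.
  by rewrite /kappa; field; rewrite gt_eqF.
apply/rV_norm_le => [|i]; first by rewrite E addr_ge0// mulr_ge0 ?(ltW r0)// mulr_ge0 ?(ltW k0).
pose h := Num.min (d / 2) (Num.min ((r - `|z - y|) / 2) (kappa^-1)).
have h0 : 0 < h by rewrite !lt_min !divr_gt0 ?subr_gt0//= invr_gt0.
have hd : h < d by rewrite gt_min; apply/orP; left; lra.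
have hr : h < r - `|z - y| by rewrite !gt_min; apply/orP; right; apply/orP; left; lra.
have hk : kappa * h <= 1.
  by rewrite mulrC -ler_pdivlMr// div1r !ge_min lexx !orbT.
have vi : `|(z - y) 0 i| <= r by exact: le_trans (rV_coord_le _ _) Bz.
have key s : `|s| = h -> s * grad f z 0 i <= h * (2 * kappa * r + 2).
  move=> sh; set v := s *: (delta_mx 0 i : 'rV[R]_m).
  have vh : `|v| = h by rewrite /v norm_delta.
  have := dH v; rewrite vh mul1r => /(_ hd); rewrite dotvZ dotv_delta.
  have Bzv : B (z + v).
    by rewrite /B /= addrAC; apply: le_trans (ler_normD _ _) _; rewrite vh; lra.
  have := zmax (z + v); rewrite inE => /(_ Bzv).
  rewrite /phi /S [z + v - y]addrAC sqnorm_shift => h1 h2.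
  have h3 : kappa * (s * (2 * (z - y) 0 i + s)) <= kappa * (h * (2 * r + h)).
    rewrite ler_wpM2l ?(ltW k0)//; apply: le_trans (ler_norm _) _; rewrite normrM sh.
    rewrite ler_wpM2l ?(ltW h0)//; apply: le_trans (ler_normD _ _) _.
    by rewrite sh normrM ger0_norm// lerD2r ler_wpM2l.
  have h4 : h * (kappa * h) <= h * 1 by rewrite ler_wpM2l ?(ltW h0).
  move: h2; rewrite ler_norml => /andP[h2 _].
  by move: h1 h2 h3; set c := (z - y) 0 i; set g := grad f z 0 i; set T := \sum_i _; lra.
have := key h; have := key (- h); rewrite normrN gtr0_norm// => /(_ erefl) k1 /(_ erefl) k2.
rewrite E -(ler_pM2l h0) -[X in X * `|_|](gtr0_norm h0) -normrM ler_norml k2 andbT.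
by rewrite lerNl -mulNr.
Qed.

Lemma addr_double_sub (V : zmodType) (a b c : V) : (b - c) + ((a - b) - (- a - c)) = a *+ 2.
Proof.
rewrite opprD !opprK [a + c]addrC [(a - b) + _]addrC addrA subrKA [b + a]addrC addrACA.
by rewrite subrr addr0 mulr2n.
Qed.

Lemma integral_le_ae d (T : measurableType d) (R : realType)
    (mu : {measure set T -> \bar R}) (N D D' : set T) (f g : T -> \bar R) :
  measurable N -> mu N = 0%E -> (forall x, ~ N x -> D x <-> D' x) ->
  (forall x, D x -> ~ N x -> (f x <= g x)%E) ->
  (\int[mu]_(x in D) f x <= \int[mu]_(x in D') g x)%E.
Proof.
move=> mN N0 DD fg; apply: (integral_le_off_null mN N0) => x nN; rewrite !patchE.
have [Dx|nDx] := pselect (D x); first by rewrite !mem_set//; [exact: fg|exact/DD].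
by rewrite !memNset// => /(DD _ nN).
Qed.

Lemma le_integral_comb3 d (T : measurableType d) (R : realType)
    (mu : {measure set T -> \bar R}) (D : set T) (f g h : T -> R) (a b c : R) (x y z : \bar R) :
  measurable D -> measurable_fun D f -> measurable_fun D g -> measurable_fun D h ->
  0 <= a -> 0 <= b -> 0 <= c ->
  (x <= \int[mu]_(x in D) (f x)%:E)%E -> (y <= \int[mu]_(x in D) (g x)%:E)%E ->
  (z <= \int[mu]_(x in D) (h x)%:E)%E ->
  (a%:E * x + b%:E * y + c%:E * z <= \int[mu]_(x in D) (a * f x + b * g x + c * h x)%:E)%E.
Proof.
move=> mD mf mg mh a0 b0 c0 xf yg zh.
have ms (k : R) (u : T -> R) : measurable_fun D u -> measurable_fun D (fun x => k * u x).
  by move=> mu'; apply: measurable_funM => //; exact: measurable_cst.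
have term (k : R) (u : T -> R) v : measurable_fun D u -> 0 <= k -> (v <= \int[mu]_(x in D) (u x)%:E)%E ->
    (k%:E * v <= \int[mu]_(x in D) (k * u x)%:E)%E.
  move=> mu' k0 vu; apply: le_trans (le_integralZl mu mD mu' k0).
  by apply: lee_wpmul2l; rewrite ?lee_fin.
have mfg := measurable_funD (ms a f mf) (ms b g mg).
apply: le_trans (le_integralD mu mD mfg (ms c h mh)).
apply: leeD; last exact: term.
apply: le_trans (le_integralD mu mD (ms a f mf) (ms b g mg)).
by apply: leeD; exact: term.
Qed.

Lemma EFin_comb3_le (R : realType) (a b c x y z : R) (x' y' z' : \bar R) :
  0 <= a -> 0 <= b -> 0 <= c -> (x%:E <= x')%E -> (y%:E <= y')%E -> (z%:E <= z')%E ->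
  ((a * x + b * y + c * z)%:E <= a%:E * x' + b%:E * y' + c%:E * z')%E.
Proof.
move=> a0 b0 c0 xx yy zz; rewrite !EFinD !EFinM.
by apply: leeD; [apply: leeD|]; apply: lee_wpmul2l; rewrite ?lee_fin.
Qed.

Section constant_bounds.
Variables (d : measure_display) (T : measurableType d) (R : realType).
Variables (mu : {measure set T -> \bar R}) (B D : set T) (f : T -> \bar R) (a : R).
Hypotheses (mB : measurable B) (muB : mu B = 1%E) (muB0 : mu (~` B) = 0%E) (BD : B `<=` D).

Let integral_cstB : (\int[mu]_(x in B) a%:E = a%:E)%E.
Proof. by rewrite integral_cst// muB mule1. Qed.

(** [mu] is concentrated on the measurable set [B], so [f] and [D] may be non-measurable. *)
Lemma integral_ge_cst : (forall x, B x -> (a%:E <= f x)%E) -> (a%:E <= \int[mu]_(x in D) f x)%E.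
Proof.
move=> H; rewrite -[leLHS]integral_cstB; apply: (integral_le_ae (measurableC mB) muB0).
  by move=> x /contrapT Bx; split=> // _; exact: BD.
by move=> x Bx _; exact: H.
Qed.

Lemma integral_le_cst : (forall x, B x -> (f x <= a%:E)%E) -> (\int[mu]_(x in D) f x <= a%:E)%E.
Proof.
move=> H; rewrite -[leRHS]integral_cstB; apply: (integral_le_ae (measurableC mB) muB0).
  by move=> x /contrapT Bx; split=> // _; exact: BD.
by move=> x _ /contrapT/H.
Qed.

End constant_bounds.

Lemma subr_subACA (V : zmodType) (a b c d : V) : a - b - (c - d) = (a - c) - (b - d).
Proof. by rewrite !opprB addrACA [RHS]addrACA; congr (_ + _); rewrite addrC. Qed.

(** * The G-convex setting *)

Section setting.
Variables (R : realType) (m n : nat).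
Local Notation E := ('rV[R]_m * ('rV[R]_n * R))%type.
Variables (X : set 'rV[R]_m) (Y : set 'rV[R]_n) (zlo : R) (zhi : \bar R).
Variable G : E -> R.
Local Notation A := (closure (XYZ X Y zlo zhi)).
Local Notation P := (clYZ Y zlo zhi).

(** [d2 v p] is the derivative at [p] of [q |-> df q v], chosen separately for each [v]: it is
    linear in its last argument, but nothing is asserted about its dependence on [v]. *)
Lemma Ck2P : Ck 2 A G -> {within A, continuous G} /\
  exists (df : E -> {linear E -> R^o}) (d2 : E -> E -> {linear E -> R^o}),
  [/\ forall v, {within A, continuous (fun p => df p v)},
      forall v w, {within A, continuous (fun p => d2 v p w)},
      forall p, A p -> forall e, 0 < e -> exists2 d, 0 < d &
        forall q, A q -> `|q - p| < d -> `|G q - G p - df p (q - p)| <= e * `|q - p| &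
      forall v p, A p -> forall e, 0 < e -> exists2 d, 0 < d &
        forall q, A q -> `|q - p| < d -> `|df q v - df p v - d2 v p (q - p)| <= e * `|q - p|].
Proof.
move=> [cG [df [Hdf Cdf]]]; split=> //; exists df.
have /choice[d2 Hd2] : forall v, exists ddf : E -> {linear E -> R^o},
    (forall p, A p -> forall e, 0 < e -> exists2 d, 0 < d &
        forall q, A q -> `|q - p| < d -> `|df q v - df p v - ddf p (q - p)| <= e * `|q - p|) /\
    forall w, {within A, continuous (fun p => ddf p w)}.
  move=> v; have [_ [ddf [H1 H2]]] := Cdf v; exists ddf; split=> [p Ap e e0|w].
    by have /within_distP := H1 p Ap e e0.
  by have [] := H2 w.
exists d2; split=> [v|v w|p Ap e e0|v].
- by have [] := Cdf v.
- by have [_] := Hd2 v.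
- by have /within_distP := Hdf p Ap e e0.
- by have [] := Hd2 v.
Qed.

Lemma open_Zset : open (Zset zlo zhi).
Proof.
rewrite openE => z [z1 z2]; apply: (iffRL (nbhs_distP z _)).
case: zhi z2 => [r| |] //= z2.
  rewrite lte_fin in z2; exists (Num.min (z - zlo) (r - z)); first by rewrite lt_min !subr_gt0 z1.
  by move=> y; rewrite lt_min !ltr_norml /Zset /= lte_fin; lra.
exists (z - zlo); first by rewrite subr_gt0.
by move=> y; rewrite ltr_norml /Zset /= ltey; split=> //; lra.
Qed.

Lemma openX (U V : topologicalType) (B : set U) (C : set V) :
  open B -> open C -> open (B `*` C).
Proof.
move=> oB oC; rewrite openE => -[x y] [Bx Cy]; exists (B, C) => //=.
by split; exact: open_nbhs_nbhs.
Qed.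

Lemma open_XYZ : open X -> open Y -> open (XYZ X Y zlo zhi).
Proof. by move=> oX oY; apply: openX => //; apply: openX => //; exact: open_Zset. Qed.

Lemma clXYZE : A = closure X `*` P.
Proof. exact: closureX. Qed.

Lemma clYZE : P = closure Y `*` closure (Zset zlo zhi).
Proof. exact: closureX. Qed.

Lemma A_XP x p : X x -> P p -> A (x, p).
Proof. by move=> Xx Pp; rewrite clXYZE; split=> //; exact: subset_closure. Qed.

Hypotheses (oX : open X) (oY : open Y).
Hypothesis cG : {within A, continuous G}.
Variables (df : E -> {linear E -> R^o}) (d2 : E -> E -> {linear E -> R^o}).
Hypothesis cdf : forall v, {within A, continuous (fun p => df p v)}.
Hypothesis cd2 : forall v w, {within A, continuous (fun p => d2 v p w)}.
Hypothesis dfP : forall p, A p -> forall e, 0 < e -> exists2 d, 0 < d &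
  forall q, A q -> `|q - p| < d -> `|G q - G p - df p (q - p)| <= e * `|q - p|.
Hypothesis d2P : forall v p, A p -> forall e, 0 < e -> exists2 d, 0 < d &
  forall q, A q -> `|q - p| < d -> `|df q v - df p v - d2 v p (q - p)| <= e * `|q - p|.

Definition ex (i : 'I_m) : E := (delta_mx 0 i, 0).

(** [GxG] written with relative derivatives, which exist and are continuous on the whole closure,
    also over the boundary of [X]. *)
Definition FG (q : E) : 'rV[R]_m * R := (\row_i df q (ex i), G q).

(** The derivative of [FG] in (y, z). Up to the sign of the first m rows, coming from [x_0 = -1], it
    is the map given by the matrix of (G6). *)
Definition AG (q : E) (w : 'rV[R]_n * R) : 'rV[R]_m * R :=
  (\row_i d2 (ex i) q (0, w), df q (0, w)).

Lemma lin_x (L : {linear E -> R^o}) (v : 'rV[R]_m) : L (v, 0) = dotv (\row_i L (ex i)) v.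
Proof.
have -> : (v, 0) = \sum_i v 0 i *: ex i.
  rewrite [v in LHS]row_sum_delta; apply: (big_rec2 (fun a b => (a, 0) = b)) => // i a b _ <-.
  by apply: f_equal2 => //=; rewrite scaler0 addr0.
rewrite linear_sum /dotv; apply: eq_bigr => i _.
by rewrite linearZ mxE mulrC.
Qed.

Lemma FGE x p : X x -> P p ->
  differentiable (fun x' => G (x', p)) x /\ GxG G x p = FG (x, p).
Proof.
move=> Xx Pp.
have [] := @differentiable_grad _ _ (fun x' => G (x', p)) x (\row_i df (x, p) (ex i)).
  move=> e e0; have [d d0 dH] := dfP (A_XP Xx Pp) e0.
  have /nbhs_distP[d' d'0 d'H] : nbhs x X by exact: open_nbhs_nbhs.
  exists (Num.min d d'); first by rewrite lt_min d0.
  move=> v; rewrite lt_min => /andP[vd vd'].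
  have Xv : X (x + v) by apply: d'H; rewrite addrKl.
  have := dH (x + v, p) (A_XP Xv Pp); rewrite pairB addrKl subrr pair_norml -lin_x.
  exact.
by move=> dG gG; split=> //; rewrite /GxG gG.
Qed.

Lemma within_row_pair (V : normedModType R) (B : set V) (f : 'I_m -> V -> R) (g : V -> R) :
  (forall i, {within B, continuous (f i)}) -> {within B, continuous g} ->
  {within B, continuous (fun q => (\row_i f i q, g q))}.
Proof.
move=> cf cg; apply/within_continuousP => q Bq e e0.
have /choice[d Hd] : forall i, exists d, 0 < d /\ forall q', B q' -> `|q' - q| < d -> `|f i q' - f i q| < e.
  by move=> i; have /within_continuousP/(_ q Bq e e0)[d d0 dH] := cf i; exists d.
have /within_continuousP/(_ q Bq e e0)[d' d'0 d'H] := cg.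
exists (Num.min d' (\big[Num.min/1]_i d i)).
  by rewrite lt_min d'0; apply: lt_bigmin => // i _; have [] := Hd i.
move=> q' Bq'; rewrite lt_min => /andP[qd qf]; rewrite pairB pair_norm_lt d'H// andbT.
apply/rV_norm_lt => // i; rewrite !mxE; have [_] := Hd i; apply=> //.
by apply: lt_le_trans qf _; rewrite (bigD1 i)//= ge_min lexx.
Qed.

Lemma FG_cts : {within A, continuous FG}.
Proof. by apply: within_row_pair => // i; exact: cdf. Qed.

Lemma FG_diff x p : A (x, p) -> forall e, 0 < e -> exists2 d, 0 < d &
  forall p', A (x, p') -> `|p' - p| < d ->
    `|FG (x, p') - FG (x, p) - AG (x, p) (p' - p)| <= e * `|p' - p|.
Proof.
move=> Axp e e0.
have /choice[f Hf] : forall i, exists d, 0 < d /\ forall q', A q' -> `|q' - (x, p)| < d ->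
    `|df q' (ex i) - df (x, p) (ex i) - d2 (ex i) (x, p) (q' - (x, p))| <= e * `|q' - (x, p)|.
  by move=> i; have [d d0 dH] := d2P (ex i) Axp e0; exists d.
have [d d0 dH] := dfP Axp e0.
exists (Num.min d (\big[Num.min/1]_i f i)).
  by rewrite lt_min d0; apply: lt_bigmin => // i _; have [] := Hf i.
move=> p' Ap'; rewrite lt_min => /andP[pd pf].
have E : (x, p') - (x, p) = (0, p' - p) by rewrite pairB subrr.
rewrite !pairB pair_norm_le /=; apply/andP; split.
  apply/rV_norm_le => [|i]; first by rewrite mulr_ge0// ltW.
  rewrite !mxE; have [_ /(_ _ Ap')] := Hf i; rewrite E pair_normr; apply.
  by apply: lt_le_trans pf _; rewrite (bigD1 i)//= ge_min lexx.
by have := dH _ Ap'; rewrite E pair_normr; exact.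
Qed.

(** * The full-rank condition and bounds on the derivative *)

Variable X0 : set R.
Hypotheses (oX0 : open X0) (X0N1 : X0 (-1)).
Local Notation Om := ((X `*` X0) `*` (Y `*` Zset zlo zhi)).

(** [bx] and [bxy] are the derivatives of [Gbar] in an x-direction and then in a (y, z)-direction.
    Unlike ordinary directional derivatives, these formulas also make sense on the boundary. *)
Let bx (i : 'I_(m + 1)) (q : ('rV[R]_m * R) * ('rV[R]_n * R)) : R :=
  match fintype.split i with
  | inl j => q.1.2 * df (q.1.1, q.2) (ex j)
  | inr _ => G (q.1.1, q.2)
  end.

Let bxy (i : 'I_(m + 1)) (w : 'rV[R]_n * R) (q : ('rV[R]_m * R) * ('rV[R]_n * R)) : R :=
  match fintype.split i with
  | inl j => q.1.2 * d2 (ex j) (q.1.1, q.2) (0, w)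
  | inr _ => df (q.1.1, q.2) (0, w)
  end.

Lemma open_Om : open Om.
Proof.
by apply: openX; apply: openX => //; exact: open_Zset.
Qed.

Lemma Om_XYZ q : Om q -> XYZ X Y zlo zhi (q.1.1, q.2).
Proof. by move=> [[? ?] ?]. Qed.

Lemma line_diff (f : E -> R) (L : {linear E -> R^o}) p v :
  (forall e, 0 < e -> exists2 d, 0 < d & forall q, A q -> `|q - p| < d ->
     `|f q - f p - L (q - p)| <= e * `|q - p|) ->
  forall e, 0 < e -> exists2 d, 0 < d & forall h, `|h| < d -> A (p + h *: v) ->
    `|f (p + h *: v) - f p - h * L v| <= e * `|h|.
Proof.
move=> H e e0; have v1 : 0 < `|v| + 1 by rewrite ltr_wpDl.
have [d d0 dH] := H (e / (`|v| + 1)) (divr_gt0 e0 v1).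
exists (d / (`|v| + 1)); first exact: divr_gt0.
move=> h; rewrite ltr_pdivlMr// => hd Ah.
have hv : `|p + h *: v - p| <= `|h| * (`|v| + 1).
  by rewrite addrKl normrZ ler_wpM2l// lerDl.
have := dH _ Ah (le_lt_trans hv hd); rewrite addrKl in hv; rewrite (addrKl p) linearZ => /le_trans; apply.
apply: le_trans (ler_wpM2l _ hv) _; first by rewrite ltW// divr_gt0.
by rewrite mulrCA [e / _ * _]mulrVK ?unitfE ?gt_eqF// mulrC.
Qed.

Lemma DGbarE i q : Om q -> 'D_(basis_pair i, 0) (Gbar G) q = bx i q.
Proof.
move=> Oq; apply: derive_distE => e e0; rewrite /bx /basis_pair.
have Aq := subset_closure (Om_XYZ Oq).
case: q Oq Aq => [[x s] p] Oq Aq; case: (fintype.split i) => [j|k] /=; last first.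
  exists 1 => // h _; rewrite !pairDZ !scaler0 !addr0 [h *: 1]mulr1 /Gbar /=.
  by rewrite mulrDl addrKl subrr normr0 mulr_ge0// ltW.
have s1 : 0 < `|s| + 1 by rewrite ltr_wpDl.
have [d d0 dH] := @line_diff G (df (x, p)) (x, p) (ex j) (dfP Aq) (e / (`|s| + 1)) (divr_gt0 e0 s1).
have [d' d'0 d'H] := near_line (ex j) (open_XYZ oX oY) (Om_XYZ Oq).
exists (Num.min d d'); first by rewrite lt_min d0.
move=> h; rewrite lt_min => /andP[hd /d'H /= /subset_closure hd'].
have := dH h hd hd'; rewrite !pairDZ !scaler0 !addr0 /Gbar /=.
move=> H; rewrite (_ : _ - _ - _ = s * (G (x + h *: delta_mx 0 j, p) - G (x, p) - h * df (x, p) (ex j))); last by ring.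
rewrite normrM; apply: le_trans (ler_wpM2l _ H) _ => //.
rewrite !mulrA ler_wpM2r// ler_pdivrMr// mulrC ler_wpM2l ?lerDl//.
exact: ltW.
Qed.

Lemma bx_diff i q w : Om q -> forall e, 0 < e -> exists2 d, 0 < d & forall h, `|h| < d ->
  `|bx i (q + h *: (0, w)) - bx i q - h * bxy i w q| <= e * `|h|.
Proof.
move=> Oq e e0; rewrite /bx /bxy; have Aq := subset_closure (Om_XYZ Oq).
have [d' d'0 d'H] := near_line (0, w) (open_XYZ oX oY) (Om_XYZ Oq).
case: q Oq Aq d'H => [[x s] p] Oq Aq d'H.
have E h : (x, s, p) + h *: (0, w) = (x, s, p + h *: w).
  by rewrite !pairDZ !scaler0 !addr0.
have E' h : (x, p) + h *: (0, w) = (x, p + h *: w).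
  by rewrite pairDZ scaler0 addr0.
case: (fintype.split i) => [j|k] /=; last first.
  have [d d0 dH] := @line_diff G (df (x, p)) (x, p) (0, w) (dfP Aq) e e0.
  exists (Num.min d d'); first by rewrite lt_min d0.
  move=> h; rewrite lt_min => /andP[hd /d'H /= /subset_closure hd'].
  by have := dH h hd hd'; rewrite E' scaler0 addr0.
have s1 : 0 < `|s| + 1 by rewrite ltr_wpDl.
have [d d0 dH] := @line_diff (fun q => df q (ex j)) (d2 (ex j) (x, p)) (x, p) (0, w) (d2P (ex j) Aq) (e / (`|s| + 1)) (divr_gt0 e0 s1).
exists (Num.min d d'); first by rewrite lt_min d0.
move=> h; rewrite lt_min => /andP[hd /d'H /= /subset_closure hd'].
have H := dH h hd hd'; rewrite E' in H; rewrite /= !(scaler0, addr0).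
rewrite (_ : _ - _ - _ = s * (df (x, p + h *: w) (ex j) - df (x, p) (ex j) - h * d2 (ex j) (x, p) (0, w))); last by ring.
rewrite normrM; apply: le_trans (ler_wpM2l _ H) _ => //.
rewrite !mulrA ler_wpM2r// ler_pdivrMr// mulrC ler_wpM2l ?lerDl//.
exact: ltW.
Qed.

Lemma D2GbarE i w q : Om q ->
  'D_(0, w) ('D_(basis_pair i, 0) (Gbar G)) q = bxy i w q.
Proof.
move=> Oq; apply: derive_distE => e e0.
have [d d0 dH] := bx_diff i w Oq e0.
have [d' d'0 d'H] := near_line (0, w) open_Om Oq.
exists (Num.min d d'); first by rewrite lt_min d0.
by move=> h; rewrite lt_min => /andP[hd /d'H hd']; rewrite !DGbarE//; exact: dH.
Qed.

Lemma cl_Om x p : A (x, p) -> closure Om ((x, -1), p).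
Proof.
rewrite clXYZE => -[Xx Pp]; rewrite closureX; split => //=.
by rewrite closureX; split => //; exact: subset_closure.
Qed.

(** The entry is a limit from the open domain, where the derivatives are [bxy]; since [bxy] is
    relatively continuous, the limit is its boundary value. *)
Lemma DxyGbarE x p (i : 'I_(m + 1)) (j : 'I_(n + 1)) : A (x, p) ->
  DxyGbar X Y zlo zhi G X0 ((x, -1), p) i j = bxy i (basis_pair j) ((x, -1), p).
Proof.
move=> Axp; rewrite mxE; apply: cl_value_distE; [exact: cl_Om|exact: D2GbarE|].
move=> e e0; set w := basis_pair j; rewrite /bxy; case: (fintype.split i) => [k|k] /=; last first.
  have /within_continuousP/(_ _ Axp e e0)[d d0 dH] := @cdf (0, w).
  exists d => // -[[x' s] p'] /Om_XYZ/subset_closure Aq; rewrite pairB pair_norm_lt [X in `|X|]pairB pair_norm_lt => /andP[/andP[h1 h2] h3].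
  by apply: dH => //; rewrite pairB pair_norm_lt h1.
set a := d2 (ex k) (x, p) (0, w).
have [d1 d10 dH1] : exists2 d1, 0 < d1 & forall s, `|s + 1| < d1 -> `|s - -1| * (`|a| + 1) < e / 2.
  have a1 : 0 < `|a| + 1 by rewrite ltr_wpDl.
  by exists (e / 2 / (`|a| + 1)); [rewrite !divr_gt0|move=> s; rewrite opprK ltr_pdivlMr].
have e4 : 0 < Num.min 1 (e / 4) by rewrite lt_min ltr01 divr_gt0.
have /within_continuousP/(_ _ Axp _ e4)[d d0 dH] := @cd2 (ex k) (0, w).
exists (Num.min (Num.min d d1) 1); first by rewrite !lt_min d0 d10 ltr01.
move=> [[x' s] p'] /Om_XYZ/subset_closure Aq; rewrite !lt_min.
have T d' : (`|(x', s, p') - (x, -1, p)| < d') = [&& `|x' - x| < d', `|s - -1| < d' & `|p' - p| < d'].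
  by rewrite pairB pair_norm_lt pairB pair_norm_lt andbA.
rewrite !T => /andP[/andP[/and3P[h1 h2 h3] /and3P[_ h4 _]] /and3P[_ h5 _]].
have := dH _ Aq; rewrite pairB pair_norm_lt h1 h3 => /(_ isT) /=.
rewrite lt_min => /andP[_]; rewrite -/a; set b := d2 _ _ _ => ba.
have := dH1 s; rewrite -{1}[1]opprK => /(_ h4) h6.
(* The varying factor [s] is separated from the varying derivative; [|s| <= 2] because [s] is within
   1 of -1. *)
have -> : s * b - -1 * a = (s - -1) * a + s * (b - a) by ring.
apply: le_lt_trans (ler_normD _ _) _; rewrite !normrM.
have s2 : `|s| <= 2.
  rewrite -[s](subrK (-1)); apply: le_trans (ler_normD _ _) _; rewrite normrN1; lra.
have : `|s - -1| * `|a| <= `|s - -1| * (`|a| + 1) by rewrite ler_wpM2l// lerDl.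
have : `|s| * `|b - a| <= 2 * `|b - a| by rewrite ler_wpM2r.
lra.
Qed.

Hypothesis rankG : forall x p, A (x, p) ->
  \rank (DxyGbar X Y zlo zhi G X0 ((x, -1), p)) = (n + 1)%N.

(** The rank equals the number of columns, so the transpose is row free. A vector annihilated by
    [AG] is annihilated by the matrix, whatever the sign of its rows. *)
Lemma AG_inj q w : A q -> AG q w = 0 -> w = 0.
Proof.
case: q => x p Aq H; set M := DxyGbar X Y zlo zhi G X0 ((x, -1), p).
pose W : 'rV[R]_(n + 1) := row_mx w.1 w.2%:M.
have wE : w = \sum_j W 0 j *: basis_pair j.
  rewrite big_split_ord /= big_ord1 /basis_pair.
  under eq_bigr do rewrite (unsplitK (inl _)) row_mxEl.
  rewrite (unsplitK (inr _)) row_mxEr mxE eqxx mulr1n.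
  have -> : \sum_(i < n) w.1 0 i *: (delta_mx 0 i, 0 : R) = (w.1, 0).
    rewrite [w.1 in RHS]row_sum_delta; apply: (big_rec2 (fun a b => b = (a, 0))) => // i a b _ ->.
    by rewrite pairZD [_ *: (0 : R)]mulr0 addr0.
  by case: w {H W} => w1 w2 /=; rewrite addrC pairZD scaler0 add0r [_ *: 1]mulr1 addr0.
have bxyL i : bxy i w ((x, -1), p) = \sum_j W 0 j * M i j.
  under eq_bigr do rewrite /M DxyGbarE//.
  have L (l : {linear E -> R^o}) : l (0, w) = \sum_j W 0 j * l (0, basis_pair j).
    have -> : (0, w) = \sum_j W 0 j *: (0 : 'rV[R]_m, basis_pair j).
      rewrite [w in LHS]wE; apply: (big_rec2 (fun a b => (0, a) = b)) => // j a b _ <-.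
      by apply: f_equal2 => //=; rewrite scaler0 addr0.
    by rewrite linear_sum; apply: eq_bigr => j _; rewrite linearZ.
  rewrite /bxy; case: (fintype.split i) => [k|k] /=; last exact: L.
  by rewrite L mulr_sumr; apply: eq_bigr => j _; rewrite mulrCA.
have W0 : W *m M^T = 0.
  apply/rowP => i; rewrite !mxE.
  transitivity (bxy i w (x, -1, p)); first by rewrite bxyL; apply: eq_bigr => j _; congr (_ * _); rewrite mxE.
  move: H => [/rowP H1 H2]; rewrite /bxy; case: (fintype.split i) => [k|k] /=; last exact: H2.
  by have := H1 k; rewrite !mxE => ->; rewrite mulr0.
have : row_free M^T by rewrite /row_free mxrank_tr rankG.
move=> /mulmx_free_eq0 F; move/eqP: W0; rewrite F => /eqP W0.
rewrite wE W0 big1// => j _; rewrite mxE scale0r//.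
Qed.

Lemma AGB q w w' : AG q (w - w') = AG q w - AG q w'.
Proof.
have E : (0, w - w') = (0, w) - (0, w') :> E by rewrite pairB subrr.
rewrite /AG E linearB [RHS]pairB; congr (_, _).
by apply/rowP => i; rewrite !mxE linearB.
Qed.

Lemma AGZ q a w : AG q (a *: w) = a *: AG q w.
Proof.
have E : (0, a *: w) = a *: (0, w) :> E by congr (_, _); rewrite /= scaler0.
rewrite /AG E linearZ; congr (_, _).
by apply/rowP => i; rewrite !mxE linearZ.
Qed.

Section compact.
Hypothesis cA : compact A.

Lemma AG_ub : exists2 K, 0 <= K & forall q w, A q -> `|AG q w| <= K * `|w|.
Proof.
have /choice[K HK] : forall i, exists K, 0 <= K /\ forall q v, A q -> `|d2 (ex i) q v| <= K * `|v|.
  by move=> i; have [K K0 HK] := lin_bounded cA (@cd2 (ex i)); exists K.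
have [K' K'0 HK'] := lin_bounded cA cdf.
have K0 i : 0 <= K i by have [] := HK i.
exists (\sum_i K i + K'); first by rewrite addr_ge0// sumr_ge0.
move=> q w Aq; rewrite pair_norm_le mulrDl; apply/andP; split; last first.
  apply: le_trans (HK' q (0, w) Aq) _; rewrite pair_normr lerDr mulr_ge0// sumr_ge0//.
apply/rV_norm_le => [|i]; first by rewrite addr_ge0// mulr_ge0// sumr_ge0.
rewrite !mxE; have [_ /(_ q (0, w) Aq)] := HK i; rewrite pair_normr => /le_trans; apply.
by rewrite (bigD1 i)//= mulrDl -!addrA lerDl !addr_ge0// mulr_ge0// sumr_ge0.
Qed.

Lemma compact_unit_sphere : compact [set w : 'rV[R]_n * R | `|w| = 1].
Proof.
apply: subclosed_compact (@compact_cball_pair R n 0 1) _ => [w /closure_distP H /=|w /= w1].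
  apply/eqP; rewrite eq_le; apply/andP; split; apply/ler_addgt0Pr => e e0;
    have [v /= v1 vw] := H e e0.
    rewrite -(subrK v w); apply: le_trans (ler_normD _ _) _.
    by rewrite distrC addrC v1 lerD2l ltW.
  rewrite -v1 -{1}(subrK w v); apply: le_trans (ler_normD _ _) _.
  by rewrite addrC lerD2l ltW.
by rewrite subr0 w1.
Qed.

(** The minimum of [|AG q w|] over [A] times the unit sphere is positive by injectivity; homogeneity
    does the rest. *)
Lemma AG_lb : exists2 c, 0 < c & forall q w, A q -> c * `|w| <= `|AG q w|.
Proof.
pose S := [set w : 'rV[R]_n * R | `|w| = 1].
pose f (qw : E * ('rV[R]_n * R)) := `|AG qw.1 qw.2|.
have unit w : w != 0 -> S (`|w|^-1 *: w).
  by move=> w0; rewrite /S /= normrZ normfV normr_id mulVf ?normr_eq0.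
have [[[q0 w0] Aqw]|AS0] := pselect (A `*` S !=set0); last first.
  exists 1 => // q w Aq; have [->|w0] := eqVneq w 0; first by rewrite normr0 mulr0.
  by exfalso; apply: AS0; exists (q, `|w|^-1 *: w); split => //; exact: unit.
have [K K0 HK] := AG_ub.
have cf : {within A `*` S, continuous f}.
  apply/within_continuousP => -[q w] [/= Aq Sw] e e0.
  have e2 : 0 < e / 2 by rewrite divr_gt0.
  have cw : {within A, continuous (fun q => AG q w)}.
    by apply: within_row_pair => [i|]; [exact: cd2|exact: cdf].
  have /within_continuousP/(_ q Aq _ e2)[d d0 dH] := cw.
  have K1 : 0 < K + 1 by rewrite ltr_wpDl.
  exists (Num.min d (e / 2 / (K + 1))); first by rewrite lt_min d0 divr_gt0.
  move=> [q' w'] [/= Aq' Sw']; rewrite pairB lt_min => /andP[]; rewrite pair_norm_lt => /andP[q'd _].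
  rewrite pair_norm_lt => /andP[_]; rewrite ltr_pdivlMr// => w'e.
  have h1 := dH q' Aq' q'd; have h2 := HK q' (w' - w) Aq'.
  apply: le_lt_trans (ler_dist_dist _ _) _.
  (* [AG] is known to be continuous in [q] only for fixed [w]; the change of [w] is handled by the
     bound [K], uniform in [q]. *)
  have -> : AG q' w' - AG q w = AG q' (w' - w) + (AG q' w - AG q w).
    by rewrite AGB addrA subrK.
  apply: le_lt_trans (ler_normD _ _) _.
  have := normr_ge0 (w' - w); lra.
have [|[q1 w1]] := compact_EVT_min (ex_intro _ (q0, w0) Aqw) _ cf.
  by apply: compact_setX => //; exact: compact_unit_sphere.
rewrite inE => -[/= Aq1 Sw1] H.
have f0 : 0 < f (q1, w1).
  rewrite /f normr_gt0; apply/eqP => /= /(AG_inj Aq1) w10.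
  by move: Sw1; rewrite /S /= w10 normr0 => /esym/eqP; rewrite oner_eq0.
exists (f (q1, w1)) => // q w Aq; have [->|w0'] := eqVneq w 0; first by rewrite normr0 mulr0.
have := H (q, `|w|^-1 *: w); rewrite inE => /(_ (conj Aq (unit w w0'))).
rewrite {2}/f /= AGZ normrZ normfV normr_id mulrC ler_pdivlMr ?normr_gt0//.
Qed.

End compact.

(** * G-segments and the inverse of (G_x, G) *)

Hypothesis HG1 : hypG1 X Y zlo zhi G.
Hypothesis HG2 : hypG2 X Y zlo zhi G.
Local Notation inv := (GxG_inv Y zlo zhi G).
Local Notation seg := (Gseg Y zlo zhi G).

Lemma GxG_inj x p p' : X x -> P p -> P p' -> GxG G x p = GxG G x p' -> p = p'.
Proof.
by move=> Xx Pp Pp' E; have [_ [g [gK _]]] := HG1 Xx; rewrite -(gK p)// E gK.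
Qed.

Lemma GxG_invK x p : X x -> P p -> inv x (GxG G x p) = p.
Proof. by move=> Xx Pp; apply: xget_unique => // p' [Pp'] /GxG_inj; exact. Qed.

Lemma conv_shift (V : lmodType R) (a c : V) t : a + t *: (c - a) = (1 - t) *: a + t *: c.
Proof. by rewrite scalerBr scalerBl scale1r addrA addrAC. Qed.

(** By (G2) the interpolated value lies in the range, so [xget] finds a preimage and does not return
    its default. *)
Lemma segP x p0 p1 t : X x -> P p0 -> P p1 -> 0 <= t <= 1 ->
  P (seg x p0 p1 t) /\
  GxG G x (seg x p0 p1 t) = GxG G x p0 + t *: (GxG G x p1 - GxG G x p0).
Proof.
move=> Xx Pp0 Pp1 /andP[t0 t1].
set q0 := GxG G x p0; set q1 := GxG G x p1.
have E : q0 + t *: (q1 - q0) = ((1 - t) *: q0.1 + t *: q1.1, (1 - t) * q0.2 + t * q1.2).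
  by rewrite conv_shift; case: (q0) (q1) => [a b] [c d].
rewrite E; apply: (@xgetPex _ 0 [set p | P p /\ GxG G x p = _]).
(* The weight [t] goes to the first point, hence [q1] before [q0]. *)
have := @HG2 x Xx q1 q0 (Itv01 t0 t1); rewrite !inE.
case; [by exists p1|by exists p0|move=> p Pp Ep].
by exists p; split=> //; rewrite Ep -E conv_shift addrC.
Qed.

Lemma seg_cts x p0 p1 s e : X x -> P p0 -> P p1 -> 0 <= s <= 1 -> 0 < e ->
  exists2 d, 0 < d & forall s', 0 <= s' <= 1 -> `|s' - s| < d ->
    `|seg x p0 p1 s' - seg x p0 p1 s| < e.
Proof.
move=> Xx Pp0 Pp1 s01 e0; have [_ [g [gK /within_continuousP cg]]] := HG1 Xx.
have [Ps Es] := segP Xx Pp0 Pp1 s01.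
have [d d0 dH] := cg (GxG G x (seg x p0 p1 s)) (imageP _ Ps) e e0.
set N := `|GxG G x p1 - GxG G x p0|.
have N1 : 0 < N + 1 by rewrite ltr_wpDl// normr_ge0.
exists (d / (N + 1)); first exact: divr_gt0.
move=> s' s'01; rewrite ltr_pdivlMr// => ss'.
have [Ps' Es'] := segP Xx Pp0 Pp1 s'01.
rewrite -(gK _ Ps) -(gK _ Ps'); apply: dH; first exact: imageP.
rewrite Es Es' opprD addrACA subrr add0r -scalerBl normrZ.
by apply: le_lt_trans ss'; rewrite ler_wpM2l// lerDl.
Qed.

(** [GxG] moves along the segment with constant speed [N]. Half of the constant [c] of [AG_lb] is
    spent on the linearisation error, so the segment itself locally moves with speed at most
    [N / (c / 2)]. *)
Lemma compact_lower_bound : compact A -> exists2 c, 0 < c &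
  forall x p p', X x -> P p -> P p' -> c * `|p - p'| <= `|GxG G x p - GxG G x p'|.
Proof.
move=> cA; have [c c0 Hc] := AG_lb cA; exists (c / 2); first by rewrite divr_gt0.
move=> x p1 p0 Xx Pp1 Pp0; set N := `|_ - _ : 'rV[R]_m * R|.
have N0 : 0 <= N by exact: normr_ge0.
rewrite mulrC -ler_pdivlMr ?divr_gt0//.
pose g s := seg x p0 p1 s.
have g0 : g 0 = p0.
  have [Ps] := segP Xx Pp0 Pp1 (introT andP (conj (lexx 0) ler01)).
  by rewrite scale0r addr0 => /(GxG_inj Xx Ps Pp0).
have g1 : g 1 = p1.
  have [Ps] := segP Xx Pp0 Pp1 (introT andP (conj ler01 (lexx 1))).
  by rewrite scale1r addrC subrK => /(GxG_inj Xx Ps Pp1).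
rewrite -g1 -[X in _ - X]g0; apply: lip_of_local; first by rewrite divr_ge0// ltW// divr_gt0.
move=> s s01; have [Ps Es] := segP Xx Pp0 Pp1 s01; rewrite -/(g s) in Ps Es.
have [d d0 dH] := FG_diff (A_XP Xx Ps) (divr_gt0 c0 (ltr0Sn R 1)).
have [d' d'0 d'H] := seg_cts Xx Pp0 Pp1 s01 d0.
exists d' => // s' s'01 /(d'H _ s'01) gd; have [Ps' Es'] := segP Xx Pp0 Pp1 s'01.
rewrite -/(g s') in Ps' Es'.
have := dH _ (A_XP Xx Ps') gd; rewrite -/(g s) -/(g s').
have [_ <-] := FGE Xx Ps; have [_ <-] := FGE Xx Ps'.
have -> : GxG G x (g s') - GxG G x (g s) = (s' - s) *: (GxG G x p1 - GxG G x p0).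
  by rewrite Es Es' opprD addrACA subrr add0r -scalerBl.
have := Hc (x, g s) (g s' - g s) (A_XP Xx Ps) => h1 h2.
have : `|AG (x, g s) (g s' - g s)| <= `|s' - s| * N + c / 2 * `|g s' - g s|.
  have nz : `|(s' - s) *: (GxG G x p1 - GxG G x p0)| = `|s' - s| * N by rewrite normrZ.
  rewrite -nz -{1}[AG _ _](subrK ((s' - s) *: (GxG G x p1 - GxG G x p0))).
  by apply: le_trans (ler_normD _ _) _; rewrite addrC lerD2l distrC.
by move=> h3; rewrite [leRHS]mulrAC [N * _]mulrC ler_pdivlMr ?divr_gt0//; lra.
Qed.

Hypothesis compact_or_lip : compact A \/ uniformly_biLipschitz X Y zlo zhi G.

Lemma GxG_lower_bound : exists2 c, 0 < c &
  forall x p p', X x -> P p -> P p' -> c * `|p - p'| <= `|GxG G x p - GxG G x p'|.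
Proof.
case: compact_or_lip => [|[c [C [c0 C0 H]]]]; first exact: compact_lower_bound.
have m1 : 0 < m.+1%:R :> R by [].
exists (c / m.+1%:R); first by rewrite divr_gt0.
move=> x p p' Xx Pp Pp'; have /andP[h _] := H x Xx p p' Pp Pp'.
rewrite mulrAC ler_pdivrMr// mulrC [leRHS]mulrC.
apply: le_trans (enorm_le _); apply: le_trans h.
by rewrite mulrC ler_wpM2l ?enorm_ge// ltW.
Qed.

(** (G1) gives continuity of the inverse for each fixed x. The lower bound, uniform in x, upgrades
    it to joint continuity: [p] and [p0] are compared over the same [x]. *)
Lemma GxG_inv_cts x0 p0 : X x0 -> P p0 -> forall e, 0 < e -> exists2 d, 0 < d &
  forall x p, X x -> P p -> `|x - x0| < d -> `|GxG G x p - GxG G x0 p0| < d -> `|p - p0| < e.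
Proof.
move=> Xx0 Pp0 e e0; have [c c0 Hc] := GxG_lower_bound.
have ce : 0 < c * e / 2 by rewrite divr_gt0// mulr_gt0.
have /within_continuousP/(_ _ (A_XP Xx0 Pp0) _ ce)[d d0 dH] := FG_cts.
exists (Num.min d (c * e / 2)); first by rewrite lt_min d0.
move=> x p Xx Pp; rewrite !lt_min => /andP[xd _] /andP[_ qd].
have := dH (x, p0) (A_XP Xx Pp0); rewrite pairB subrr pair_norml => /(_ xd).
have [_ <-] := FGE Xx Pp0; have [_ <-] := FGE Xx0 Pp0 => h.
have := Hc x p p0 Xx Pp Pp0; rewrite -(ltr_pM2l c0) => /le_lt_trans; apply.
rewrite -(subrK (GxG G x0 p0) (GxG G x p)) -addrA; apply: le_lt_trans (ler_normD _ _) _.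
by rewrite [X in _ + X]distrC; lra.
Qed.

(** * Supports of G-convex functions *)

Definition touches (u : 'rV[R]_m -> R) y p :=
  [/\ P p, u y = G (y, p) & forall x, X x -> G (x, p) <= u x].

Lemma GconvexP u : Gconvex X Y zlo zhi G u -> {within X, continuous u} /\
  forall x, X x -> exists p, touches u x p.
Proof.
move=> [cu H]; split=> // x /H[y [z [Yy Zz ux uX]]].
by exists (y, z); split=> //; rewrite clYZE.
Qed.

Variable pnull : 'rV[R]_n * R.
Hypothesis Ppnull : P pnull.

Lemma cball_sub (x y : 'rV[R]_m) r z : ball x r y -> `|z - y| <= r -> `|z - x| <= 2 * r.
Proof.
move=> /ballE xy zy; rewrite -(subrK y z) -addrA; apply: le_trans (ler_normD _ _) _.
have -> : 2 * r = r + r by ring.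
by rewrite [X in _ + X]distrC lerD// ltW.
Qed.

(** [G(., p)] lies below [u] and meets it at [y], so [small_slope] provides a point [z] near [y]
    with [GxG G z p] bounded by [S]. The lower bound for [GxG] at [z] then bounds the distance from
    [p] to [pnull]. *)
Lemma touches_bounded u x : {within X, continuous u} -> X x ->
  exists r T, [/\ 0 < r, forall z, `|z - x| <= 2 * r -> X z &
    forall y p, ball x r y -> touches u y p -> `|p| <= T].
Proof.
move=> cu Xx; have /nbhs_distP[d d0 dX] : nbhs x X by exact: open_nbhs_nbhs.
pose r := d / 3; have r0 : 0 < r by rewrite divr_gt0.
pose B := [set z : 'rV[R]_m | `|z - x| <= 2 * r].
have BX : B `<=` X by move=> z Bz; apply: dX; apply: le_lt_trans Bz _; rewrite /r; lra.
have cB : compact B by exact: compact_cball.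
have [M M0 HM] := compact_bound cB (continuous_subspaceW BX cu).
have [K K0 HK] : exists2 K, 0 <= K & forall z, B z -> `| `|GxG G z pnull| | <= K.
  apply: (compact_bound cB); apply/within_continuousP => z Bz e e0.
  have /within_continuousP/(_ _ (A_XP (BX _ Bz) Ppnull) e e0)[d' d'0 d'H] := FG_cts.
  exists d' => // z' Bz' zz'; apply: le_lt_trans (ler_dist_dist _ _) _.
  have [_ ->] := FGE (BX _ Bz) Ppnull; have [_ ->] := FGE (BX _ Bz') Ppnull.
  by apply: d'H; [exact: A_XP (BX _ Bz') Ppnull|rewrite pairB subrr pair_norml].
have [c c0 Hc] := GxG_lower_bound.
pose S := 2 * (2 * M + 1) / r + 2 + M.
exists r, ((S + K) / c + `|pnull|); split=> // y p yr [Pp uy uX].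
have sub z : `|z - y| <= r -> B z by exact: cball_sub.
have By : B y by apply: sub; rewrite subrr normr0 ltW.
have [|||z [zr fz gz]] := @small_slope R m (fun z => G (z, p)) y r M r0 M0.
- by move=> z /sub/BX Xz; have [] := FGE Xz Pp.
- move=> z /sub Bz; apply: le_trans (uX z (BX _ Bz)) _; apply: le_trans (ler_norm _) _; exact: HM.
- by rewrite -uy; have := HM y By; rewrite ler_norml => /andP[].
have Bz := sub z zr; have Xz := BX z Bz.
have gS : `|GxG G z p| <= S.
  have t0 : 0 <= 2 * (2 * M + 1) / r + 2 by apply: le_trans gz.
  by rewrite pair_norm_le; apply/andP; split => /=; [apply: le_trans gz _|apply: le_trans fz _]; rewrite /S ?lerDl ?lerDr.
have := Hc z p pnull Xz Pp Ppnull; have := HK z Bz; rewrite normr_id => h1 h2.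
rewrite -(subrK pnull p); apply: le_trans (ler_normD _ _) _; rewrite lerD2r ler_pdivlMr// mulrC.
by apply: le_trans h2 _; apply: le_trans (ler_normB _ _) _; exact: lerD.
Qed.

Lemma mean_value_line (f : E -> R) (L : E -> {linear E -> R^o}) p v c K : 0 <= K ->
  (forall s, 0 <= s <= 1 -> A (p + s *: v)) ->
  (forall q, A q -> forall e, 0 < e -> exists2 d, 0 < d & forall q', A q' -> `|q' - q| < d ->
     `|f q' - f q - L q (q' - q)| <= e * `|q' - q|) ->
  (forall s, 0 <= s <= 1 -> `|L (p + s *: v) v - c| <= K) ->
  `|f (p + v) - f p - c| <= K.
Proof.
move=> K0 Av fL LK.
have := @mean_value R (fun s => f (p + s *: v) - s * c) (fun s => L (p + s *: v) v - c) K K0 LK.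
rewrite scale1r scale0r addr0 mul1r mul0r subr0 addrAC; apply=> s s01 e e0.
have [d d0 dH] := line_diff v (fL _ (Av s s01)) e0.
exists d => // h hd sh01; have := dH h hd; rewrite -addrA -scalerDl => /(_ (Av _ sh01)).
by congr (`|_| <= _); ring.
Qed.

(** [u] lies above [G(., p)], whose second derivatives in x are bounded on a compact set containing
    all touching points over the ball. Hence one constant serves for all of them. *)
Lemma Gconvex_semisupport u x : Gconvex X Y zlo zhi G u -> X x -> exists r C,
  [/\ 0 < r, 0 <= C, ball x r `<=` X &
    forall y p, ball x r y -> touches u y p -> semisupport u (ball x r) C y (GxG G y p).1].
Proof.
move=> /GconvexP[cu _] Xx; have [r [T [r0 rX HT]]] := touches_bounded cu Xx.
have B2 z : ball x r z -> `|z - x| <= 2 * r.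
  by move/ballE; rewrite distrC; lra.
pose B := [set z : 'rV[R]_m | `|z - x| <= 2 * r] `*` (P `&` [set p | `|p - 0| <= T]).
have BA : B `<=` A by move=> [z p] [/= Bz [Pp _]]; apply: A_XP => //; exact: rX.
have cB : compact B.
  apply: compact_setX; first exact: compact_cball.
  rewrite setIC; apply: compact_closedI; [exact: compact_cball_pair|exact: closed_closure].
have /choice[K HK] : forall i, exists K, 0 <= K /\ forall q v, B q -> `|d2 (ex i) q v| <= K * `|v|.
  move=> i; have [w|K K0 HK] := @lin_bounded R m n B (d2 (ex i)) cB.
    exact: continuous_subspaceW BA (@cd2 (ex i) w).
  by exists K.
pose KK := \sum_i K i.
have K0 i : 0 <= K i by have [] := HK i.
have KK0 : 0 <= KK by exact: sumr_ge0.
have KKi i : K i <= KK by rewrite /KK (bigD1 i)//= lerDl sumr_ge0.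
exists r, (m%:R * KK); split=> //; first by rewrite mulr_ge0.
  by move=> z /B2; exact: rX.
move=> y p yr tp y' y'r; have [Pp uy uX] := tp; have Tp := HT y p yr tp.
set v := y' - y.
have Xy : X y by apply: rX; exact: B2.
have Bs s : 0 <= s <= 1 -> B ((y, p) + s *: (v, 0)).
  move=> s01; rewrite pairDZ scaler0 addr0; split; last by split=> //=; rewrite subr0.
  apply: B2; apply/ballE; rewrite /v conv_shift.
  have -> : x - ((1 - s) *: y + s *: y') = (1 - s) *: (x - y) + s *: (x - y').
    by rewrite !scalerBr opprD addrACA -scalerDl subrK scale1r.
  apply: le_lt_trans (ler_normD _ _) _; rewrite !normrZ.
  move/ballE: yr => yr; move/ballE: y'r => y'r.
  have /andP[s0 s1] := s01; rewrite (ger0_norm s0) ger0_norm ?subr_ge0//.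
  have [->|sn0] := eqVneq s 0; first by rewrite subr0 mul1r mul0r addr0.
  have : s * `|x - y'| < s * r by rewrite ltr_pM2l// lt_neqAle eq_sym sn0.
  have : (1 - s) * `|x - y| <= (1 - s) * r by rewrite ler_wpM2l ?subr_ge0// ltW.
  by lra.
have v0 : 0 <= KK * `|v| ^+ 2 by rewrite mulr_ge0// sqr_ge0.
(* The outer mean value compares the increment of [G] with its derivative at [y]; an inner one,
   along [s *: (v, 0)], bounds the change of each partial derivative. The factor [m] comes from
   summing over coordinates. *)
have : `|G ((y, p) + (v, 0)) - G (y, p) - dotv (GxG G y p).1 v| <= m%:R * (KK * `|v| ^+ 2).
  apply: (@mean_value_line G df); [by rewrite mulr_ge0|by move=> s /Bs/BA|exact: dfP|].
  move=> s s01; rewrite lin_x; have [_ ->] := FGE Xy Pp; rewrite /FG /=.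
  rewrite /dotv -sumrB -sum_const_natr; apply: le_trans (ler_norm_sum _ _ _) _; apply: ler_sum => i _.
  rewrite -mulrBl normrM expr2 mulrA.
  apply: ler_pM => //; last exact: rV_coord_le.
  rewrite !mxE.
  have := @mean_value_line (fun q => df q (ex i)) (d2 (ex i)) (y, p) (s *: (v, 0)) 0 (KK * `|v|).
  rewrite subr0; apply.
  - by rewrite mulr_ge0.
  - move=> s' s'01; rewrite scalerA; apply: BA; apply: Bs.
    by have /andP[? ?] := s01; have /andP[? ?] := s'01; rewrite mulr_ge0//= mulr_ile1.
  - exact: d2P.
  - move=> s' s'01; rewrite subr0; have [_ HKi] := HK i.
    have : B ((y, p) + s' *: (s *: (v, 0))).
      rewrite scalerA; apply: Bs.
      by have /andP[? ?] := s01; have /andP[? ?] := s'01; rewrite mulr_ge0//= mulr_ile1.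
    move=> /HKi h; apply: le_trans (h _) _; apply: ler_pM => //.
    rewrite normrZ pair_norml; have /andP[? ?] := s01; rewrite ger0_norm//.
    by rewrite ler_piMl.
rewrite pairD addr0 [y + v]addrC [v + y]subrK ler_norml => /andP[h _].
have := uX y' (rX _ (B2 _ y'r)); rewrite uy; move: h; rewrite !mulrA; lra.
Qed.

(** * Concavity of pi measured by (G_x, G) *)

Variable pi : E -> R.
Hypothesis cpi : {within A, continuous pi}.

Lemma seg0 x p0 p1 : X x -> P p0 -> P p1 -> seg x p0 p1 0 = p0.
Proof.
move=> Xx Pp0 Pp1; have [Ps] := segP Xx Pp0 Pp1 (introT andP (conj (lexx 0) ler01)).
by rewrite scale0r addr0 => /(GxG_inj Xx Ps Pp0).
Qed.

Lemma seg1 x p0 p1 : X x -> P p0 -> P p1 -> seg x p0 p1 1 = p1.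
Proof.
move=> Xx Pp0 Pp1; have [Ps] := segP Xx Pp0 Pp1 (introT andP (conj ler01 (lexx 1))).
by rewrite scale1r addrC subrK => /(GxG_inj Xx Ps Pp1).
Qed.

(* The forward maps need not be Lipschitz when [Y] is not convex, but they are
   differentiable, so the modulus of concavity can be transported from
   [p1 - p0] to [GxG p1 - GxG p0] infinitesimally along the segment. *)
Lemma pi_concave_GxG : pi_uniformly_concave_along_Gsegments X Y zlo zhi G pi ->
  exists2 K, 0 < K & forall x p0 p1, X x -> P p0 -> P p1 -> forall t, 0 <= t <= 1 ->
    t * (1 - t) * K * sqnorm (GxG G x p1 - GxG G x p0) <=
    pi (x, seg x p0 p1 t) - (1 - t) * pi (x, p0) - t * pi (x, p1).
Proof.
move=> [lam lam0 H]; case: compact_or_lip => [cA|[c [C [c0 C0 HC]]]]; last first.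
  exists (lam / C ^+ 2); first by rewrite divr_gt0// exprn_gt0.
  move=> x p0 p1 Xx Pp0 Pp1 t t01; have /andP[t0 t1] := t01.
  apply: le_trans (H x p0 p1 Xx Pp0 Pp1 t t01).
  rewrite -!mulrA ler_wpM2l// ler_wpM2l ?subr_ge0// ler_wpM2l ?(ltW lam0)//.
  rewrite ler_pdivrMl ?exprn_gt0//.
  have /andP[_ h] := HC x Xx p1 p0 Pp1 Pp0.
  have {}h : enorm (GxG G x p1 - GxG G x p0) ^+ 2 <= (C * enorm (p1 - p0)) ^+ 2.
    by rewrite lerXn2r ?nnegrE ?mulr_ge0 ?sqrtr_ge0// ltW.
  by move: h; rewrite exprMn !sqr_sqrtr ?sqnorm_ge0.
have [c c0 Hc] := GxG_lower_bound; have [K0 K00 HK0] := AG_ub cA.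
pose C0 := K0 + 1; have C00 : 0 < C0 by rewrite /C0; lra.
have m1 : 0 < m.+1%:R :> R by [].
(* The 8 is the 4 of [concave_of_diff2] times the 2 in [K] below; [m.+1] compares [sqnorm] with the
   squared sup norm. *)
exists (lam / (8 * C0 ^+ 2 * m.+1%:R)).
  by rewrite divr_gt0// !mulr_gt0// exprn_gt0.
move=> x p0 p1 Xx Pp0 Pp1 t t01; have /andP[t0 t1] := t01.
set q := GxG G x p1 - GxG G x p0; set N := `|q|.
have N0 : 0 <= N by exact: normr_ge0.
have [Nz|Nz] := eqVneq N 0.
  have q0 : q = 0 by apply/eqP; rewrite -normr_eq0 -/N Nz.
  have -> : sqnorm q = 0.
    by apply/eqP; rewrite eq_le sqnorm_ge0 andbT; apply: le_trans (sqnorm_le q) _; rewrite -/N Nz expr0n mulr0.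
  rewrite mulr0; apply: le_trans (H x p0 p1 Xx Pp0 Pp1 t t01).
  by rewrite !mulr_ge0 ?sqnorm_ge0 ?subr_ge0// ltW.
have {Nz}N0' : 0 < N by rewrite lt_neqAle eq_sym Nz.
pose g s := seg x p0 p1 s; pose f s := pi (x, g s).
have gP s : 0 <= s <= 1 -> P (g s) /\ GxG G x (g s) = GxG G x p0 + s *: q.
  by move=> s01; exact: segP.
have cf : {within `[0, 1], continuous f}.
  apply/within_continuousP => s /=; rewrite in_itv /= => s01 e e0.
  have [Ps _] := gP s s01.
  have /within_continuousP/(_ _ (A_XP Xx Ps) e e0)[d d0 dH] := cpi.
  have [d' d'0 d'H] := seg_cts Xx Pp0 Pp1 s01 d0.
  exists d' => // s'; rewrite /= in_itv /= => s'01 /(d'H _ s'01) gd.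
  have [Ps' _] := gP s' s'01.
  by apply: dH; [exact: A_XP|rewrite pairB subrr pair_normr].
(* The hypothesis at [t = 1/2] on the piece from [s - h] to [s + h], doubled, has the factor
   [lam / 2]; the end points of the piece are at least [h * N / C0] apart. *)
pose K := lam / 2 * (N / C0) ^+ 2.
have Kpos : 0 < K by rewrite mulr_gt0 ?divr_gt0// exprn_gt0// divr_gt0.
have := concave_of_diff2 Kpos cf _ t01.
rewrite /f /g seg0// seg1// => C2; apply: le_trans (C2 _).
  have h1 : sqnorm q <= m.+1%:R * N ^+ 2 by exact: sqnorm_le.
  have tt : 0 <= t * (1 - t) by rewrite mulr_ge0// subr_ge0.
  rewrite [leRHS]mulrC -[leLHS]mulrA ler_wpM2l// /K.
  have -> : lam / 2 * (N / C0) ^+ 2 / 4 = lam / (8 * C0 ^+ 2 * m.+1%:R) * (m.+1%:R * N ^+ 2).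
    by field; rewrite ?gt_eqF// nat1r; apply/andP.
  by rewrite ler_wpM2l// divr_ge0 ?(ltW lam0)// !mulr_ge0// ?exprn_ge0// ltW.
move=> s /andP[s0 s1]; have s01 : 0 <= s <= 1 by rewrite !ltW.
have [Ps Es] := gP s s01.
have c2 : 0 < c / 2 by rewrite divr_gt0.
have [d d0 dH] := FG_diff (A_XP Xx Ps) c2.
have [d' d'0 d'H] := seg_cts Xx Pp0 Pp1 s01 d0.
exists d' => // h /andP[h0 hd] sm sp.
have sm01 : 0 <= s - h <= 1 by lra.
have sp01 : 0 <= s + h <= 1 by lra.
have [Pm Em] := gP _ sm01; have [Pp Ep] := gP _ sp01.
have B s' : 0 <= s' <= 1 -> `|s' - s| = h ->
    `|(s' - s) *: q - AG (x, g s) (g s' - g s)| <= h * N / 2.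
  move=> s'01 sh; have [Ps' Es'] := gP _ s'01.
  have := dH _ (A_XP Xx Ps') (d'H _ s'01 _); rewrite sh => /(_ hd).
  have [_ <-] := FGE Xx Ps; have [_ <-] := FGE Xx Ps'.
  have E : GxG G x (g s') - GxG G x (g s) = (s' - s) *: q.
    by rewrite Es Es' opprD addrACA subrr add0r -scalerBl.
  rewrite -/(g s) -/(g s') E => /le_trans; apply.
  have := Hc x _ _ Xx Ps' Ps; rewrite E normrZ sh -/N; lra.
have Bp := B _ sp01; rewrite addrKl gtr0_norm// in Bp; have {}Bp := Bp erefl.
have Bm := B _ sm01; rewrite addrKl normrN gtr0_norm// in Bm; have {}Bm := Bm erefl.
(* [2 h q] is [AG] of the full increment plus two linearisation errors of at most [h * N / 2] each.
   The choice [c / 2] was made so that they consume only half of [2 * h * N]. *)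
have hN : h * N <= C0 * `|g (s + h) - g (s - h)|.
  have E : (h *: q) *+ 2 = AG (x, g s) (g (s + h) - g (s - h)) +
     ((h *: q - AG (x, g s) (g (s + h) - g s)) - (- h *: q - AG (x, g s) (g (s - h) - g s))).
    have -> : AG (x, g s) (g (s + h) - g (s - h)) =
        AG (x, g s) (g (s + h) - g s) - AG (x, g s) (g (s - h) - g s).
      by rewrite -AGB opprB addrA subrK.
    by rewrite scaleNr addr_double_sub.
  have : `|(h *: q) *+ 2| = 2 * (h * N) by rewrite normrMn normrZ gtr0_norm// mulr_natl.
  have K01 := HK0 (x, g s) (g (s + h) - g (s - h)) (A_XP Xx Ps).
  have C01 : K0 * `|g (s + h) - g (s - h)| <= C0 * `|g (s + h) - g (s - h)|.
    by rewrite ler_wpM2r// /C0 lerDl.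
  have tri := ler_normD (AG (x, g s) (g (s + h) - g (s - h)))
     ((h *: q - AG (x, g s) (g (s + h) - g s)) - (- h *: q - AG (x, g s) (g (s - h) - g s))).
  have tri2 := ler_normB (h *: q - AG (x, g s) (g (s + h) - g s)) (- h *: q - AG (x, g s) (g (s - h) - g s)).
  rewrite -E in tri; lra.
have half01 : 0 <= (2^-1 : R) <= 1 by lra.
(* A piece of a G-segment is a G-segment, so its midpoint is [g s]. *)
have segs : seg x (g (s - h)) (g (s + h)) 2^-1 = g s.
  have [P1 E1] := segP Xx Pm Pp half01.
  apply: (GxG_inj Xx P1 Ps); rewrite E1 Es Em Ep opprD addrACA subrr add0r -scalerBl.
  rewrite scalerA -addrA -scalerDl; congr (_ + _ *: _); by field.
have := H x _ _ Xx Pm Pp _ half01; rewrite segs -/(f s) -/(f (s - h)) -/(f (s + h)) => Hs.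
have sq : (h * N / C0) ^+ 2 <= sqnorm (g (s + h) - g (s - h)).
  apply: le_trans (sqnorm_ge _); rewrite lerXn2r ?nnegrE ?divr_ge0 ?mulr_ge0 ?(ltW h0) ?(ltW C00)//.
  by rewrite ler_pdivrMr// [leRHS]mulrC.
have {}sq := ler_wpM2l (ltW lam0) sq.
have -> : K * h ^+ 2 = lam * (h * N / C0) ^+ 2 / 2 by rewrite /K; field; rewrite gt_eqF.
by lra.
Qed.

(** * From pi to Pi *)

Local Notation Gconv := (Gconvex X Y zlo zhi G).
Local Notation yb u x := (ybarG Y zlo zhi G x (u x) (grad u x)).

Definition kinks (u : 'rV[R]_m -> R) : set 'rV[R]_m := [set x | exists i, kink u X i x].

(** Off the kinks the slope of any support must be the gradient, so every touching point has the jet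
    of [u] as its image under [GxG]. *)
Lemma Gconvex_touches u x p : Gconv u -> X x -> ~ kinks u x -> touches u x p ->
  differentiable u x /\ GxG G x p = (grad u x, u x).
Proof.
move=> Gu Xx nk tp; have [r [C [r0 C0 rX H]]] := Gconvex_semisupport Gu Xx.
have [cu ex] := GconvexP Gu.
have [||du gu] := semiconvex_differentiable r0 C0 rX _ (H x p (ballxx x r0) tp).
- by move=> y yr; have [p' tp'] := ex y (rX y yr); exists (GxG G y p').1; exact: H.
- by move=> i ki; apply: nk; exists i.
by have [_ ux _] := tp; rewrite gu ux.
Qed.

Lemma Gconvex_diff u x : Gconv u -> X x -> ~ kinks u x ->
  [/\ differentiable u x, P (yb u x) & GxG G x (yb u x) = (grad u x, u x)].
Proof.
move=> Gu Xx nk; have [cu ex] := GconvexP Gu; have [p tp] := ex x Xx.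
have [du E] := Gconvex_touches Gu Xx nk tp; have [Pp _ _] := tp.
by rewrite /ybarG -E GxG_invK.
Qed.

Lemma Gconvex_jet_cts u x : Gconv u -> X x -> ~ kinks u x -> forall e, 0 < e ->
  exists2 d, 0 < d & forall y, X y -> ~ kinks u y -> `|y - x| < d ->
    `|(grad u y, u y) - (grad u x, u x)| < e.
Proof.
move=> Gu Xx nk e e0; have [r [C [r0 C0 rX H]]] := Gconvex_semisupport Gu Xx.
have [cu ex] := GconvexP Gu; have [du _ _] := Gconvex_diff Gu Xx nk.
have [d d0 dH] := semiconvex_grad_cts r0 C0 oX cu rX du e0.
have [d' d'0 d'H] := continuous_open_distP oX cu Xx e0.
exists (Num.min r (Num.min d d')); first by rewrite !lt_min r0 d0.
move=> y Xy nky; rewrite !lt_min => /and3P[yr yd /d'H[_ uy]].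
rewrite pairB pair_norm_lt uy andbT; apply: dH => //.
have [p tp] := ex y Xy; have [_ E] := Gconvex_touches Gu Xy nky tp.
by have -> : grad u y = (GxG G y p).1 by [rewrite E]; apply: H => //; exact: sub_ball_norm.
Qed.

Lemma pi_jet_cts u x : Gconv u -> X x -> ~ kinks u x -> forall e, 0 < e ->
  exists2 d, 0 < d & forall y, X y -> ~ kinks u y -> `|y - x| < d ->
    `|pi (y, yb u y) - pi (x, yb u x)| < e.
Proof.
move=> Gu Xx nk e e0; have [_ Px Ex] := Gconvex_diff Gu Xx nk.
have /within_continuousP/(_ _ (A_XP Xx Px) e e0)[d d0 dH] := cpi.
have [d1 d10 dH1] := GxG_inv_cts Xx Px d0.
have [d2' d20 dH2] := Gconvex_jet_cts Gu Xx nk d10.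
exists (Num.min d (Num.min d1 d2')); first by rewrite !lt_min d0 d10.
move=> y Xy nky; rewrite !lt_min => /and3P[yd y1 y2]; have [_ Py Ey] := Gconvex_diff Gu Xy nky.
apply: dH; first exact: A_XP.
rewrite pairB pair_norm_lt yd; apply: (dH1 y _ Xy Py y1).
by rewrite Ex Ey; exact: dH2.
Qed.

Lemma kinksE u : kinks u = \big[setU/set0]_(i < m) kink u X i.
Proof.
apply/seteqP; split=> [x [i ki]|x]; first by rewrite (bigD1 i)//=; left.
by elim/big_rec: _ => // i B _ IH [ki|/IH]; [exists i|].
Qed.

Lemma measurable_kinks u : Gconv u -> measurable (kinks u : set (borel_rV R m)).
Proof.
move=> Gu; have [cu _] := GconvexP Gu; rewrite kinksE.
by apply: bigsetU_measurable => i _; exact: measurable_kink.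
Qed.

Lemma null_kinks u (mu : probability (borel_rV R m) R) : mu `<< @lebesgue_rV R m ->
  Gconv u -> mu (kinks u) = 0%E.
Proof.
move=> mulam Gu; have [cu ex] := GconvexP Gu.
have [nu nuE _] := lebesgue_rV_measure R m; rewrite -nuE in mulam.
have mk i : measurable (kink u X i : set (borel_rV R m)) by exact: measurable_kink.
have k0 i : mu (kink u X i) = 0%E.
  apply: (mulam (kink u X i) _ _ (mk i)) => //; apply/(measure0_null_setP _ (mk i)).
  apply: etrans (congr1 (fun f => f (kink u X i)) nuE) _; apply: null_kink => // x Xx.
  have [r [C [r0 C0 rX H]]] := Gconvex_semisupport Gu Xx; exists r, C; split=> // y yr.
  by have [p tp] := ex y (rX y yr); exists (GxG G y p).1; exact: H.
have [] : measurable (kinks u : set (borel_rV R m)) /\ mu (kinks u) = 0%E; last by [].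
rewrite kinksE; elim/big_rec: _ => [|i B _ [mB B0]]; first by rewrite measure0.
by split; [exact: measurableU|exact: etrans (measureU0 (mk i) mB B0) (k0 i)].
Qed.

Lemma Pi_concave_of_pi : pi_uniformly_concave_along_Gsegments X Y zlo zhi G pi ->
  Pi_uniformly_concave X Y zlo zhi G pi.
Proof.
move=> /pi_concave_GxG[K K0 HK]; exists K => // mu _ mulam u0 u1 G0 G1 t t01.
(* [D] is a measurable common domain: off the null set [N] it agrees with [diff_points] of [u0], of
   [u1] and of their linear combinations. *)
pose N := kinks u0 `|` kinks u1; pose D := X `\` N.
have mN : measurable (N : set (borel_rV R m)) by apply: measurableU; exact: measurable_kinks.
have N0 : mu N = 0%E by rewrite [LHS]measureU0; [exact: null_kinks|exact: measurable_kinks..|exact: null_kinks].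
have mD : measurable (D : set (borel_rV R m)) by apply: measurableD => //; exact: borel_rV_open.
have jet i x : D x -> let u := if i then u1 else u0 in
    [/\ differentiable u x, P (yb u x) & GxG G x (yb u x) = (grad u x, u x)].
  by move=> [Xx nN]; case: i; apply: Gconvex_diff => // k; apply: nN; [right|left].
have dp a b x : D x -> differentiable (fun x => a * u0 x + b * u1 x) x /\
    grad (fun x => a * u0 x + b * u1 x) x = a *: grad u0 x + b *: grad u1 x.
  by move=> Dx; have [d0' _ _] := jet false x Dx; have [d1' _ _] := jet true x Dx; exact: grad_lin.
have dom u : (forall x, D x -> differentiable u x) -> forall x, ~ N x -> diff_points X u x <-> D x.
  by move=> du x nN; split=> [[]//|Dx]; have [Xx _] := Dx; split=> //; exact: du.
pose f u x := pi (x, yb u x).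
pose w x := sqnorm ((grad u1 x, u1 x) - (grad u0 x, u0 x)).
have mf i : measurable_fun (D : set (borel_rV R m)) (f (if i then u1 else u0)).
  apply: measurable_fun_within => x [Xx nN] e e0.
  have [|||d d0 dH] := @pi_jet_cts (if i then u1 else u0) x _ _ _ e e0.
  - by case: i.
  - by [].
  - by case: i => k; apply: nN; [right|left].
  - by exists d => // y [Xy nNy]; apply: dH => //; case: i => k; apply: nNy; [right|left].
have mw : measurable_fun (D : set (borel_rV R m)) w.
  apply: measurable_fun_within => x [Xx nN] e e0.
  have [d d0 dH] := sqnorm_cts ((grad u1 x, u1 x) - (grad u0 x, u0 x)) e0.
  have d2' : 0 < d / 2 by rewrite divr_gt0.
  have [|d1 d10 dH1] := Gconvex_jet_cts G1 Xx _ d2'; first by move=> k; apply: nN; right.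
  have [|d1' d1'0 dH1'] := Gconvex_jet_cts G0 Xx _ d2'; first by move=> k; apply: nN; left.
  exists (Num.min d1 d1'); first by rewrite lt_min d10.
  move=> y [Xy nNy]; rewrite lt_min => /andP[y1 y0]; apply: dH.
  rewrite subr_subACA.
  apply: le_lt_trans (ler_normB _ _) _.
  rewrite (splitr d); apply: ltrD.
    by apply: dH1 => // k; apply: nNy; right.
  by apply: dH1' => // k; apply: nNy; left.
have t1 : 0 <= 1 - t by lra.
have t0 : 0 <= t by lra.
have c0 : 0 <= t * (1 - t) * K by rewrite !mulr_ge0// ltW.
have I0 : (Pi X Y zlo zhi G pi mu u0 <= \int[mu]_(x in D) (f u0 x)%:E)%E.
  apply: (integral_le_ae mN N0) => //; apply: dom => x /(jet false)[]//.
have I1 : (Pi X Y zlo zhi G pi mu u1 <= \int[mu]_(x in D) (f u1 x)%:E)%E.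
  apply: (integral_le_ae mN N0) => //; apply: dom => x /(jet true)[]//.
have Ew : (fun x => u1 x - u0 x) = (fun x => -1 * u0 x + 1 * u1 x).
  by apply/funext => x; ring.
have Iw : (W12norm2 X mu (fun x => u1 x - u0 x)%R <= \int[mu]_(x in D) (w x)%:E)%E.
  rewrite /W12norm2 Ew; apply: (integral_le_ae mN N0).
    by apply: dom => x /(dp (-1) 1)[].
  move=> x [Xx _] nN; have [_ ->] := dp (-1) 1 x (conj Xx nN).
  by rewrite /w pairB scaleN1r scale1r [- grad u0 x + _]addrC.
apply: le_trans (le_integral_comb3 mD (mf false) (mf true) mw t1 t0 c0 I0 I1 Iw) _.
apply: (integral_le_ae mN N0).
  move=> x nN; symmetry; apply: dom => // y /(dp (1 - t) t)[]//.
move=> x Dx _; have [Xx _] := Dx; rewrite lee_fin.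
have [_ P0 E0] := jet false x Dx; have [_ P1 E1] := jet true x Dx.
have [_ gt] := dp (1 - t) t x Dx.
(* With these jets, [Gseg] between the two points and [ybarG] at the jet of the combination are
   [GxG_inv] of the same value. *)
have := HK x _ _ Xx P0 P1 t t01; rewrite E0 E1 /Gseg E0 E1 /= /ybarG gt.
by rewrite /f /w /ybarG; lra.
Qed.

(** * From Pi to pi *)

Lemma GxG_slice_cts x0 p : X x0 -> P p -> forall e, 0 < e -> exists2 d, 0 < d &
  forall x, X x -> `|x - x0| < d -> `|GxG G x p - GxG G x0 p| < e.
Proof.
move=> Xx0 Pp e e0; have /within_continuousP/(_ _ (A_XP Xx0 Pp) e e0)[d d0 dH] := FG_cts.
exists d => // x Xx xd; have [_ ->] := FGE Xx Pp; have [_ ->] := FGE Xx0 Pp.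
by apply: dH; [exact: A_XP|rewrite pairB subrr pair_norml].
Qed.

Lemma Gconvex_slice p : P p -> Gconv (fun x => G (x, p)).
Proof.
move=> Pp; split.
  apply/within_continuousP => x Xx e e0; have [d d0 dH] := GxG_slice_cts Xx Pp e0.
  by exists d => // y Xy /(dH y Xy); rewrite pairB pair_norm_lt => /andP[].
move=> x _; exists p.1, p.2; case: p Pp => y z; rewrite clYZE => -[/= Yy Zz].
by split=> // x' _.
Qed.

Lemma pi_seg_cts x0 p0 p1 t : X x0 -> P p0 -> P p1 -> 0 <= t <= 1 -> forall e, 0 < e ->
  exists2 d, 0 < d & forall x, X x -> `|x - x0| < d ->
    `|pi (x, seg x p0 p1 t) - pi (x0, seg x0 p0 p1 t)| < e.
Proof.
move=> Xx0 Pp0 Pp1 t01 e e0; have [Ps Es] := segP Xx0 Pp0 Pp1 t01.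
have /within_continuousP/(_ _ (A_XP Xx0 Ps) e e0)[d d0 dH] := cpi.
have [d1 d10 dH1] := GxG_inv_cts Xx0 Ps d0.
have d120 : 0 < d1 / 2 by rewrite divr_gt0.
have [r r0 rH] := GxG_slice_cts Xx0 Pp0 d120; have [r' r'0 r'H] := GxG_slice_cts Xx0 Pp1 d120.
exists (Num.min (Num.min d d1) (Num.min r r')); first by rewrite !lt_min d0 d10 r0.
move=> x Xx; rewrite !lt_min => /andP[/andP[xd xd1] /andP[xr xr']].
have [Px Ex] := segP Xx Pp0 Pp1 t01.
apply: dH; first exact: A_XP.
rewrite pairB pair_norm_lt xd; apply: (dH1 x _ Xx Px xd1).
rewrite Ex Es !conv_shift opprD addrACA -!scalerBr.
apply: le_lt_trans (ler_normD _ _) _; rewrite !normrZ.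
have /andP[t0 t1] := t01; rewrite (ger0_norm t0) ger0_norm ?subr_ge0//.
have h : (1 - t) * `|GxG G x p0 - GxG G x0 p0| <= (1 - t) * (d1 / 2).
  by rewrite ler_wpM2l ?subr_ge0// ltW// rH.
have h' : t * `|GxG G x p1 - GxG G x0 p1| <= t * (d1 / 2) by rewrite ler_wpM2l// ltW// r'H.
apply: le_lt_trans (lerD h h') _; rewrite -mulrDl subrK mul1r.
by rewrite ltr_pdivrMr// mulr_natr mulr2n ltrDl.
Qed.

Lemma sqnorm_GxG_cts x0 p0 p1 : X x0 -> P p0 -> P p1 -> forall e, 0 < e ->
  exists2 d, 0 < d & forall x, X x -> `|x - x0| < d ->
    `|sqnorm (GxG G x p1 - GxG G x p0) - sqnorm (GxG G x0 p1 - GxG G x0 p0)| < e.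
Proof.
move=> Xx0 Pp0 Pp1 e e0; have [d d0 dH] := sqnorm_cts (GxG G x0 p1 - GxG G x0 p0) e0.
have d20 : 0 < d / 2 by rewrite divr_gt0.
have [r r0 rH] := GxG_slice_cts Xx0 Pp0 d20; have [r' r'0 r'H] := GxG_slice_cts Xx0 Pp1 d20.
exists (Num.min r r'); first by rewrite !lt_min r0.
move=> x Xx; rewrite lt_min => /andP[xr xr']; apply: dH; rewrite subr_subACA.
apply: le_lt_trans (ler_normB _ _) _; rewrite (splitr d); apply: ltrD; [exact: r'H|exact: rH].
Qed.

(** For [u = G(., p)] the point [ybarG] is [p] for every x, so all the integrands are continuous in
    x and are close to their values at [x0] on a small box. The inequality passes to the limit
    pointwise. *)
Lemma pi_of_Pi_concave : Pi_uniformly_concave X Y zlo zhi G pi ->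
  pi_uniformly_concave_along_Gsegments X Y zlo zhi G pi.
Proof.
move=> [lam lam0 H]; have [c c0 Hc] := GxG_lower_bound.
have n1 : 0 < n.+1%:R :> R by [].
(* [c ^+ 2] converts distances of images into distances of points; [n.+1] compares [sqnorm] with the
   squared sup norm. *)
exists (lam * c ^+ 2 / n.+1%:R); first by rewrite divr_gt0// mulr_gt0// exprn_gt0.
move=> x0 p0 p1 Xx0 Pp0 Pp1 t t01; have /andP[t0 t1] := t01.
have t1' : 0 <= 1 - t by rewrite subr_ge0.
pose k := t * (1 - t) * lam; have k0 : 0 <= k by rewrite !mulr_ge0// ltW.
pose W x := sqnorm (GxG G x p1 - GxG G x p0).
have dlin a b x : X x -> differentiable (fun x => a * G (x, p0) + b * G (x, p1)) x /\
    grad (fun x => a * G (x, p0) + b * G (x, p1)) x = a *: (GxG G x p0).1 + b *: (GxG G x p1).1.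
  by move=> Xx; have [d0 _] := FGE Xx Pp0; have [d1 _] := FGE Xx Pp1; exact: grad_lin.
suff main : k * W x0 <= pi (x0, seg x0 p0 p1 t) - (1 - t) * pi (x0, p0) - t * pi (x0, p1).
  apply: le_trans main; rewrite /k -!mulrA ler_wpM2l// ler_wpM2l// ler_wpM2l ?(ltW lam0)//.
  have h1 := sqnorm_le (p1 - p0); have h2 := sqnorm_ge (GxG G x0 p1 - GxG G x0 p0).
  have {}h2 : (c * `|p1 - p0|) ^+ 2 <= W x0.
    apply: le_trans h2; rewrite lerXn2r ?nnegrE ?mulr_ge0 ?(ltW c0)//; exact: Hc.
  apply: le_trans h2; rewrite mulrA -expr2 exprMn ler_wpM2l ?sqr_ge0//.
  by rewrite ler_pdivrMl.
apply/ler_addgt0Pr => e e0.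
(* The errors add up to [(k + 2) * e']: one [e'] at the interpolated point, [(1 - t) * e' + t * e']
   at the end points, and [k * e'] from the Sobolev term. *)
pose e' := e / (k + 2); have k2 : 0 < k + 2 by rewrite ltr_wpDl.
have e'0 : 0 < e' by rewrite divr_gt0.
have [r r0 rH] := pi_seg_cts Xx0 Pp0 Pp1 t01 e'0.
have pc p : P p -> exists2 d, 0 < d & forall x, X x -> `|x - x0| < d -> `|pi (x, p) - pi (x0, p)| < e'.
  move=> Pp; have /within_continuousP/(_ _ (A_XP Xx0 Pp) _ e'0)[d d0 dH] := cpi.
  by exists d => // x Xx xd; apply: dH; [exact: A_XP|rewrite pairB subrr pair_norml].
have [r1 r10 rH1] := pc p0 Pp0; have [r2 r20 rH2] := pc p1 Pp1.
have [r3 r30 rH3] := sqnorm_GxG_cts Xx0 Pp0 Pp1 e'0.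
have /nbhs_distP[r4 r40 rH4] : nbhs x0 X by exact: open_nbhs_nbhs.
pose s := Num.min r (Num.min (Num.min r1 r2) (Num.min r3 r4)).
have s0 : 0 < s by rewrite !lt_min r0 r10 r20 r30.
have [mu [mulam muB0 muB]] := box_probability x0 s0.
have Bx x : box x0 s x -> [/\ X x, `|x - x0| < r, `|x - x0| < r1, `|x - x0| < r2 & `|x - x0| < r3].
  rewrite box_ball// => /ballE; rewrite distrC !lt_min => /and3P[? /andP[? ?] /andP[? /rH4 Xx]].
  by split.
have BX : box x0 s `<=` X by move=> x /Bx[].
have dpX u : (forall x, X x -> differentiable u x) -> diff_points X u = X.
  by move=> du; apply/seteqP; split=> [x []//|x Xx]; split=> //; exact: du.
have mB := measurable_box x0 s0.
have lo (f : 'rV[R]_m -> R) a : (forall x, box x0 s x -> a <= f x) -> (a%:E <= \int[mu]_(x in X) (f x)%:E)%E.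
  by move=> fa; apply: (integral_ge_cst mB (muB _ (@subset_refl _ _)) muB0 BX) => x /fa; rewrite lee_fin.
have hi (f : 'rV[R]_m -> R) a : (forall x, box x0 s x -> f x <= a) -> (\int[mu]_(x in X) (f x)%:E <= a%:E)%E.
  by move=> fa; apply: (integral_le_cst mB (muB _ (@subset_refl _ _)) muB0 BX) => x /fa; rewrite lee_fin.
have yslice p x : P p -> X x -> yb (fun x => G (x, p)) x = p by move=> Pp Xx; exact: GxG_invK.
have Pislice p : P p -> Pi X Y zlo zhi G pi mu (fun x => G (x, p)) = (\int[mu]_(x in X) (pi (x, p))%:E)%E.
  move=> Pp; rewrite /Pi dpX; last by move=> x Xx; have [] := FGE Xx Pp.
  by apply: eq_integral => x; rewrite inE => Xx; rewrite yslice.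
have E0 : ((pi (x0, p0) - e')%:E <= Pi X Y zlo zhi G pi mu (fun x => G (x, p0)))%E.
  rewrite Pislice//; apply: lo => x /Bx[Xx _ /(rH1 x Xx) + _ _].
  by rewrite ltr_norml => /andP[/ltW h _]; rewrite lerBlDr -lerBlDl -lerN2 opprB.
have E1 : ((pi (x0, p1) - e')%:E <= Pi X Y zlo zhi G pi mu (fun x => G (x, p1)))%E.
  rewrite Pislice//; apply: lo => x /Bx[Xx _ _ /(rH2 x Xx) + _].
  by rewrite ltr_norml => /andP[/ltW h _]; rewrite lerBlDr -lerBlDl -lerN2 opprB.
have Ew : ((W x0 - e')%:E <= W12norm2 X mu (fun x => G (x, p1) - G (x, p0))%R)%E.
  have -> : (fun x => G (x, p1) - G (x, p0)) = (fun x => -1 * G (x, p0) + 1 * G (x, p1)).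
    by apply/funext => x; ring.
  rewrite /W12norm2 dpX; last by move=> x /(dlin (-1) 1)[].
  apply: lo => x /Bx[Xx _ _ _ /(rH3 x Xx)]; have [_ ->] := dlin (-1) 1 x Xx.
  have -> : (-1 *: (GxG G x p0).1 + 1 *: (GxG G x p1).1, -1 * G (x, p0) + 1 * G (x, p1)) = GxG G x p1 - GxG G x p0.
    by rewrite scaleN1r scale1r mulN1r mul1r addrC [- G _ + _]addrC.
  by rewrite ltr_norml => /andP[/ltW h _]; rewrite lerBlDr -lerBlDl -lerN2 opprB.
have Et : (Pi X Y zlo zhi G pi mu (fun x => (1 - t) * G (x, p0) + t * G (x, p1))%R <=
    (pi (x0, seg x0 p0 p1 t) + e')%:E)%E.
  rewrite /Pi dpX; last by move=> x /(dlin (1 - t) t)[].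
  apply: hi => x /Bx[Xx /(rH x Xx) + _ _ _]; rewrite /ybarG; have [_ ->] := dlin (1 - t) t x Xx.
  by rewrite ltr_norml => /andP[_ /ltW h]; rewrite -lerBlDl.
have muX : mu X = 1%E by exact: muB.
have := H mu muX mulam _ _ (Gconvex_slice Pp0) (Gconvex_slice Pp1) t t01.
move=> /le_trans/(_ Et) Hle.
have : (((1 - t) * (pi (x0, p0) - e') + t * (pi (x0, p1) - e') + k * (W x0 - e'))%:E <=
    (pi (x0, seg x0 p0 p1 t) + e')%:E)%E.
  exact: le_trans (EFin_comb3_le t1' t0 k0 E0 E1 Ew) Hle.
rewrite lee_fin => Hfin.
have : e' * (k + 2) = e by rewrite divfK// gt_eqF.
lra.
Qed.

End setting.

(** * Compactness of the closed domain and conclusion *)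

Lemma compact_closureS (R : realType) (V : normedModType R) (B K : set V) :
  compact K -> B `<=` K -> compact (closure B).
Proof.
move=> cK BK; have clK : closed K by apply: compact_closed => //; exact: norm_hausdorff.
apply: (subclosed_compact _ cK); first exact: closed_closure.
by rewrite (closure_id K).1//; exact: closure_subset.
Qed.

Lemma compact_closure_bounded (R : realType) k (B : set 'rV[R]_k) :
  bounded_set B -> compact (closure B).
Proof.
move=> [M [_ HM]]; apply: compact_closureS (@compact_cball R k 0 (M + 1)) _ => x Bx /=.
by rewrite subr0; apply: (HM (M + 1)) => //; rewrite ltrDl.
Qed.

Lemma compact_closure_XYZ (R : realType) m n (X : set 'rV[R]_m) (Y : set 'rV[R]_n) zlo zhi :
  bounded_set X -> bounded_set Y -> compact (closure (XYZ X Y zlo zhi%:E)).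
Proof.
move=> bX bY; rewrite clXYZE clYZE; apply: compact_setX; first exact: compact_closure_bounded.
apply: compact_setX; first exact: compact_closure_bounded.
apply: compact_closureS (@segment_compact _ zlo zhi) _ => z [z1]; rewrite lte_fin => z2 /=.
by rewrite in_itv /= !ltW.
Qed.

Unset Implicit Arguments.

Theorem theorem4p5 (R : realType) (m n : nat) (le_nm : (n <= m)%N)
    (X : set 'rV[R]_m) (Y : set 'rV[R]_n) (zlo : R) (zhi : \bar R)
    (G pi : 'rV[R]_m * ('rV[R]_n * R) -> R)
    (pnull : 'rV[R]_n * R)
    (a b : R) (lt_a : a < -1) (lt_b : -1 < b) (b_le0 : b <= 0)
    (HG0 : hypG0 X Y zlo zhi G)
    (HG1 : hypG1 X Y zlo zhi G)
    (HG2 : hypG2 X Y zlo zhi G)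
    (HG3 : hypG3 X Y zlo zhi G)
    (HG4 : hypG4 X Y zlo zhi G)
    (HG5 : hypG5 X Y zlo zhi G pi pnull)
    (HG6 : hypG6 X Y zlo zhi G `]a, b[)
    (HbiLip : zhi = +oo%E -> uniformly_biLipschitz X Y zlo zhi G) :
  pi_uniformly_concave_along_Gsegments X Y zlo zhi G pi <->
  Pi_uniformly_concave X Y zlo zhi G pi.
Proof.
have [oX bX oY bY [zlohi _]] := HG0; have [cpi Ppnull _ _] := HG5.
have [/Ck2P[cG [df [d2 [cdf cd2 dfP d2P]]]] rankG] := HG6.
have oX0 : open [set` `]a, b[] by exact: interval_open.
have X0N1 : [set` `]a, b[] (-1) by rewrite /= in_itv /= lt_a.
(* A finite [zhi] gives compactness and [+oo] the bi-Lipschitz bound; [-oo] is excluded by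
   [zlo < zhi]. *)
have ccl : compact (closure (XYZ X Y zlo zhi)) \/ uniformly_biLipschitz X Y zlo zhi G.
  case: (zhi) zlohi HbiLip => [r _ _|_ H|//]; last by right; exact: H.
  by left; exact: compact_closure_XYZ.
split; first exact: (Pi_concave_of_pi oX oY cG cdf cd2 dfP d2P oX0 X0N1 rankG HG1 HG2 ccl Ppnull cpi).
exact: (pi_of_Pi_concave oX oY cG cdf cd2 dfP d2P oX0 X0N1 rankG HG1 HG2 ccl cpi).
Qed.
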